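(* Given $c>0$, there exist $\ell>1$ and $\varepsilon_0>0$ such that for every $k\in K$, $a\in\tilde A^+$, $h\in H$ with $\alpha(\log a)>c$ for all $\alpha\in\tilde\Delta_{\sigma,\theta}$, setting $g=kah$, and every $0<\varepsilon<\varepsilon_0$, $$\mathcal O_\varepsilon g\subset(K\cap\mathcal O_{\ell\varepsilon})k\cdot(A\cap\mathcal O_{\ell\varepsilon})a\cdot(H\cap\mathcal O_{\ell\varepsilon})h.$$
   Context: $G$ connected noncompact semisimple real Lie group with finite center, $\sigma$ an involution, $H$ a closed subgroup whose identity component equals that of the fixed points of $\sigma$, $\theta$ a Cartan involution commuting with $\sigma$, $K$ its fixed points, $\mathfrak p,\mathfrak q$ the $(-1)$-eigenspaces of $\theta,\sigma$ on $\mathfrak g$, $\mathfrak a$ a maximal abelian subspace of $\mathfrak p\cap\mathfrak q$, $A=\exp\mathfrak a$, $\mathfrak g^\alpha$ the root spaces and $\Sigma_\sigma$ the roots of $\mathfrak a$, $\Sigma_\sigma^+$ a positive system. A Riemannian metric on $G$ is fixed and $\mathcal O_\varepsilon$ is the $\varepsilon$-ball at $e$. Let $\mathfrak g^{\sigma\theta}$ be the fixed points of $\sigma\theta$ on $\mathfrak g$, $\tilde\Sigma_{\sigma,\theta}=\{\alpha\in\Sigma_\sigma:\mathfrak g^\alpha\cap\mathfrak g^{\sigma\theta}\ne0\}$ (a root system on $\mathfrak a$), $\tilde\Sigma^+_{\sigma,\theta}=\Sigma_\sigma^+\cap\tilde\Sigma_{\sigma,\theta}$, $\tilde\Delta_{\sigma,\theta}$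 its simple roots, and $\tilde A^+$ the associated closed Weyl chamber in $A$; then $G=K\tilde A^+H$. *)

(* Defs.v *)
From HB Require Import structures.
From mathcomp Require Import all_boot all_order all_algebra.
From mathcomp Require Import all_classical all_reals all_analysis.

Set Implicit Arguments.
Unset Strict Implicit.
Unset Printing Implicit Defensive.

Import Order.TTheory GRing.Theory Num.Theory.
Import numFieldNormedType.Exports.

Local Open Scope classical_set_scope.
Local Open Scope ring_scope.

(* A group carrying a topology. Compatibility of the two, together with the
   Hausdorff axiom, is part of [lieGroup] below. *)
#[short(type="preTopologicalGroupType")]
HB.structure Definition PreTopologicalGroup := {G of Topological G & Group G}.

Definition setmulg (G : groupType) (A B : set G) : set G :=
  [set (x * y)%g | x in A & y in B].

Definition is_subgroup (G : groupType) (H : set G) : Prop :=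
  [/\ H 1%g, forall x y, H x -> H y -> H (x * y)%g & forall x, H x -> H x^-1%g].

Definition group_center (G : groupType) : set G :=
  [set z | forall g, (z * g)%g = (g * z)%g].
Arguments group_center : clear implicits.

(** * Smooth maps and smooth manifolds *)

(* [Ck_on k U f]: f is of class C^k on U. It is meant for U open. *)
Fixpoint Ck_on (R : realType) (V W : normedModType R) (k : nat)
    (U : set V) (f : V -> W) : Prop :=
  match k with
  | 0 => forall x, U x -> {for x, continuous f}
  | k'.+1 => (forall x, U x -> differentiable f x) /\
             (forall v, Ck_on k' U (fun x => 'D_v f x))
  end.

Definition smooth_on (R : realType) (V W : normedModType R)
    (U : set V) (f : V -> W) : Prop := forall k, Ck_on k U f.

(* A chart with values in R^n. The maps are total functions, of which only the
   restrictions to [chart_dom] and to its image [chart_cod] matter. *)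
Record chart (R : realType) (M : topologicalType) (n : nat) := Chart {
  chart_dom : set M;
  chart_map : M -> 'rV[R]_n;
  chart_inv : 'rV[R]_n -> M;
  chart_dom_open : open chart_dom;
  chart_cod_open : open (chart_map @` chart_dom);
  chart_mapK : forall p, chart_dom p -> chart_inv (chart_map p) = p;
  chart_map_continuous : forall p, chart_dom p -> {for p, continuous chart_map};
  chart_inv_continuous : forall x, (chart_map @` chart_dom) x ->
    {for x, continuous chart_inv}
}.

Definition chart_cod (R : realType) (M : topologicalType) (n : nat)
    (c : chart R M n) : set 'rV[R]_n := chart_map c @` chart_dom c.

(* f, read in the charts c and c', on the points where this makes sense *)
Definition smooth_in_charts (R : realType) (M : topologicalType) (n : nat)
    (c c' : chart R M n) (f : M -> M) : Prop :=
  smooth_on [set x | chart_cod c x /\ chart_dom c' (f (chart_inv c x))]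
            (fun x => chart_map c' (f (chart_inv c x))).

(** * Lie groups *)

(* Second countability is not required: it is automatic for connected groups.
   [id_chart] is a chosen chart around the identity, through which the tangent
   space at the identity is identified with R^n. *)
Record lieGroup (R : realType) (n : nat) := LieGroup {
  lie_carrier :> preTopologicalGroupType;
  lie_hausdorff : hausdorff_space lie_carrier;
  lie_mul_continuous :
    continuous (fun p : lie_carrier * lie_carrier => (p.1 * p.2)%g);
  lie_inv_continuous : continuous (fun g : lie_carrier => g^-1%g);
  lie_atlas : set (chart R lie_carrier n);
  lie_atlas_cover : forall g, exists2 c, lie_atlas c & chart_dom c g;
  lie_atlas_compatible : forall c c', lie_atlas c -> lie_atlas c' ->
    smooth_in_charts c c' id;
  lie_mul_smooth : forall c1 c2 c3,
    lie_atlas c1 -> lie_atlas c2 -> lie_atlas c3 ->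
    smooth_on
      [set p : 'rV[R]_n * 'rV[R]_n |
        [/\ chart_cod c1 p.1, chart_cod c2 p.2 &
            chart_dom c3 (chart_inv c1 p.1 * chart_inv c2 p.2)%g]]
      (fun p => chart_map c3 (chart_inv c1 p.1 * chart_inv c2 p.2)%g);
  lie_inv_smooth : forall c c', lie_atlas c -> lie_atlas c' ->
    smooth_in_charts c c' (fun g => g^-1%g);
  id_chart : chart R lie_carrier n;
  id_chart_atlas : lie_atlas id_chart;
  id_chart_dom : chart_dom id_chart 1%g
}.

Section LieGroup.
Context {R : realType} {n : nat}.
Variable G : lieGroup R n.

(* The Lie algebra of G, i.e. the tangent space at the identity. *)
Local Notation g := 'rV[R]_n.

Local Notation phi := (chart_map (id_chart G)).
Local Notation psi := (chart_inv (id_chart G)).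
Local Notation x1 := (phi 1%g).

(* The value at psi x, read in the identity chart, of the left-invariant
   vector field whose value at the identity is v. *)
Definition left_field (v x : g) : g := 'D_v (fun y => phi (psi x * psi y)%g) x1.

(* The commutator of left-invariant vector fields, evaluated at the identity:
   in coordinates [X, Y] = DY(X) - DX(Y). *)
Definition lie_bracket (v w : g) : g :=
  'D_v (left_field w) x1 - 'D_w (left_field v) x1.

Definition one_parameter_subgroup (gamma : R -> G) (v : g) : Prop :=
  [/\ continuous gamma,
      forall s t, gamma (s + t) = (gamma s * gamma t)%g &
      is_derive (0 : R) (1 : R) (phi \o gamma) v].

(* For every v there is exactly one one-parameter subgroup gamma with velocity v,
   so the default value 1 is never used. *)
Definition lie_exp (v : g) : G :=
  xget 1%g [set x | exists2 gamma, one_parameter_subgroup gamma v & gamma 1 = x].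

Definition lie_endomorphism (f : G -> G) : Prop :=
  [/\ forall x y, f (x * y)%g = (f x * f y)%g,
      continuous f &
      forall c c', lie_atlas c -> lie_atlas c' -> smooth_in_charts c c' f].

Definition lie_involution (f : G -> G) : Prop :=
  lie_endomorphism f /\ involutive f.

(* differential at the identity of a map fixing the identity *)
Definition lie_diff (f : G -> G) (v : g) : g := 'D_v (phi \o f \o psi) x1.

(** ** Semisimplicity and Cartan involutions *)

Definition lie_derived (U : {vspace g}) : {vspace g} :=
  <<[seq lie_bracket v w | v <- vbasis U, w <- vbasis U]>>%VS.

Definition lie_solvable (U : {vspace g}) : Prop :=
  exists k, iter k lie_derived U = 0%VS.

Definition lie_ideal (U : {vspace g}) : Prop :=
  forall v w, w \in U -> lie_bracket v w \in U.

Definition semisimple : Prop :=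
  forall U, lie_ideal U -> lie_solvable U -> U = 0%VS.

Definition killing (v w : g) : R :=
  \tr (lin1_mx (lie_bracket v) *m lin1_mx (lie_bracket w)).

Definition cartan_involution (theta : G -> G) : Prop :=
  lie_involution theta /\
  forall v, v != 0 -> 0 < - killing v (lie_diff theta v).

(** ** Restricted roots *)

Definition lie_abelian (a : {vspace g}) : Prop :=
  forall v w, v \in a -> w \in a -> lie_bracket v w = 0.

Definition maximal_abelian_in (E : set g) (a : {vspace g}) : Prop :=
  [/\ forall v, v \in a -> E v,
      lie_abelian a &
      forall b : {vspace g}, (a <= b)%VS -> (forall v, v \in b -> E v) ->
        lie_abelian b -> b = a].

(* The (-1)-eigenspace of the differential of an involution. *)
Definition minus_space (f : G -> G) : set g := [set v | lie_diff f v = - v].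

Section Roots.
Variable a : {vspace g}.

Definition root_space (alpha : 'Hom(subvs_of a, R^o)) : set g :=
  [set X | forall Y : subvs_of a,
             lie_bracket (vsval Y) X = (alpha Y : R) *: X].

Definition restricted_roots : set 'Hom(subvs_of a, R^o) :=
  [set alpha | alpha != 0 /\ exists2 X, X != 0 & root_space alpha X].

(* The roots alpha for which g^alpha meets g^{sigma theta} nontrivially. *)
Definition fixed_roots (sigma theta : G -> G) : set 'Hom(subvs_of a, R^o) :=
  [set alpha | restricted_roots alpha /\
     exists X, [/\ X != 0, root_space alpha X &
                   lie_diff sigma (lie_diff theta X) = X]].

(* The positive systems of S: its elements positive on some regular Y. *)
Definition positive_system (S P : set 'Hom(subvs_of a, R^o)) : Prop :=
  exists Y : subvs_of a, (forall alpha, S alpha -> (alpha Y : R) != 0) /\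
    P = [set alpha | S alpha /\ 0 < (alpha Y : R)].

Definition simple_roots (P : set 'Hom(subvs_of a, R^o)) :
    set 'Hom(subvs_of a, R^o) :=
  [set alpha | P alpha /\
     ~ exists beta gamma, [/\ P beta, P gamma & alpha = beta + gamma]].

Definition exp_image : set G := range (fun Y : subvs_of a => lie_exp (vsval Y)).

(* The inverse of exp : a -> exp a, for a on which exp is injective, as it is on
   abelian subspaces of the (-1)-eigenspace of a Cartan involution. *)
Definition lie_log (x : G) : subvs_of a :=
  xget 0 [set Y : subvs_of a | lie_exp (vsval Y) = x].

Definition closed_chamber (P : set 'Hom(subvs_of a, R^o)) : set G :=
  [set x | exp_image x /\
     forall alpha, P alpha -> 0 <= (alpha (lie_log x) : R)].

End Roots.

(** ** Riemannian metrics *)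

(* The metric in the chart c at the point of coordinates x has Gram matrix
   [gram c x] in the coordinate frame. *)
Record riemannian_metric := RiemannianMetric {
  gram : chart R G n -> 'rV[R]_n -> 'M[R]_n;
  gram_sym : forall c x, lie_atlas c -> chart_cod c x ->
    (gram c x)^T = gram c x;
  gram_pos : forall c x (v : 'rV[R]_n), lie_atlas c -> chart_cod c x -> v != 0 ->
    0 < (v *m gram c x *m v^T) 0 0;
  gram_smooth : forall c, lie_atlas c -> smooth_on (chart_cod c) (gram c);
  gram_change : forall c c' x (u v : 'rV[R]_n),
    lie_atlas c -> lie_atlas c' ->
    chart_cod c x -> chart_dom c' (chart_inv c x) ->
    let tau := chart_map c' \o chart_inv c in
    u *m gram c x *m v^T = 'D_u tau x *m gram c' (tau x) *m ('D_v tau x)^T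
}.

Section Metric.
Variable m : riemannian_metric.

Definition segment_length (c : chart R G n) (u : R -> 'rV[R]_n) : R :=
  \int[lebesgue_measure]_(t in `[0, 1])
     Num.sqrt ((derive1 u t *m gram m c (u t) *m (derive1 u t)^T) 0 0).

(* [curve_length x y l]: some piecewise C^1 curve from x to y has length l. Such a
   curve is given as a finite concatenation of C^1 curves over [0, 1], each
   contained in the domain of one chart; by compactness every piecewise C^1
   curve can be so subdivided. A C^1 curve over [0, 1] is taken as the
   restriction of one over R. *)
Inductive curve_length : G -> G -> R -> Prop :=
| curve_length_nil x : curve_length x x 0
| curve_length_cons (c : chart R G n) (u : R -> 'rV[R]_n) y l :
    lie_atlas c ->
    (forall t, derivable u t 1) -> continuous (derive1 u) ->
    (forall t, t \in `[0, 1] -> chart_cod c (u t)) ->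
    curve_length (chart_inv c (u 1)) y l ->
    curve_length (chart_inv c (u 0)) y (segment_length c u + l).

Definition riemannian_dist (x y : G) : \bar R :=
  ereal_inf [set l%:E | l in curve_length x y].

Definition id_ball (eps : R) : set G :=
  [set x | (riemannian_dist 1%g x < eps%:E)%E].

End Metric.

End LieGroup.

Arguments root_space {R n} G a alpha.
Arguments restricted_roots {R n} G a.
Arguments exp_image {R n} G a.
Arguments lie_log {R n} G a x.
Arguments fixed_roots {R n G} a sigma theta.
Arguments closed_chamber {R n} G {a} P.

(* Main.v *)
(* For X in k, Y in a and Z in h,
     exp(Ad(k) X) exp(Ad(k) Y) exp(Ad(kb) Z) kbh = (exp(Ad(k) X) k) (exp(Y) b) (exp(Z) h),
   so it is enough to write each small element of G as such a triple product with
   X, Y, Z of comparable size. A contraction argument reduces this to the linear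
   problem: decompose each W as X + Y + Ad(b) Z with bounds uniform in b; Ad(k) does
   no harm as it preserves the inner product - killing(v, theta w). The operators
   ad(Y), Y in a, and sigma theta are symmetric for this inner product and commute.
   On the plane spanned by a joint eigenvector e of weight alpha and theta e, the
   linear problem is a 2 x 2 system whose determinant is, up to sign, E + 1/E or
   E - 1/E with E = exp(alpha(log b)). The latter occurs only if sigma theta e = e,
   and then either alpha = 0, where e lies in k + a by maximality of a, or alpha is
   one of the roots for which |alpha(log b)| > c. *)
Require Import Defs.
From HB Require Import structures.
From mathcomp Require Import all_boot all_order all_algebra.
From mathcomp Require Import all_classical all_reals all_analysis.
From mathcomp Require Import ring lra.
Set Implicit Arguments.
Unset Strict Implicit.
Unset Printing Implicit Defensive.

Import Order.TTheory GRing.Theory Num.Theory.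
Import numFieldNormedType.Exports.

Local Open Scope classical_set_scope.
Local Open Scope ring_scope.

(** * Calculus *)

(** The obstacle is that Ad(b) is unbounded over the chamber, so an inverse function theorem applied
    for each b separately would give radii depending on b. The unknown is therefore a single vector
    W: the three factors are exponentials of linear functions of W that add up to W, and the third
    of these functions is Ad(b) Z as a whole. The linear problem must then bound Ad(b) Z as well as
    Z: the former keeps the contraction uniform, the latter puts exp(Z) into the ball in H. The
    radius of the contraction depends only on these operator bounds, hence on neither k nor b.

    The group is given by charts alone. The exponential of v arises as the limit of the 2^k-th
    powers of points with coordinates x_k, and depends only on v = lim 2^k x_k. This freedom in the
    choice of x_k yields additivity along lines, naturality under homomorphisms and uniqueness of
    one-parameter subgroups. The bracket enters as the antisymmetrized bilinear term of the product.
    Since Riemannian and coordinate balls at the identity contain each other up to constant factors,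
    a linear bound in coordinates is enough. *)

Section Calculus.
Context {R : realType}.

Lemma row_norm_le n (x : 'rV[R]_n) (c : R) :
  0 <= c -> (forall j, `|x 0 j| <= c) -> `|x| <= c.
Proof.
move=> c0 xc; rewrite [leLHS]/Num.Def.normr/= mx_normrE.
by apply: bigmax_le => //= -[i j] _; rewrite ord1.
Qed.

Lemma coord_norm_le n (x : 'rV[R]_n) j : `|x 0 j| <= `|x|.
Proof.
rewrite [leRHS]/Num.Def.normr/= mx_normrE.
exact: (le_bigmax _ (fun ij => `|x ij.1 ij.2|) (0, j)).
Qed.

Section Line.
Context {V W : normedModType R}.

Lemma derive_quotient_line (f : V -> W) (p v : V) (t : R) :
  (fun h : R => h^-1 *: (((fun s : R => f (p + s *: v)) \o shift t) (h *: 1)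
      - f (p + t *: v))) =
  (fun h : R => h^-1 *: ((f \o shift (p + t *: v)) (h *: v) - f (p + t *: v))).
Proof.
apply/funext => h /=; congr (_ *: (f _ - _)).
by rewrite scalerDl scaler1 addrCA.
Qed.

Lemma derivable_line (f : V -> W) (p v : V) (t : R) :
  derivable f (p + t *: v) v -> derivable (fun s : R => f (p + s *: v)) t 1.
Proof. by rewrite /derivable derive_quotient_line. Qed.

Lemma derive_line (f : V -> W) (p v : V) (t : R) :
  'D_1 (fun s : R => f (p + s *: v)) t = 'D_v f (p + t *: v).
Proof. by rewrite /derive derive_quotient_line. Qed.

End Line.

(** The norm of a row is the maximum of its coordinates, so the scalar mean value theorem applied to
    each coordinate gives the vector bound with the same constant. *)
Lemma mean_value_path n (g : R -> 'rV[R]_n) (k : R) :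
  (forall t : R, 0 <= t <= 1 -> derivable g t 1) ->
  (forall t : R, 0 <= t <= 1 -> `|'D_1 g t| <= k) ->
  `|g 1 - g 0| <= k.
Proof.
move=> dg gk.
have k0 : 0 <= k by apply: le_trans (gk 0 _); rewrite ?lexx ?ler01 ?normr_ge0.
apply: row_norm_le => // j; rewrite !mxE.
have dgj (t : R) : 0 <= t <= 1 -> is_derive t 1 (fun s => g s 0 j) ('D_1 g t 0 j).
  move=> t01; split; first exact: (derivable_mxP g t 1).1 (dg t t01) 0 j.
  by rewrite (derive_mx (dg t t01)) mxE.
have /(MVT ltr01)[] : forall x : R, x \in `]0, 1[ ->
    is_derive x 1 (fun s => g s 0 j) ('D_1 g x 0 j).
  by move=> x /andP[/ltW x0 /ltW x1]; apply: dgj; rewrite x0 x1.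
  apply: derivable_within_continuous => x x01; apply/ex_derive/dgj.
  by move: x01; rewrite in_itv.
move=> t /andP[/ltW t0 /ltW t1] ->; rewrite subr0 mulr1.
by apply: le_trans (coord_norm_le _ _) (gk t _); rewrite t0 t1.
Qed.

(** Subtracting [t *: u] turns a bound on the deviation of the derivative from [u] into a mean value
    bound for the corrected path. *)
Lemma mean_value_line (V : normedModType R) n (f : V -> 'rV[R]_n) (p v : V)
    (u : 'rV[R]_n) (k : R) :
  (forall t : R, 0 <= t <= 1 -> derivable f (p + t *: v) v) ->
  (forall t : R, 0 <= t <= 1 -> `|'D_v f (p + t *: v) - u| <= k) ->
  `|f (p + v) - f p - u| <= k.
Proof.
move=> df fk; pose g (t : R) := f (p + t *: v) - t *: u.
have dgt (t : R) : 0 <= t <= 1 -> is_derive t 1 g ('D_v f (p + t *: v) - u).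
  move=> t01; apply: is_deriveB.
    by split; [exact/derivable_line/df|exact: derive_line].
  have : is_derive t 1 (fun s : R => s *: u) ((1 : R) *: u).
    apply: DeriveDef; first by apply/diff_derivable; apply: ex_diff.
    by rewrite deriveE; [rewrite diff_val|apply: ex_diff].
  by rewrite scale1r.
have := @mean_value_path n g k; rewrite /g !scale1r scale0r addr0 scale0r subr0.
rewrite addrAC; apply => t t01; first exact/ex_derive/dgt.
by have [_ ->] := dgt t t01; exact: fk.
Qed.

End Calculus.

(** * Bilinear maps and second-order expansion of a local product *)

Section SecondOrder.
Context {R : realType}.

Lemma linear_row_expand n (W : lmodType R) (f : 'rV[R]_n -> W) v :
  linear f -> f v = \sum_i v 0 i *: f (delta_mx 0 i).
Proof.
move=> lf; pose fM := GRing.isLinear.Build _ _ _ _ _ lf.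
pose fL : {linear _ -> _} := HB.pack f fM.
have {1}-> : f = fL by [].
rewrite {1}[v]row_sum_delta linear_sum; apply: eq_bigr => i _.
by rewrite linearZ.
Qed.

Lemma linear_row_bound n (W : normedModType R) (f : 'rV[R]_n -> W) v :
  linear f -> `|f v| <= (\sum_i `|f (delta_mx 0 i)|) * `|v|.
Proof.
move=> lf; rewrite (linear_row_expand v lf) mulr_suml.
apply: le_trans (ler_norm_sum _ _ _) _; apply: ler_sum => i _.
by rewrite normrZ mulrC ler_wpM2l// coord_norm_le.
Qed.

(** Stated for bare functions, since the brackets, mixed derivatives and forms below are plain
    functions of two arguments. *)
Definition bilinear_map n m (W : lmodType R)
    (B : 'rV[R]_n -> 'rV[R]_m -> W) : Prop :=
  (forall w, linear (B ^~ w)) /\ (forall v, linear (B v)).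

Lemma bilinear_row_expand n m (W : lmodType R)
    (B : 'rV[R]_n -> 'rV[R]_m -> W) v w : bilinear_map B ->
  B v w = \sum_i \sum_j (v 0 i * w 0 j) *: B (delta_mx 0 i) (delta_mx 0 j).
Proof.
move=> [B1 B2]; rewrite (linear_row_expand v (B1 w)); apply: eq_bigr => i _.
rewrite (linear_row_expand w (B2 _)) scaler_sumr; apply: eq_bigr => j _.
by rewrite scalerA.
Qed.

Lemma bilinear_row_bound n m (W : normedModType R)
    (B : 'rV[R]_n -> 'rV[R]_m -> W) : bilinear_map B ->
  exists2 C, 0 < C & forall v w, `|B v w| <= C * `|v| * `|w|.
Proof.
move=> bB; pose S := \sum_i \sum_j `|B (delta_mx 0 i) (delta_mx 0 j)|.
have S0 : 0 <= S by apply: sumr_ge0 => i _; apply: sumr_ge0.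
exists (S + 1) => [|v w]; first by rewrite ltr_wpDl.
apply: (@le_trans _ _ (S * `|v| * `|w|)); last first.
  by rewrite -!mulrA ler_wpM2r ?mulr_ge0// lerDl.
rewrite (bilinear_row_expand v w bB) -mulrA mulr_suml.
apply: le_trans (ler_norm_sum _ _ _) _; apply: ler_sum => i _.
rewrite mulr_suml.
apply: le_trans (ler_norm_sum _ _ _) _; apply: ler_sum => j _.
by rewrite normrZ normrM mulrC ler_wpM2l// ler_pM// coord_norm_le.
Qed.

(** Continuity at each pair of vectors becomes continuity in operator norm: it suffices to control
    the finitely many pairs of basis vectors, each by [e / N], where [N] exceeds the number of
    pairs. *)
Lemma bilinear_family_continuous n m (T : topologicalType) (W : normedModType R)
    (B : T -> 'rV[R]_n -> 'rV[R]_m -> W) (p0 : T) (e : R) :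
  (\forall p \near p0, bilinear_map (B p)) ->
  (forall v w, {for p0, continuous (fun p => B p v w)}) -> 0 < e ->
  \forall p \near p0, forall v w, `|B p v w - B p0 v w| <= e * `|v| * `|w|.
Proof.
move=> bB cB e0; pose N := (n * m).+1%:R : R.
have N0 : 0 < N by rewrite ltr0Sn.
have near_ij : \forall p \near p0, forall i j,
    `|B p (delta_mx 0 i) (delta_mx 0 j) - B p0 (delta_mx 0 i) (delta_mx 0 j)|
      <= e / N.
  apply: filter_forall => i; apply: filter_forall => j.
  have /cvgrPdist_le/(_ (e / N) (divr_gt0 e0 N0)) :=
    cB (delta_mx 0 i) (delta_mx 0 j).
  by apply: filterS => p; rewrite distrC.
have bB0 := nbhs_singleton bB.
near=> p => v w.
have bBp : bilinear_map (B p) by near: p; exact: bB.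
rewrite (bilinear_row_expand v w bBp) (bilinear_row_expand v w bB0) -sumrB.
apply: (@le_trans _ _ (\sum_(i < n) \sum_(j < m) (e / N * (`|v| * `|w|)))).
  apply: le_trans (ler_norm_sum _ _ _) _; apply: ler_sum => i _.
  rewrite -sumrB.
  apply: le_trans (ler_norm_sum _ _ _) _; apply: ler_sum => j _.
  rewrite -scalerBr normrZ normrM mulrC ler_pM// ?mulr_ge0//.
    by move: i j; near: p.
  by rewrite ler_pM// coord_norm_le.
rewrite !sumr_const !card_ord -mulrnA -mulr_natr -!mulrA.
apply: ler_wpM2l; first exact: ltW.
rewrite [X in _ * X <= _]mulrA mulrCA ler_piMr ?mulr_ge0//.
by rewrite ler_pdivrMl// mulr1 ler_nat mulnC leqnSn.
Unshelve. all: by end_near. Qed.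

(** A directional derivative sees only one line, so the two maps may live on different spaces; this
    is how partial derivatives of the product become derivatives in one variable. *)
Lemma derive_along (U V W : normedModType R) (f : U -> W) (g : V -> W) a u b v :
  (forall h : R, f (a + h *: u) = g (b + h *: v)) -> 'D_u f a = 'D_v g b.
Proof.
move=> fg; have := fg 0; rewrite !scale0r !addr0 => fgab.
rewrite /derive (_ : (fun h : R => h^-1 *: ((f \o shift a) (h *: u) - f a)) =
  (fun h : R => h^-1 *: ((g \o shift b) (h *: v) - g b)))//.
by apply/funext => h /=; rewrite fgab [h *: u + a]addrC fg [b + _]addrC.
Qed.

Lemma derive_lincomb (V W : normedModType R) (f g : V -> W) k p w :
  derivable f p w -> derivable g p w ->
  'D_w (fun q => k *: f q + g q) p = k *: 'D_w f p + 'D_w g p.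
Proof.
move=> df dg; have dkf : derivable (k *: f) p w by exact: derivableZ.
by rewrite -deriveZ// -deriveD.
Qed.

Section PairMap.
Context {n : nat}.
Local Notation V := 'rV[R]_n.
Variables (M : V * V -> V) (U : set (V * V)) (a : V).
Hypotheses (openU : open U) (Ua : U (a, a)) (smoothM : smooth_on U M).

Lemma smooth_derive_linear p : U p -> linear (fun v => 'D_v M p).
Proof.
move=> Up k v w; have [dM _] := smoothM 1%N.
by rewrite !deriveE; [rewrite linearP|exact: dM..].
Qed.

Lemma smooth_derive2_linear_out p v : U p -> linear (fun w => 'D_w ('D_v M) p).
Proof.
move=> Up k w w'; have [_ /(_ v)[dM _]] := smoothM 2%N.
by rewrite !deriveE; [rewrite linearP|exact: dM..].
Qed.

Lemma smooth_derive2_linear_in p w : U p -> linear (fun v => 'D_w ('D_v M) p).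
Proof.
move=> Up k v v'; have [_ dM] := smoothM 2%N.
have [dv _] := dM v; have [dv' _] := dM v'.
rewrite -derive_lincomb; [|exact/diff_derivable/dv|exact/diff_derivable/dv'].
apply: near_eq_derive; near=> q; apply: smooth_derive_linear.
by near: q; exact: open_nbhs_nbhs.
Unshelve. all: by end_near. Qed.

(** The two orders of mixed differentiation are treated in parallel, here and in the next lemma;
    each estimate uses the order in which it arises, without exchanging derivatives. *)
Lemma bilinear_derive12 p : U p ->
  bilinear_map (fun v w : V => 'D_(v, 0) ('D_(0, w) M) p).
Proof.
move=> Up; split => [w k v v'|v k w w'] /=.
  have -> : (k *: v + v', 0) = k *: (v, 0) + (v', 0) :> V * V.
    by congr pair; rewrite /= scaler0 addr0.
  exact: (smooth_derive2_linear_out (0, w) Up).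
have -> : (0, k *: w + w') = k *: (0, w) + (0, w') :> V * V.
  by congr pair; rewrite /= scaler0 addr0.
exact: (smooth_derive2_linear_in (v, 0) Up).
Qed.

Lemma bilinear_derive21 p : U p ->
  bilinear_map (fun v w : V => 'D_(0, w) ('D_(v, 0) M) p).
Proof.
move=> Up; split => [w k v v'|v k w w'] /=.
  have -> : (k *: v + v', 0) = k *: (v, 0) + (v', 0) :> V * V.
    by congr pair; rewrite /= scaler0 addr0.
  exact: (smooth_derive2_linear_in (0, w) Up).
have -> : (0, k *: w + w') = k *: (0, w) + (0, w') :> V * V.
  by congr pair; rewrite /= scaler0 addr0.
exact: (smooth_derive2_linear_out (v, 0) Up).
Qed.

Lemma smooth_derive2_continuous p v w :
  U p -> {for p, continuous ('D_w ('D_v M))}.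
Proof.
by move=> Up; have [_ /(_ v)[_ /(_ w)]] := smoothM 2%N; apply.
Qed.

Lemma near_square (P : set (V * V)) : (\forall p \near (a, a), P p) ->
  exists2 r : R, 0 < r &
    forall x y, `|x| < r -> `|y| < r -> P (a + x, a + y).
Proof.
move=> /nbhs_ballP[r r0 rP]; exists r => // x y xr yr; apply: rP.
by split => /=; rewrite -ball_normE /ball_/= opprD addrA subrr sub0r normrN.
Qed.

Hypothesis (unitl : \forall y \near a, M (a, y) = y).
Hypothesis (unitr : \forall x \near a, M (x, a) = x).

Lemma derive_affine (b y : V) (t : R) : 'D_1 (fun s : R => b + s *: y) t = y.
Proof.
have : is_derive t 1 (fun s : R => b + s *: y) (0 + (1 : R) *: y).
  apply: is_deriveD; apply: DeriveDef.
    by apply/diff_derivable; apply: ex_diff.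
  by rewrite deriveE; [rewrite diff_val|apply: ex_diff].
by rewrite scale1r add0r => -[].
Qed.

Lemma derive_unitl x y : (\forall z \near (a + x), M (a, z) = z) ->
  'D_(0, y) M (a, a + x) = y.
Proof.
move=> uz; pose p : V * V := (a, a + x).
have -> : (a, a + x) = p + (0 : R) *: ((0, y) : V * V).
  by rewrite scale0r addr0.
rewrite -derive_line -[RHS](@derive_affine (a + x) y 0).
apply: near_eq_derive.
have cz : (fun s : R => a + x + s *: y) @ 0 --> a + x.
  rewrite -[X in _ --> X]addr0 -(scale0r y).
  exact: (cvgD (cvg_cst (a + x)) (@scalel_continuous R V y 0)).
near=> s.
have <- : M (a, a + x + s *: y) = a + x + s *: y.
  by near: s; have nz := cz _ uz; exact nz.
by congr (M (_, _)); rewrite /= ?scaler0 ?addr0.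
Unshelve. all: by end_near. Qed.

Lemma derive_unitr x y : (\forall z \near (a + x), M (z, a) = z) ->
  'D_(y, 0) M (a + x, a) = y.
Proof.
move=> uz; pose p : V * V := (a + x, a).
have -> : (a + x, a) = p + (0 : R) *: ((y, 0) : V * V).
  by rewrite scale0r addr0.
rewrite -derive_line -[RHS](@derive_affine (a + x) y 0).
apply: near_eq_derive.
have cz : (fun s : R => a + x + s *: y) @ 0 --> a + x.
  rewrite -[X in _ --> X]addr0 -(scale0r y).
  exact: (cvgD (cvg_cst (a + x)) (@scalel_continuous R V y 0)).
near=> s.
have <- : M (a + x + s *: y, a) = a + x + s *: y.
  by near: s; have nz := cz _ uz; exact nz.
by congr (M (_, _)); rewrite /= ?scaler0 ?addr0.
Unshelve. all: by end_near. Qed.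

Lemma unit_square : exists2 r : R, 0 < r & forall x y z, `|x| < r -> `|y| < r ->
  [/\ U (a + x, a + y), 'D_(0, z) M (a, a + x) = z,
      'D_(z, 0) M (a + x, a) = z, M (a, a + x) = a + x
    & M (a + x, a) = a + x].
Proof.
have [r1 r10 U1] := near_square (open_nbhs_nbhs (conj openU Ua)).
have /nbhs_ballP[r2 /= r20 U2] := nbhs_interior unitl.
have /nbhs_ballP[r3 /= r30 U3] := nbhs_interior unitr.
exists (Num.min r1 (Num.min r2 r3)) => [|x y z]; first by rewrite !lt_min r10 r20.
rewrite !lt_min => /and3P[xr1 xr2 xr3] /and3P[yr1 yr2 yr3].
have b2 : ball a r2 (a + x).
  by rewrite -ball_normE /ball_/= opprD addrA subrr sub0r normrN.
have b3 : ball a r3 (a + x).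
  by rewrite -ball_normE /ball_/= opprD addrA subrr sub0r normrN.
split; [exact: U1|exact/derive_unitl/U2|exact/derive_unitr/U3| |].
- exact: (nbhs_singleton (U2 _ b2)).
- exact: (nbhs_singleton (U3 _ b3)).
Qed.

Lemma convex_norm_lt (x x' : V) (r t : R) :
  `|x| < r -> `|x'| < r -> 0 <= t <= 1 -> `|x + t *: (x' - x)| < r.
Proof.
move=> xr x'r /andP[t0 t1].
have -> : x + t *: (x' - x) = (1 - t) *: x + t *: x'.
  by rewrite scalerBr scalerBl scale1r addrAC addrA.
apply: le_lt_trans (ler_normD _ _) _; rewrite !normrZ !ger0_norm ?subr_ge0//.
have [->|t0'] := eqVneq t 0; first by rewrite subr0 mul1r mul0r addr0.
have : t * `|x'| < t * r by rewrite ltr_pM2l// lt_neqAle eq_sym t0'.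
have : (1 - t) * `|x| <= (1 - t) * r by rewrite ler_wpM2l ?subr_ge0// ltW.
lra.
Qed.

Lemma scale_norm_lt (x : V) (r t : R) :
  `|x| < r -> 0 <= t <= 1 -> `|t *: x| < r.
Proof.
move=> xr /andP[t0 t1]; rewrite normrZ ger0_norm//.
by apply: le_lt_trans xr; rewrite ler_piMl.
Qed.

Lemma near_derive12 (e : R) : 0 < e ->
  \forall p \near (a, a), forall v w : V,
    `|'D_(v, 0) ('D_(0, w) M) p - 'D_(v, 0) ('D_(0, w) M) (a, a)|
      <= e * `|v| * `|w|.
Proof.
apply: (@bilinear_family_continuous _ _ _ _
  (fun p (v w : V) => 'D_(v, 0) ('D_(0, w) M) p)).
  near=> p; apply: bilinear_derive12.
  by near: p; exact: open_nbhs_nbhs.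
by move=> v w; exact: smooth_derive2_continuous.
Unshelve. all: by end_near. Qed.

Lemma near_derive21 (e : R) : 0 < e ->
  \forall p \near (a, a), forall v w : V,
    `|'D_(0, w) ('D_(v, 0) M) p - 'D_(0, w) ('D_(v, 0) M) (a, a)|
      <= e * `|v| * `|w|.
Proof.
apply: (@bilinear_family_continuous _ _ _ _
  (fun p (v w : V) => 'D_(0, w) ('D_(v, 0) M) p)).
  near=> p; apply: bilinear_derive21.
  by near: p; exact: open_nbhs_nbhs.
by move=> v w; exact: smooth_derive2_continuous.
Unshelve. all: by end_near. Qed.

(** Two nested mean value estimates: along [d] from [p + e], then along [e] back to the side through
    [p], where the derivative in the direction [d] is exactly [u]. The vector [w] approximates the
    mixed derivative. *)
Lemma second_difference (p d e : V * V) (u w : V) (k : R) :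
  (forall s t : R, 0 <= s <= 1 -> 0 <= t <= 1 ->
     U (p + t *: d + s *: e) /\ `|'D_e ('D_d M) (p + t *: d + s *: e) - w| <= k) ->
  (forall t : R, 0 <= t <= 1 -> 'D_d M (p + t *: d) = u) ->
  `|M (p + e + d) - M (p + e) - (u + w)| <= k.
Proof.
move=> HU Hu.
have dM q : U q -> differentiable M q by have [+ _] := smoothM 1%N; apply.
have dDM q : U q -> differentiable ('D_d M) q.
  by have [_ /(_ d)[+ _]] := smoothM 2%N; apply.
have i01 : 0 <= (1 : R) <= 1 by rewrite ler01 lexx.
apply: (@mean_value_line _ _ _ M (p + e) d (u + w) k) => t t01.
  by have [] := HU 1 t i01 t01; rewrite scale1r addrAC => /dM/diff_derivable.
rewrite addrAC -(Hu t t01) opprD addrA.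
apply: (@mean_value_line _ _ _ ('D_d M) (p + t *: d) e w k) => s s01; last by have [] := HU s t s01 t01.
by have [/dDM/diff_derivable] := HU s t s01 t01.
Qed.

(** The increment in one factor is exact when the other factor is the unit; moving that other factor
    by [y] costs a bounded mixed derivative. The error thus carries the factor [|y|] besides the
    increment, and the product is a small perturbation of addition. *)
Lemma mul_lipschitz : exists C r : R, [/\ 0 < C, 0 < r
  & forall x x' y, `|x| < r -> `|x'| < r -> `|y| < r ->
  `|M (a + x', a + y) - M (a + x, a + y) - (x' - x)| <= C * `|y| * `|x' - x| /\
  `|M (a + y, a + x') - M (a + y, a + x) - (x' - x)| <= C * `|y| * `|x' - x|].
Proof.
have [r0 r00 unit_r0] := unit_square.
have [C1 C10 HC1] := bilinear_row_bound (bilinear_derive12 Ua).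
have [C2 C20 HC2] := bilinear_row_bound (bilinear_derive21 Ua).
have [r1 r10 H1] := near_square (near_derive12 ltr01).
have [r2 r20 H2] := near_square (near_derive21 ltr01).
have b12 x y v w : `|x| < r1 -> `|y| < r1 ->
    `|'D_(v, 0) ('D_(0, w) M) (a + x, a + y)| <= (C1 + 1) * `|v| * `|w|.
  move=> xr yr; rewrite -[X in `|X|](subrK ('D_(v, 0) ('D_(0, w) M) (a, a))).
  apply: le_trans (ler_normD _ _) _.
  by rewrite 2!mulrDl addrC lerD ?HC1//; exact: H1.
have b21 x y v w : `|x| < r2 -> `|y| < r2 ->
    `|'D_(0, w) ('D_(v, 0) M) (a + x, a + y)| <= (C2 + 1) * `|v| * `|w|.
  move=> xr yr; rewrite -[X in `|X|](subrK ('D_(0, w) ('D_(v, 0) M) (a, a))).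
  apply: le_trans (ler_normD _ _) _.
  by rewrite 2!mulrDl addrC lerD ?HC2//; exact: H2.
pose C := C1 + 1 + (C2 + 1).
have C1C : C1 + 1 <= C by rewrite /C; lra.
have C2C : C2 + 1 <= C by rewrite /C; lra.
exists C, (Num.min r0 (Num.min r1 r2)); split; first by rewrite /C; lra.
  by rewrite !lt_min r00 r10.
move=> x x' y; rewrite !lt_min.
move=> /and3P[x0 x1 x2] /and3P[x'0 x'1 x'2] /and3P[y0 y1 y2].
have r0_0 : `|0 : V| < r0 by rewrite normr0.
split.
- have -> : (a + x', a + y) = (a + x, a) + (0, y) + (x' - x, 0) :> V * V.
    by congr pair; rewrite /= ?addr0// -addrA [x + _]addrC subrK.
  have -> : (a + x, a + y) = (a + x, a) + (0, y) :> V * V.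
    by congr pair; rewrite /= ?addr0.
  rewrite -[X in _ - X]addr0.
  have pt (s t : R) : (a + x, a) + t *: (x' - x, 0) + s *: (0, y) =
      (a + (x + t *: (x' - x)), a + s *: y) :> V * V.
    by congr pair; rewrite /= !scaler0 ?addr0// addrA.
  apply: second_difference => [s t s01 t01|t t01].
    have z0 := convex_norm_lt x0 x'0 t01; have z2 := convex_norm_lt x2 x'2 t01.
    rewrite pt; split.
      by have [] := unit_r0 _ _ 0 z0 (scale_norm_lt y0 s01).
    rewrite subr0; apply: le_trans (b21 _ _ _ _ z2 (scale_norm_lt y2 s01)) _.
    by rewrite mulrAC -!mulrA ler_wpM2r ?mulr_ge0.
  have := pt 0 t; rewrite !scale0r !addr0 => ->.
  by have [] := unit_r0 _ _ (x' - x) (convex_norm_lt x0 x'0 t01) r0_0.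
- have -> : (a + y, a + x') = (a, a + x) + (y, 0) + (0, x' - x) :> V * V.
    by congr pair; rewrite /= ?addr0// -addrA [x + _]addrC subrK.
  have -> : (a + y, a + x) = (a, a + x) + (y, 0) :> V * V.
    by congr pair; rewrite /= ?addr0.
  rewrite -[X in _ - X]addr0.
  have pt (s t : R) : (a, a + x) + t *: (0, x' - x) + s *: (y, 0) =
      (a + s *: y, a + (x + t *: (x' - x))) :> V * V.
    by congr pair; rewrite /= !scaler0 ?addr0// addrA.
  apply: second_difference => [s t s01 t01|t t01].
    have z0 := convex_norm_lt x0 x'0 t01; have z1 := convex_norm_lt x1 x'1 t01.
    rewrite pt; split.
      by have [] := unit_r0 _ _ 0 (scale_norm_lt y0 s01) z0.
    rewrite subr0; apply: le_trans (b12 _ _ _ _ (scale_norm_lt y1 s01) z1) _.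
    by rewrite -!mulrA ler_wpM2r ?mulr_ge0.
  have := pt 0 t; rewrite !scale0r !addr0 => ->.
  by have [] := unit_r0 _ _ (x' - x) (convex_norm_lt x0 x'0 t01) r0_0.
Qed.

(** The error is a small multiple of [|x| * |y|], not merely of the squared size of the pair; this
    form survives division by the size of one factor, as happens when the product is differentiated
    to give [Ad]. *)
Lemma mul_second_order (e : R) : 0 < e -> exists2 r : R, 0 < r
  & forall x y, `|x| < r -> `|y| < r ->
  `|M (a + x, a + y) - a - x - y - 'D_(x, 0) ('D_(0, y) M) (a, a)|
    <= e * `|x| * `|y|.
Proof.
move=> e0; have [r0 r00 unit_r0] := unit_square.
have [r1 r10 H1] := near_square (near_derive12 e0).
exists (Num.min r0 r1) => [|x y]; first by rewrite lt_min r00.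
rewrite !lt_min => /andP[x0 x1] /andP[y0 y1].
have [_ _ _ _ Mx] := unit_r0 _ _ 0 x0 y0.
have -> : (a + x, a + y) = (a, a) + (x, 0) + (0, y) :> V * V.
  by congr pair; rewrite /= ?addr0.
have {}Mx : M ((a, a) + (x, 0)) = a + x.
  by rewrite -Mx; congr (M (_, _)); rewrite /= addr0.
have -> : M ((a, a) + (x, 0) + (0, y)) - a - x - y
      - 'D_(x, 0) ('D_(0, y) M) (a, a) =
    M ((a, a) + (x, 0) + (0, y)) - M ((a, a) + (x, 0))
      - (y + 'D_(x, 0) ('D_(0, y) M) (a, a)).
  by rewrite Mx !opprD !addrA.
have pt (s t : R) : (a, a) + t *: (0, y) + s *: (x, 0) =
    (a + s *: x, a + t *: y) :> V * V.
  by congr pair; rewrite /= !scaler0 ?addr0.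
apply: second_difference => [s t s01 t01|t t01].
  rewrite pt; split.
    by have [] := unit_r0 _ _ 0 (scale_norm_lt x0 s01) (scale_norm_lt y0 t01).
  exact: (H1 _ _ (scale_norm_lt x1 s01) (scale_norm_lt y1 t01)).
have := pt 0 t; rewrite !scale0r !addr0 => ->.
by have [] := unit_r0 _ _ y (scale_norm_lt y0 t01) x0.
Qed.

End PairMap.

End SecondOrder.

(** * Linearization of the squaring map *)

(** Joins completeness to the norm on matrices, for the geometric series and the fixed point theorem
    below. *)
HB.instance Definition _ (R : realType) (m n : nat) := Complete.on 'M[R]_(m, n).

Section LimitBounds.
Context {R : realType} {V : normedModType R} {T : Type} {F : set_system T}.

Lemma cvg_norm_le {FF : ProperFilter F} (f : T -> V) (l : V) (c : R) :
  f @ F --> l -> (\forall x \near F, `|f x| <= c) -> `|l| <= c.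
Proof.
move=> fl fc; apply/ler_addgt0Pr => e e0.
have lf : \forall x \near F, `|l - f x| <= e by exact: (cvgrPdist_le _ _).1 fl e e0.
have /filter_ex[x [fx lx]] : F ((fun x => `|f x| <= c) `&` (fun x => `|l - f x| <= e)).
  exact: filterI.
rewrite -[l](subrK (f x)) addrC.
by apply: le_trans (ler_normD _ _) _; exact: lerD.
Qed.

Lemma cvg_dominated {FF : Filter F} (f g : T -> V) (h : T -> R) (l : V) :
  g @ F --> l -> h @ F --> (0 : R) ->
  (\forall x \near F, `|f x - g x| <= h x) -> f @ F --> l.
Proof.
move=> gl h0 fgh; apply: cvg_sub0 gl; apply/cvgr0Pnorm_le => e e0.
have := @cvgr0_norm_le _ _ _ _ FF h h0 e e0; apply: filterS2 fgh => x /= fgx hx.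
by apply: le_trans fgx _; apply: le_trans (ler_norm _) hx.
Qed.

End LimitBounds.

Section Koenigs.
Context {R : realType} {n : nat}.
Local Notation V := 'rV[R]_n.

Lemma geometric_cvg (u : nat -> V) (K : R) :
  (forall k, `|u k.+1 - u k| <= K / 2 ^+ k) -> cvgn u.
Proof.
move=> uK.
have -> : u = cst (u 0%N) + series (telescope u).
  by apply/funext => k; rewrite eq_sum_telescope.
apply: is_cvgD; first exact: is_cvg_cst.
apply: normed_cvg; apply: (@series_le_cvg _ _ (geometric K 2^-1)) => k //=.
- apply: mulr_ge0; last by rewrite exprn_ge0// invr_ge0.
  by have := uK 0%N; rewrite expr0 divr1; apply: le_trans.
- by rewrite exprVn; exact: uK.
- by apply: is_cvg_geometric_series; rewrite ger0_norm ?invr_ge0// invf_lt1// ltr1n.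
Qed.

Variables (q : V -> V) (C r : R).
Hypotheses (C0 : 0 < C) (r0 : 0 < r) (q0 : q 0 = 0).
Hypothesis (q_lip : forall x y : V, `|x| < r -> `|y| < r ->
  `|q x - q y - 2 *: (x - y)| <= C * (`|x| + `|y|) * `|x - y|).

(** The relative error stays bounded independently of [k]. The induction hypothesis is used at
    [rho / 2], since [2 ^+ k.+1 * |x| <= rho] halves to a bound for [2 ^+ k * |x|]; the halved error
    leaves room for that of the last application of [q]. *)
Lemma iter_estimate (k : nat) (rho : R) (x y : V) :
  rho < r -> 4 * C * rho <= 1 ->
  2 ^+ k * `|x| <= rho -> 2 ^+ k * `|y| <= rho ->
  `|iter k q x - iter k q y - 2 ^+ k *: (x - y)|
    <= 4 * C * rho * (2 ^+ k * `|x - y|).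
Proof.
elim: k rho x y => [|k IH] rho x y rho_r Crho xrho yrho.
  rewrite /= expr0 scale1r subrr normr0 mul1r mulr_ge0// mulr_ge0//.
    by rewrite mulr_ge0// ltW.
  by apply: le_trans xrho; rewrite mulr_ge0.
have iter0 j : iter j q 0 = 0 by elim: j => //= j ->.
set K : R := 2 ^+ k in IH *.
have K0 : 0 < K by rewrite exprn_gt0.
have rho0 : 0 <= rho by apply: le_trans xrho; rewrite mulr_ge0// exprn_ge0.
have Crho0 : 0 <= C * rho by rewrite mulr_ge0// ltW.
have IH' (z z' : V) : 2 ^+ k.+1 * `|z| <= rho -> 2 ^+ k.+1 * `|z'| <= rho ->
    `|iter k q z - iter k q z' - K *: (z - z')|
      <= 2 * C * rho * (K * `|z - z'|).
  rewrite exprS -!mulrA -/K => zr z'r.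
  have := IH (rho / 2) z z'; have -> : 4 * C * (rho / 2) = 2 * C * rho by field.
  rewrite -!mulrA; apply; lra.
have bound (z : V) : 2 ^+ k.+1 * `|z| <= rho -> `|iter k q z| <= 3 / 4 * rho.
  move=> zr; have := IH' z 0 zr; rewrite normr0 mulr0 => /(_ rho0).
  rewrite iter0 !subr0 => Hz.
  have : `|iter k q z| <= `|iter k q z - K *: z| + `|K *: z|.
    by rewrite -{1}(subrK (K *: z) (iter k q z)) ler_normD.
  rewrite normrZ gtr0_norm//; move: zr; rewrite exprS -mulrA -/K => zr.
  have Z0 : 0 <= K * `|z| by rewrite mulr_ge0// ltW.
  set Z := K * `|z| in zr Hz Z0 *.
  have : C * rho * Z <= 1 / 4 * Z by rewrite ler_wpM2r//; lra.
  lra.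
have xb := bound x xrho; have yb := bound y yrho.
have bx : `|iter k q x| < r by apply: le_lt_trans xb _; lra.
have by_ : `|iter k q y| < r by apply: le_lt_trans yb _; lra.
rewrite /= exprS -/K.
set X := iter k q x in xb bx *; set Y := iter k q y in yb by_ *.
have H1 := IH' x y xrho yrho; rewrite -/X -/Y in H1.
have H2 := q_lip bx by_.
have H3 : `|q X - q Y - (2 * K) *: (x - y)| <=
    `|q X - q Y - 2 *: (X - Y)| + 2 * `|X - Y - K *: (x - y)|.
  rewrite -[2 * `|_|](_ : `|2 *: (X - Y - K *: (x - y))| = _).
    apply: le_trans (ler_normD _ _).
    by rewrite [2 *: (X - Y - _)]scalerBr scalerA addrA subrK.
  by rewrite normrZ ger0_norm.
set D := K * `|x - y| in H1 *.
have D0 : 0 <= D by rewrite mulr_ge0// ltW.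
have CD : C * rho * D <= 1 / 4 * D by rewrite ler_wpM2r//; lra.
have H4 : `|X - Y| <= 3 / 2 * D.
  have : `|X - Y| <= `|X - Y - K *: (x - y)| + `|K *: (x - y)|.
    by rewrite -{1}(subrK (K *: (x - y)) (X - Y)) ler_normD.
  rewrite normrZ gtr0_norm// -/D; lra.
have H5 : C * (`|X| + `|Y|) * `|X - Y| <= C * (3 / 2 * rho) * (3 / 2 * D).
  apply: ler_pM => //; first by rewrite mulr_ge0 ?addr_ge0// ltW.
  by rewrite ler_pM2l//; lra.
have -> : 2 * K * `|x - y| = 2 * D by rewrite /D mulrA.
by have := mulr_ge0 Crho0 D0; lra.
Qed.

Variable rho : R.
Hypothesis (rho0 : 0 < rho) (rho_r : rho < r) (Crho : 4 * C * rho <= 1).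

(* Koenigs' linearization: [koenigs] conjugates [q], a perturbation of
   [v |-> 2 *: v], to [v |-> 2 *: v]. *)
Definition koenigs (v : V) : V := limn (fun k => iter k q ((2 ^+ k)^-1 *: v)).

Lemma iter_lipschitz (k : nat) (x y : V) :
  2 ^+ k * `|x| <= rho -> 2 ^+ k * `|y| <= rho ->
  `|iter k q x - iter k q y| <= 2 * (2 ^+ k * `|x - y|).
Proof.
move=> xr yr; have := iter_estimate rho_r Crho xr yr.
set X := iter k q x; set Y := iter k q y; set D := 2 ^+ k * `|x - y| => H.
have D0 : 0 <= D by rewrite mulr_ge0// exprn_ge0.
have : 4 * C * rho * D <= 1 * D by rewrite ler_wpM2r.
have : `|X - Y| <= `|X - Y - 2 ^+ k *: (x - y)| + `|2 ^+ k *: (x - y)|.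
  by rewrite -{1}(subrK (2 ^+ k *: (x - y)) (X - Y)) ler_normD.
rewrite normrZ ger0_norm ?exprn_ge0// -/D; lra.
Qed.

(** With [y] equal to [v] divided by [2 ^+ k.+1], consecutive terms are the [k]-th iterates of [q y]
    and [2 *: y]. These points differ by a multiple of [|y| ^+ 2], while [k] iterations magnify
    distances by at most [2 * 2 ^+ k], so the increments decay geometrically. *)
Lemma koenigs_cvg (v : V) : 2 * `|v| < rho ->
  iter k q ((2 ^+ k)^-1 *: v) @[k --> \oo] --> koenigs v.
Proof.
move=> vr; apply: (@geometric_cvg _ (C * `|v| ^+ 2)) => k /=.
pose y : V := (2 ^+ k.+1)^-1 *: v; rewrite -/y.
set N : R := `|v| in vr *; have v0 : 0 <= N by exact: normr_ge0.
have -> : (2 ^+ k)^-1 *: v = 2 *: y.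
  by rewrite scalerA exprS invfM mulrA divff ?mul1r.
rewrite -iterS iterSr.
have yv : `|y| <= N.
  rewrite normrZ ger0_norm ?invr_ge0 ?exprn_ge0// ler_piMl//.
  by rewrite invf_le1 ?exprn_gt0// exprn_ege1// ler1n.
have rr := rho_r; have rho1 := rho0.
have yr : `|y| < r by lra.
have zr : `|0 : V| < r by rewrite normr0.
have := q_lip yr zr; rewrite q0 !subr0 normr0 addr0 => qy.
have Cy : 4 * C * `|y| <= 1.
  by apply: le_trans Crho; rewrite ler_pM2l ?mulr_gt0//; lra.
have qy2 : `|q y| <= 9 / 4 * `|y|.
  have : `|q y| <= `|q y - 2 *: y| + `|2 *: y|.
    by rewrite -{1}(subrK (2 *: y) (q y)) ler_normD.
  rewrite normrZ ger0_norm//.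
  have : 4 * C * `|y| * `|y| <= 1 * `|y| by rewrite ler_wpM2r.
  lra.
have K0 : (0 : R) < 2 ^+ k by rewrite exprn_gt0.
have N2 : 2^-1 * N <= 1 / 2 * N by rewrite div1r.
have Ey : 2 ^+ k * `|y| = 2^-1 * N.
  rewrite normrZ ger0_norm ?invr_ge0 ?exprn_ge0// mulrA exprS invfM mulrCA.
  by rewrite divff ?mulr1// gt_eqF.
have qyk : 2 ^+ k * `|q y| <= rho.
  have : 2 ^+ k * `|q y| <= 2 ^+ k * (9 / 4 * `|y|) by rewrite ler_pM2l.
  rewrite [X in _ <= X]mulrCA Ey; lra.
have y2k : 2 ^+ k * `|2 *: y| <= rho.
  by rewrite normrZ ger0_norm// mulrCA Ey; lra.
apply: le_trans (iter_lipschitz qyk y2k) _.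
rewrite ler_pdivlMr//.
have : 2 ^+ k * `|q y - 2 *: y| <= 2 ^+ k * (C * `|y| * `|y|) by rewrite ler_pM2l.
move=> /(ler_wpM2l (ltW K0)) H.
have -> : 2 * (2 ^+ k * `|q y - 2 *: y|) * 2 ^+ k =
  2 * (2 ^+ k * (2 ^+ k * `|q y - 2 *: y|)) by ring.
have E4 : 2 ^+ k * (2 ^+ k * (C * `|y| * `|y|)) = C * (2^-1 * N) ^+ 2.
  by rewrite -Ey; ring.
rewrite E4 in H; have := mulr_ge0 (ltW C0) (sqr_ge0 N).
rewrite exprMn in H; have -> : C * N ^+ 2 = 4 * (C * (2^-1 ^+ 2 * N ^+ 2)).
  by field.
by have := mulr_ge0 (ltW C0) (sqr_ge0 (2^-1 * N)); rewrite exprMn; lra.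
Qed.

(** Every sequence with the right first-order behaviour has the same limit, not only the exact
    rescalings of [v]. The properties of the exponential are drawn from this freedom. *)
Lemma koenigs_core (v : V) (x : nat -> V) : 2 * `|v| < rho ->
  2 ^+ k *: x k @[k --> \oo] --> v -> iter k q (x k) @[k --> \oo] --> koenigs v.
Proof.
move=> vr xv; apply: (@cvg_dominated _ _ _ _ _ _ _
    (fun k => 2 * `|2 ^+ k *: x k - v|) _ (koenigs_cvg vr)).
  rewrite -(mulr0 2); apply: cvgMl_tmp; apply/norm_cvg0P.
  by apply/subr_cvg0.
have d0 : 0 < rho - `|v| by have : 0 <= `|v| := normr_ge0 v; have := rho0; lra.
have : \forall k \near \oo, `|v - 2 ^+ k *: x k| <= rho - `|v|.
  exact: (cvgrPdist_le _ _).1 xv _ d0.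
apply: filterS => k xk.
have K0 : (0 : R) < 2 ^+ k by rewrite exprn_gt0.
have -> : 2 ^+ k *: x k - v = 2 ^+ k *: (x k - (2 ^+ k)^-1 *: v).
  by rewrite scalerBr scalerA divff ?scale1r// gt_eqF.
rewrite normrZ gtr0_norm//; apply: iter_lipschitz.
  have -> : 2 ^+ k * `|x k| = `|2 ^+ k *: x k| by rewrite normrZ gtr0_norm.
  rewrite -[X in `|X|](subrK v) -[leRHS](subrK `|v|).
  by apply: le_trans (ler_normD _ _) _; rewrite lerD2r distrC.
rewrite normrZ gtr0_norm ?invr_gt0// mulrA divff ?gt_eqF// mul1r.
by have : 0 <= `|v| := normr_ge0 v; lra.
Qed.

(** The constant tends to 0 with [s]: this is strict differentiability at 0, with the identity as
    differential. *)
Lemma koenigs_estimate (s : R) (v w : V) : s <= rho -> 2 * `|v| < rho ->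
  2 * `|w| < rho -> `|v| <= s -> `|w| <= s ->
  `|koenigs v - koenigs w - (v - w)| <= 4 * C * s * `|v - w|.
Proof.
move=> sr vr wr vs ws.
apply: (@cvg_norm_le _ _ _ \oo _ (fun k => iter k q ((2 ^+ k)^-1 *: v)
    - iter k q ((2 ^+ k)^-1 *: w) - (v - w))).
  by apply: cvgB; [apply: cvgB; exact: koenigs_cvg|exact: cvg_cst].
apply: nearW => k.
have K0 : (0 : R) < 2 ^+ k by rewrite exprn_gt0.
have E (u : V) : 2 ^+ k * `|(2 ^+ k)^-1 *: u| = `|u| :> R.
  by rewrite normrZ gtr0_norm ?invr_gt0// mulrA divff ?gt_eqF// mul1r.
have := @iter_estimate k s ((2 ^+ k)^-1 *: v) ((2 ^+ k)^-1 *: w).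
rewrite -scalerBr !E scalerA divff ?gt_eqF// scale1r; apply => //.
  exact: le_lt_trans rho_r.
by apply: le_trans Crho; rewrite ler_pM2l ?mulr_gt0.
Qed.

End Koenigs.

(** * The group near the identity *)

Section LocalGroup.
Context {R : realType} {n : nat} (G : lieGroup R n).
Local Notation V := 'rV[R]_n.
Local Notation phi := (chart_map (id_chart G)).
Local Notation psi := (chart_inv (id_chart G)).
Local Notation x1 := (phi 1%g).
Local Notation dom := (chart_dom (id_chart G)).
Local Notation cod := (chart_cod (id_chart G)).

(** The identity chart translated so that the identity has coordinate 0; [to_coord] and [coord_mul]
    use the same origin. *)
Definition from_coord (x : V) : G := psi (x1 + x).
Definition to_coord (g : G) : V := phi g - x1.
Definition coord_mul (x y : V) : V := to_coord (from_coord x * from_coord y)%g.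
Local Notation P := from_coord.
Local Notation Q := to_coord.

Lemma cvg_mulg (T : Type) (F : set_system T) {FF : Filter F} (f g : T -> G) (a b : G) :
  f @ F --> a -> g @ F --> b -> (f x * g x)%g @[x --> F] --> (a * b)%g.
Proof.
move=> fa gb; apply: (cvg_comp2 fa gb).
exact: (@lie_mul_continuous _ _ G (a, b)).
Qed.

Lemma cvg_invg (T : Type) (F : set_system T) (f : T -> G) (a : G) :
  f @ F --> a -> (f x)^-1%g @[x --> F] --> a^-1%g.
Proof.
move=> fa; apply: (@cvg_comp _ _ _ f (fun g : G => g^-1%g) F (nbhs a)) => //.
exact: lie_inv_continuous.
Qed.

Lemma cvg_expg (T : Type) (F : set_system T) {FF : Filter F} (f : T -> G) (a : G) k :
  f @ F --> a -> (f x ^+ k)%g @[x --> F] --> (a ^+ k)%g.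
Proof.
move=> fa; elim: k => [|k IH]; first exact: cvg_cst.
rewrite expgS; under eq_fun do rewrite expgS.
exact: cvg_mulg.
Qed.

Lemma cvg_group_unique (T : Type) (F : set_system T) {FF : ProperFilter F}
  (f : T -> G) (a b : G) : f @ F --> a -> f @ F --> b -> a = b.
Proof. exact: (@cvg_unique _ (@lie_hausdorff _ _ G)). Qed.

Lemma chart_mapK_cod (x : V) : cod x -> phi (psi x) = x.
Proof. by move=> [g dg <-]; rewrite chart_mapK. Qed.

Lemma chart_inv_dom (x : V) : cod x -> dom (psi x).
Proof. by move=> [g dg <-]; rewrite chart_mapK. Qed.

Lemma cod_unit : cod x1.
Proof. by exists 1%g => //; exact: id_chart_dom. Qed.

Lemma from_coord0 : P 0 = 1%g.
Proof. by rewrite /P addr0 chart_mapK//; exact: id_chart_dom. Qed.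

Lemma to_coord1 : Q 1%g = 0.
Proof. by rewrite /Q subrr. Qed.

Lemma to_coordK g : dom g -> P (Q g) = g.
Proof. by move=> dg; rewrite /P /Q addrC subrK chart_mapK. Qed.

Lemma from_coordK (x : V) : cod (x1 + x) -> Q (P x) = x.
Proof. by move=> cx; rewrite /Q /P chart_mapK_cod// addrC addKr. Qed.

Lemma from_coord_continuous (x : V) : cod (x1 + x) -> {for x, continuous P}.
Proof.
move=> cx; have xD : x1 + z @[z --> x] --> x1 + x.
  exact: (cvgD (cvg_cst x1) (@cvg_id _ (nbhs x))).
by apply: (@cvg_comp _ _ _ _ psi _ _ _ xD); exact: chart_inv_continuous.
Qed.

Lemma to_coord_continuous g : dom g -> {for g, continuous Q}.
Proof.
move=> dg; have c := chart_map_continuous dg.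
exact: (cvgB c (cvg_cst x1)).
Qed.

Definition mul_dom : set (V * V) :=
  [set p | [/\ cod p.1, cod p.2 & dom (psi p.1 * psi p.2)%g]].

Lemma mul_dom_open : open mul_dom.
Proof.
rewrite openE => -[x y] [/= cx cy dxy]; rewrite /interior.
have nx : \forall p \near (x, y), cod p.1.
  by apply: cvg_fst; apply: open_nbhs_nbhs; split=> //; exact: chart_cod_open.
have ny : \forall p \near (x, y), cod p.2.
  by apply: cvg_snd; apply: open_nbhs_nbhs; split=> //; exact: chart_cod_open.
have nd : \forall p \near (x, y), dom (psi p.1 * psi p.2)%g.
  have mc : (psi p.1 * psi p.2)%g @[p --> (x, y)] --> (psi x * psi y)%g.
    apply: cvg_mulg.
      apply: (@cvg_comp _ _ _ fst psi _ (nbhs x)); first exact: cvg_fst.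
      exact: chart_inv_continuous.
    apply: (@cvg_comp _ _ _ snd psi _ (nbhs y)); first exact: cvg_snd.
    exact: chart_inv_continuous.
  apply: mc; apply: open_nbhs_nbhs; split=> //; exact: chart_dom_open.
by near=> p; split; near: p.
Unshelve. all: by end_near. Qed.

Lemma near_cod : \forall x \near x1, cod x.
Proof.
by apply: open_nbhs_nbhs; split; [exact: chart_cod_open|exact: cod_unit].
Qed.

Lemma mul_dom_unit : mul_dom (x1, x1).
Proof.
rewrite /mul_dom /=; split; last by rewrite chart_mapK ?mul1g; exact: id_chart_dom.
  exact: cod_unit.
exact: cod_unit.
Qed.

Let M (p : V * V) : V := phi (psi p.1 * psi p.2)%g.

Lemma mul_smooth : smooth_on mul_dom M.
Proof.
exact: (lie_mul_smooth (id_chart_atlas G) (id_chart_atlas G) (id_chart_atlas G)).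
Qed.

Lemma mul_unitl : \forall y \near x1, M (x1, y) = y.
Proof.
apply: filterS near_cod => y cy /=.
by rewrite /M /= [psi x1]chart_mapK ?mul1g ?chart_mapK_cod//; exact: id_chart_dom.
Qed.

Lemma mul_unitr : \forall x \near x1, M (x, x1) = x.
Proof.
apply: filterS near_cod => x cx /=.
by rewrite /M /= [psi x1]chart_mapK ?mulg1 ?chart_mapK_cod//; exact: id_chart_dom.
Qed.

Lemma local_mul : exists C r : R, [/\ 0 < C, 0 < r
  & forall x y z : V, `|x| < r -> `|y| < r -> `|z| < r ->
  [/\ cod (x1 + x), dom (P x * P y)%g,
    `|coord_mul y z - coord_mul x z - (y - x)| <= C * `|z| * `|y - x|
  & `|coord_mul z y - coord_mul z x - (y - x)| <= C * `|z| * `|y - x| ]].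
Proof.
have [C [r [C0 r0 CL]]] :=
  mul_lipschitz mul_dom_open mul_dom_unit mul_smooth mul_unitl mul_unitr.
have [r' r'0 Ur'] := near_square (open_nbhs_nbhs (conj mul_dom_open mul_dom_unit)).
exists C, (Num.min r r'); split; rewrite ?lt_min ?r0//.
move=> x y z; rewrite !lt_min => /andP[xr xr'] /andP[yr yr'] /andP[zr zr'].
have [cx cy dxy] := Ur' _ _ xr' yr'; split=> //.
  by have [/= H _] := CL x y z xr yr zr; rewrite /coord_mul /Q opprB addrA subrK.
by have [/= _ H] := CL x y z xr yr zr; rewrite /coord_mul /Q opprB addrA subrK.
Qed.

Lemma derive_mul_left_field (y z : V) :
  'D_((0 : V), y) M (z, x1) = left_field G y z.
Proof.
apply: derive_along => h.
have -> : (z, x1) + h *: ((0 : V), y) = (z, x1 + h *: y) :> V * V.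
  by congr pair; rewrite /= ?scaler0 ?addr0.
by [].
Qed.

Lemma derive2_mul_left_field (x y : V) :
  'D_(x, (0 : V)) ('D_((0 : V), y) M) (x1, x1) = 'D_x (left_field G y) x1.
Proof.
apply: derive_along => h; rewrite -derive_mul_left_field//.
have -> : (x1, x1) + h *: (x, (0 : V)) = (x1 + h *: x, x1) :> V * V.
  by congr pair; rewrite /= ?scaler0 ?addr0.
by [].
Qed.

(** The bilinear term in the expansion of the product at the identity; the bracket is its
    antisymmetrization, by mere unfolding. *)
Definition mul_form (x y : V) : V := 'D_x (left_field G y) x1.

Lemma lie_bracketE (x y : V) : lie_bracket G x y = mul_form x y - mul_form y x.
Proof. by []. Qed.

Lemma mul_formE (x y : V) :
  'D_(x, (0 : V)) ('D_((0 : V), y) M) (x1, x1) = mul_form x y.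
Proof. exact: derive2_mul_left_field. Qed.

Lemma mul_form_bilinear : bilinear_map mul_form.
Proof.
have [h1 h2] := bilinear_derive12 mul_dom_open mul_smooth mul_dom_unit.
split => [w k u v|v k w w']; rewrite -!mul_formE; first exact: h1.
exact: h2.
Qed.

Lemma coord_mul_second_order (e : R) : 0 < e -> exists2 r : R, 0 < r
  & forall x y : V, `|x| < r -> `|y| < r ->
  `|coord_mul x y - x - y - mul_form x y| <= e * `|x| * `|y|.
Proof.
move=> e0; have [r r0 Hr] :=
  mul_second_order mul_dom_open mul_dom_unit mul_smooth mul_unitl mul_unitr e0.
exists r; first exact: r0.
move=> x y xr yr; move: (Hr x y xr yr).
rewrite mul_formE.
rewrite /coord_mul /Q -!addrA.
by [].
Qed.

End LocalGroup.

(** * The exponential map *)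

Section Exponential.
Context {R : realType} {n : nat} (G : lieGroup R n).
Local Notation V := 'rV[R]_n.
Local Notation phi := (chart_map (id_chart G)).
Local Notation x1 := (phi 1%g).
Local Notation dom := (chart_dom (id_chart G)).
Local Notation cod := (chart_cod (id_chart G)).
Local Notation P := (@from_coord R n G).
Local Notation Q := (@to_coord R n G).
Local Notation m := (coord_mul G).

(** The existential constants of [local_mul] are fixed by choice once for each group, so that
    [exp_radius] can be a definition. *)
Definition mul_const : R := sval (cid (local_mul G)).
Definition mul_radius : R := sval (cid (svalP (cid (local_mul G)))).
Local Notation C := mul_const.
Local Notation r := mul_radius.

Lemma mul_spec : [/\ 0 < C, 0 < r
  & forall x y z : V, `|x| < r -> `|y| < r -> `|z| < r ->
  [/\ cod (x1 + x), dom (P x * P y)%g,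
    `|m y z - m x z - (y - x)| <= C * `|z| * `|y - x|
  & `|m z y - m z x - (y - x)| <= C * `|z| * `|y - x| ]].
Proof. exact: svalP (cid (svalP (cid (local_mul G)))). Qed.

Lemma mul_const_gt0 : 0 < C. Proof. by have [] := mul_spec. Qed.
Lemma mul_radius_gt0 : 0 < r. Proof. by have [] := mul_spec. Qed.

Lemma cod_radius (x : V) : `|x| < r -> cod (x1 + x).
Proof. by move=> xr; have [_ _ /(_ x x x xr xr xr)[]] := mul_spec. Qed.

Lemma from_coordK_radius (x : V) : `|x| < r -> Q (P x) = x.
Proof. by move=> /cod_radius/from_coordK. Qed.

Lemma from_coord_continuous_radius (x : V) : `|x| < r -> {for x, continuous P}.
Proof. by move=> /cod_radius/from_coord_continuous. Qed.

Lemma from_coord_mul (x y : V) : `|x| < r -> `|y| < r -> P (m x y) = (P x * P y)%g.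
Proof.
by move=> xr yr; have [_ _ /(_ x y x xr yr xr)[_ d _ _]] := mul_spec; exact: to_coordK.
Qed.

Lemma coord_mul0r (x : V) : `|x| < r -> m x 0 = x.
Proof. by move=> xr; rewrite /coord_mul from_coord0 mulg1 from_coordK_radius. Qed.

Lemma coord_mul_lip (x y x' y' : V) : `|x| < r -> `|y| < r -> `|x'| < r -> `|y'| < r ->
  `|m x y - m x' y' - (x - x') - (y - y')|
    <= C * (`|y| * `|x - x'| + `|x'| * `|y - y'|).
Proof.
move=> xr yr x'r y'r; have [_ _ mC] := mul_spec.
have [_ _ H1 _] := mC x' x y x'r xr yr.
have [_ _ _ H2] := mC y' y x' y'r yr x'r.
have -> : m x y - m x' y' - (x - x') - (y - y') =
  (m x y - m x' y - (x - x')) + (m x' y - m x' y' - (y - y')).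
  by rewrite [RHS]addrACA subrKA addrA.
apply: le_trans (ler_normD _ _) _; rewrite mulrDr !mulrA; exact: lerD.
Qed.

(** The bound [(4 * C)^-1] is the smallness condition of the Koenigs estimates; [r / 3] stays
    strictly inside the radius of the local product. *)
Definition exp_radius : R := Num.min (r / 3) (4 * C)^-1.
Local Notation rho := exp_radius.

Lemma exp_radius_spec : [/\ 0 < rho, 3 * rho <= r & 4 * C * rho <= 1].
Proof.
have C0 := mul_const_gt0; have r0 := mul_radius_gt0.
have [h1 h2] : rho <= r / 3 /\ rho <= (4 * C)^-1.
  by split; rewrite /rho ge_min lexx ?orbT.
split.
- by rewrite lt_min divr_gt0// invr_gt0 mulr_gt0.
- by move: h1; rewrite ler_pdivlMr// mulrC.
- by rewrite -ler_pdivlMl ?mulr1// mulr_gt0.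
Qed.

Lemma exp_radius_gt0 : 0 < rho. Proof. by have [] := exp_radius_spec. Qed.
Lemma exp_radius_lt : rho < r.
Proof. by have [] := exp_radius_spec; lra. Qed.
Lemma exp_radius_const : 4 * C * rho <= 1.
Proof. by have [] := exp_radius_spec. Qed.

Let sq (x : V) : V := m x x.

Lemma sq0 : sq 0 = 0.
Proof. by rewrite /sq coord_mul0r// normr0 mul_radius_gt0. Qed.

Lemma sq_lip (x y : V) : `|x| < r -> `|y| < r ->
  `|sq x - sq y - 2 *: (x - y)| <= C * (`|x| + `|y|) * `|x - y|.
Proof.
move=> xr yr; have := coord_mul_lip xr xr yr yr.
by rewrite -mulrDl mulrA -addrA -opprD -mulr2n -scaler_nat.
Qed.

Let q_est := @iter_lipschitz R n sq C r mul_const_gt0 sq0 sq_lip rho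
  exp_radius_lt exp_radius_const.

(** The iterates stay where coordinates multiply like group elements, because [k] steps magnify by
    at most [2 * 2 ^+ k]. *)
Lemma from_coord_iter k (x : V) : 2 ^+ k * `|x| <= rho ->
  P (iter k sq x) = (P x ^+ (2 ^ k))%g.
Proof.
elim: k => [|k IH] // xr.
have [rho0 rho3 _] := exp_radius_spec.
have x0 : 0 <= `|x| := normr_ge0 x.
have k0 : (0 : R) <= 2 ^+ k by rewrite exprn_ge0.
have xr' : 2 ^+ k * `|x| <= rho.
  apply: le_trans xr; rewrite exprS -mulrA; have := mulr_ge0 k0 x0; lra.
have z0 : 2 ^+ k * `|0 : V| <= rho by rewrite normr0 mulr0 ltW.
have iter0 : iter k sq 0 = 0 by elim: (k) => //= j ->; exact: sq0.
have := q_est xr' z0; rewrite iter0 !subr0 => ix.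
have lt_r : `|iter k sq x| < r.
  by apply: le_lt_trans ix _; have := mul_radius_gt0; lra.
by rewrite iterS [sq _]/sq from_coord_mul// IH// -expgnDr addnn -mul2n -expnS.
Qed.

(* [x |-> x * x] is linearized by the exponential map, which Koenigs' limit
   therefore constructs without solving a differential equation. *)
Definition coord_exp : V -> V := koenigs sq.
Local Notation E := coord_exp.

Lemma coord_exp_estimate (s : R) (v w : V) : s <= rho -> 2 * `|v| < rho ->
  2 * `|w| < rho -> `|v| <= s -> `|w| <= s ->
  `|E v - E w - (v - w)| <= 4 * C * s * `|v - w|.
Proof.
exact: (koenigs_estimate mul_const_gt0 mul_radius_gt0 sq0 sq_lip exp_radius_gt0
  exp_radius_lt exp_radius_const).
Qed.

Lemma coord_exp0 : E 0 = 0.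
Proof.
rewrite /coord_exp /koenigs; apply: cvg_lim => //.
apply: cvg_near_cst; apply: nearW => k; rewrite scaler0.
by elim: k => //= j ->; exact: sq0.
Qed.

Lemma coord_exp_second_order (v : V) : 2 * `|v| < rho ->
  `|E v - v| <= 4 * C * `|v| * `|v|.
Proof.
move=> vr; have rho0 := exp_radius_gt0.
have v0 : 0 <= `|v| := normr_ge0 v.
have := @coord_exp_estimate `|v| v 0; rewrite coord_exp0 !subr0; apply => //.
- lra.
- by rewrite normr0 mulr0.
- by rewrite normr0.
Qed.

Lemma coord_exp_le (v : V) : 2 * `|v| < rho -> `|E v| <= 2 * `|v|.
Proof.
move=> vr; have H := coord_exp_second_order vr.
have v0 : 0 <= `|v| := normr_ge0 v.
have cv : 4 * C * `|v| <= 1.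
  apply: le_trans exp_radius_const; rewrite ler_pM2l; first by lra.
  by rewrite mulr_gt0// mul_const_gt0.
have : 4 * C * `|v| * `|v| <= 1 * `|v| by rewrite ler_wpM2r.
have : `|E v| <= `|E v - v| + `|v| by rewrite -{1}(subrK v (E v)) ler_normD.
lra.
Qed.

Lemma local_exp_limit (v : V) (x : nat -> V) : 2 * `|v| < rho ->
  2 ^+ k *: x k @[k --> \oo] --> v ->
  (P (x k) ^+ (2 ^ k))%g @[k --> \oo] --> P (E v).
Proof.
move=> vr xv.
have [rho0 rho3 _] := exp_radius_spec.
have v0 : 0 <= `|v| := normr_ge0 v.
have iv := koenigs_core mul_const_gt0 mul_radius_gt0 sq0 sq_lip exp_radius_gt0
  exp_radius_lt exp_radius_const vr xv.
have Er : `|E v| < r.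
  by apply: le_lt_trans (coord_exp_le vr) _; lra.
have Pc := from_coord_continuous_radius Er.
have Piv : P (iter k sq (x k)) @[k --> \oo] --> P (E v).
  exact: (@cvg_comp _ _ _ (fun k => iter k sq (x k)) P _ _ _ iv Pc).
apply: cvg_trans Piv; apply: near_eq_cvg.
have d0 : 0 < rho - `|v| by lra.
have : \forall k \near \oo, `|v - 2 ^+ k *: x k| <= rho - `|v|.
  exact: (cvgrPdist_le _ _).1 xv _ d0.
apply: filterS => k xk; apply: from_coord_iter.
have K0 : (0 : R) < 2 ^+ k by rewrite exprn_gt0.
have -> : 2 ^+ k * `|x k| = `|2 ^+ k *: x k| by rewrite normrZ gtr0_norm.
rewrite -[X in `|X|](subrK v) -[leRHS](subrK `|v|).
by apply: le_trans (ler_normD _ _) _; rewrite lerD2r distrC.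
Qed.

(** Far from 0 the powers may leave the chart, so the limit is taken in the group. It exists by
    [lexp_limit_aux], hence the default 1 is never a fallback. *)
Definition lexp (v : V) : G :=
  xget 1%g [set g | (P ((2 ^+ k)^-1 *: v) ^+ (2 ^ k))%g @[k --> \oo] --> g].

Lemma pow2_scaleK (v : V) k : 2 ^+ k *: ((2 ^+ k)^-1 *: v) = v.
Proof. by rewrite scalerA divff ?scale1r// expf_neq0// pnatr_eq0. Qed.

Lemma exists_small_scale (v : V) (e : R) : 0 < e ->
  exists j : nat, `|(2 ^+ j)^-1 *: v| < e.
Proof.
move=> e0; exists (Num.bound (`|v| / e)).
rewrite normrZ gtr0_norm ?invr_gt0 ?exprn_gt0// ltr_pdivrMl ?exprn_gt0//.
rewrite -ltr_pdivrMr//.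
have ve0 : 0 <= `|v| / e by rewrite divr_ge0// ltW.
apply: (lt_trans (archi_boundP ve0)).
by rewrite -natrX ltr_nat ltn_expl.
Qed.

Lemma cvg_shift_seq (T : topologicalType) (u : nat -> T) (l : T) (j : nat) :
  u (k + j)%N @[k --> \oo] --> l -> u k @[k --> \oo] --> l.
Proof.
move=> ul A /ul[N _ NA]; exists (N + j)%N => // k /= Nk.
by rewrite -(subnK (leq_trans (leq_addl N j) Nk)); apply: NA; rewrite /= leq_subRL;
  rewrite 1?addnC// (leq_trans _ Nk)// leq_addl.
Qed.

(** Splitting the exponent into [2 ^ k] and a fixed [2 ^ j] reduces to a small multiple of [v],
    where the local limit exists; raising to the fixed power is continuous. *)
Lemma lexp_limit_aux (v : V) : exists g : G, forall x : nat -> V,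
  2 ^+ k *: x k @[k --> \oo] --> v ->
  (P (x k) ^+ (2 ^ k))%g @[k --> \oo] --> g.
Proof.
have rho2 : 0 < rho / 2 by rewrite divr_gt0// exp_radius_gt0.
have [j vj] := exists_small_scale v rho2.
exists (P (E ((2 ^+ j)^-1 *: v)) ^+ (2 ^ j))%g => x xv.
apply: (@cvg_shift_seq _ _ _ j).
under eq_fun do rewrite expnD expgnA.
apply: cvg_expg; apply: local_exp_limit; first by rewrite mulrC -ltr_pdivlMr.
have -> : (fun k => 2 ^+ k *: x (k + j)%N) =
    (fun k => (2 ^+ j)^-1 *: (2 ^+ (k + j) *: x (k + j)%N)).
  apply/funext => k; have e0 : (2 : R) ^+ j != 0 by rewrite expf_neq0// pnatr_eq0.
  by rewrite scalerA exprD mulrCA mulVf// mulr1.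
apply: cvgZl_tmp.
by move: xv; rewrite -(@cvg_shiftn j V (fun k => 2 ^+ k *: x k)).
Qed.

Lemma lexp_limit (v : V) (x : nat -> V) :
  2 ^+ k *: x k @[k --> \oo] --> v ->
  (P (x k) ^+ (2 ^ k))%g @[k --> \oo] --> lexp v.
Proof.
move=> xv; have [g Hg] := lexp_limit_aux v.
have cg : (P ((2 ^+ k)^-1 *: v) ^+ (2 ^ k))%g @[k --> \oo] --> g.
  by apply: Hg; under eq_fun do rewrite pow2_scaleK; exact: cvg_cst.
have cl := @xgetI G 1%g
  [set g : G | (P ((2 ^+ k)^-1 *: v) ^+ (2 ^ k))%g @[k --> \oo] --> g] g cg.
rewrite -/(lexp v) in cl.
by rewrite (cvg_group_unique cl cg); exact: Hg.
Qed.

Lemma lexp_unique (v : V) (x : nat -> V) (g : G) :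
  2 ^+ k *: x k @[k --> \oo] --> v ->
  (P (x k) ^+ (2 ^ k))%g @[k --> \oo] --> g -> lexp v = g.
Proof. by move=> /lexp_limit l1 l2; exact: (cvg_group_unique l1 l2). Qed.

Lemma lexp_small (v : V) : 2 * `|v| < rho -> lexp v = P (E v).
Proof.
move=> vr; have cv : 2 ^+ k *: ((2 ^+ k)^-1 *: v) @[k --> \oo] --> v.
  by under eq_fun do rewrite pow2_scaleK; exact: cvg_cst.
exact: (lexp_unique cv (local_exp_limit vr cv)).
Qed.

Lemma lexp0 : lexp 0 = 1%g.
Proof.
by rewrite lexp_small ?coord_exp0 ?from_coord0// normr0 mulr0 exp_radius_gt0.
Qed.

End Exponential.

(** * Powers, inverses and continuity of the exponential *)

Section OneParameter.
Context {R : realType} {n : nat} (G : lieGroup R n).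
Local Notation V := 'rV[R]_n.
Local Notation phi := (chart_map (id_chart G)).
Local Notation psi := (chart_inv (id_chart G)).
Local Notation x1 := (phi 1%g).
Local Notation dom := (chart_dom (id_chart G)).
Local Notation cod := (chart_cod (id_chart G)).
Local Notation P := (@from_coord R n G).
Local Notation Q := (@to_coord R n G).
Local Notation m := (coord_mul G).
Local Notation C := (mul_const G).
Local Notation r := (mul_radius G).
Local Notation rho := (exp_radius G).
Local Notation E := (coord_exp G).
Local Notation lexp := (lexp G).

Lemma near_eq_cvg_to (T : Type) (U : topologicalType) (F : set_system T)
    {FF : Filter F} (f g : T -> U) (l : U) :
  (\forall x \near F, f x = g x) -> f @ F --> l -> g @ F --> l.
Proof. by move=> fg; apply: cvg_trans; exact: near_eq_cvg. Qed.

Lemma near_dom1 : \forall g \near (1%g : G), dom g.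
Proof.
by apply: open_nbhs_nbhs; split; [exact: chart_dom_open|exact: id_chart_dom].
Qed.

Lemma near_seq_dom (g : nat -> G) : g @ \oo --> (1%g : G) ->
  \forall k \near \oo, dom (g k).
Proof. by move=> g1; have gd := g1 _ near_dom1; exact gd. Qed.

Lemma to_coord_cvg0 (g : nat -> G) : g @ \oo --> (1%g : G) -> Q (g k) @[k --> \oo] --> (0 : V).
Proof.
move=> g1; rewrite -(to_coord1 G).
apply: (@cvg_comp _ _ _ g Q _ _ _ g1).
exact: to_coord_continuous (id_chart_dom G).
Qed.

Lemma from_coord_cvg1 (x : nat -> V) : x @ \oo --> (0 : V) -> P (x k) @[k --> \oo] --> (1%g : G).
Proof.
move=> x0; rewrite -(from_coord0 G).
apply: (@cvg_comp _ _ _ x P _ _ _ x0).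
by apply: from_coord_continuous_radius; rewrite normr0 mul_radius_gt0.
Qed.

Lemma pow2_scale_cvg0 (x : nat -> V) (v : V) :
  2 ^+ k *: x k @[k --> \oo] --> v -> x @ \oo --> (0 : V).
Proof.
move=> xv.
have -> : x = (fun k => (2^-1 ^+ k) *: (2 ^+ k *: x k)).
  apply/funext => k; have e0 : (2 : R) ^+ k != 0 by rewrite expf_neq0// pnatr_eq0.
  by rewrite scalerA exprVn mulVf// scale1r.
rewrite -(scale0r v); apply: cvgZ => //.
by apply: cvg_expr; rewrite ger0_norm ?invr_ge0// invf_lt1// ltr1n.
Qed.

(** The tool for evaluating the exponential: it suffices to exhibit a sequence tending to the
    identity with velocity [v], whose [2 ^ k]-th powers have a known limit. *)
Lemma lexp_seq (g : nat -> G) (v : V) (h : G) : g @ \oo --> (1%g : G) ->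
  2 ^+ k *: Q (g k) @[k --> \oo] --> v ->
  (g k ^+ (2 ^ k))%g @[k --> \oo] --> h -> lexp v = h.
Proof.
move=> g1 gv gh; apply: (lexp_unique gv).
apply: cvg_trans gh; apply: near_eq_cvg.
have := near_seq_dom g1; apply: filterS => k dk.
by rewrite to_coordK.
Qed.

Lemma near_small (x : nat -> V) (e : R) : 0 < e -> x @ \oo --> (0 : V) ->
  \forall k \near \oo, `|x k| < e.
Proof. by move=> e0 x0; have h := @cvgr0_norm_lt _ _ _ \oo _ x x0 e e0; exact: h. Qed.

(** To first order the product adds coordinates; the error, at most [C * |x k| * |y k|], tends to 0
    even after multiplication by [2 ^+ k]. *)
Lemma pow2_mul (x y : nat -> V) (v w : V) :
  2 ^+ k *: x k @[k --> \oo] --> v -> 2 ^+ k *: y k @[k --> \oo] --> w ->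
  2 ^+ k *: m (x k) (y k) @[k --> \oo] --> v + w.
Proof.
move=> xv yw; have x0 := pow2_scale_cvg0 xv; have y0 := pow2_scale_cvg0 yw.
apply: (@cvg_dominated _ _ _ _ _ _ (fun k => 2 ^+ k *: x k + 2 ^+ k *: y k)
  (fun k => C * `|2 ^+ k *: x k| * `|y k|) (v + w)).
- exact: cvgD.
- rewrite -(mulr0 (C * `|v|)); apply: cvgM.
    by apply: cvgMl_tmp; exact: cvg_norm.
  by rewrite -(normr0 V); exact: cvg_norm.
- have xr := near_small (mul_radius_gt0 G) x0.
  have yr := near_small (mul_radius_gt0 G) y0.
  apply: filterS2 xr yr => k xr yr.
  have zr : `|0 : V| < r by rewrite normr0 mul_radius_gt0.
  have := coord_mul_lip xr yr zr zr.
  rewrite coord_mul0r// !subr0 normr0 mul0r addr0 -addrA -opprD => H.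
  rewrite -scalerDr -scalerBr !normrZ ger0_norm ?exprn_ge0//.
  rewrite [C * _]mulrCA -!mulrA ler_pM2l ?exprn_gt0//.
  by rewrite [`|x k| * _]mulrC.
Qed.

(** The coordinates of an element and of its inverse multiply to 0, so their sum is of second
    order. *)
Lemma pow2_inv (x : nat -> V) (v : V) :
  2 ^+ k *: x k @[k --> \oo] --> v ->
  2 ^+ k *: Q ((P (x k))^-1)%g @[k --> \oo] --> - v.
Proof.
move=> xv; have x0 := pow2_scale_cvg0 xv.
have g1 : ((P (x k))^-1)%g @[k --> \oo] --> (1%g : G).
  by rewrite -invg1; apply: cvg_invg; exact: from_coord_cvg1.
have y0 := to_coord_cvg0 g1; set y := fun k => Q ((P (x k))^-1)%g in y0 *.
apply: (@cvg_dominated _ _ _ _ _ _ (fun k => - (2 ^+ k *: x k))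
  (fun k => C * `|2 ^+ k *: x k| * `|y k|) (- v)).
- exact: cvgN.
- rewrite -(mulr0 (C * `|v|)); apply: cvgM.
    by apply: cvgMl_tmp; exact: cvg_norm.
  by rewrite -(normr0 V); exact: cvg_norm.
- have xr := near_small (mul_radius_gt0 G) x0.
  have yr := near_small (mul_radius_gt0 G) y0.
  have dk := near_seq_dom g1.
  near=> k.
  have zr : `|0 : V| < r by rewrite normr0 mul_radius_gt0.
  have xk : `|x k| < r by near: k.
  have yk : `|y k| < r by near: k.
  have Py : P (y k) = ((P (x k))^-1)%g by apply: to_coordK; near: k; exact: dk.
  have := coord_mul_lip xk yk zr zr.
  rewrite coord_mul0r// !subr0 normr0 mul0r addr0 -addrA -opprD => H.
  rewrite {1}/coord_mul Py mulgV to_coord1 sub0r normrN in H.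
  rewrite opprK -scalerDr !normrZ ger0_norm ?exprn_ge0//.
  rewrite [C * _]mulrCA -!mulrA ler_pM2l ?exprn_gt0// addrC.
  by rewrite [`|x k| * _]mulrC.
Unshelve. all: by end_near. Qed.

Lemma pow2_scaled_cvg (v : V) : 2 ^+ k *: ((2 ^+ k)^-1 *: v) @[k --> \oo] --> v.
Proof. by under eq_fun do rewrite pow2_scaleK; exact: cvg_cst. Qed.

Lemma lexpN (v : V) : lexp (- v) = (lexp v)^-1%g.
Proof.
have xv := @pow2_scaled_cvg v; have x0 := pow2_scale_cvg0 xv.
apply: (lexp_seq _ (pow2_inv xv)).
  by rewrite -invg1; apply: cvg_invg; exact: from_coord_cvg1.
under eq_fun do rewrite expVgn.
by apply: cvg_invg; exact: lexp_limit.
Qed.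

Lemma pow2_exp (x : nat -> V) (v : V) (i : nat) :
  2 ^+ k *: x k @[k --> \oo] --> v ->
  2 ^+ k *: Q (P (x k) ^+ i)%g @[k --> \oo] --> i%:R *: v.
Proof.
move=> xv; have x0 := pow2_scale_cvg0 xv.
elim: i => [|i IH].
  under eq_fun do rewrite expg0 to_coord1 scaler0.
  by rewrite scale0r; exact: cvg_cst.
rewrite -[i.+1]add1n natrD scalerDl scale1r.
have := pow2_mul xv IH; apply: cvg_trans; apply: near_eq_cvg.
have g1 : (P (x k) ^+ i)%g @[k --> \oo] --> (1%g : G).
  by rewrite -(expg1n G i); apply: cvg_expg; exact: from_coord_cvg1.
have := near_seq_dom g1; apply: filterS => k dk.
by rewrite /coord_mul to_coordK// -expgS.
Qed.

Lemma lexpMn (v : V) (i : nat) : lexp (i%:R *: v) = (lexp v ^+ i)%g.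
Proof.
have xv := @pow2_scaled_cvg v; have x0 := pow2_scale_cvg0 xv.
apply: (@lexp_seq (fun k => (P ((2 ^+ k)^-1 *: v) ^+ i)%g)).
- by rewrite -(expg1n G i); apply: cvg_expg; exact: from_coord_cvg1.
- exact: pow2_exp.
under eq_fun do rewrite expgnAC.
by apply: cvg_expg; exact: lexp_limit.
Qed.

Lemma lexp_pow2 (v : V) (j : nat) :
  lexp v = (lexp ((2 ^+ j)^-1 *: v) ^+ (2 ^ j))%g.
Proof. by rewrite -lexpMn natrX pow2_scaleK. Qed.

Lemma near_dist_lt (v : V) (d : R) : 0 < d -> \forall w \near v, `|v - w| < d.
Proof. by move=> d0; have := nbhsx_ballx v d d0; rewrite -ball_normE. Qed.

Lemma coord_exp_continuous (v : V) : 2 * `|v| < rho -> {for v, continuous E}.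
Proof.
move=> vr; have rho0 := exp_radius_gt0 G; have Crho := exp_radius_const G.
have v0 : 0 <= `|v| := normr_ge0 v.
suff Ev : E w @[w --> v] --> E v by exact: Ev.
apply: (@cvg_dominated R V V (nbhs v) _ E (fun=> E v) (fun w => 2 * `|v - w|)).
- exact: cvg_cst.
- rewrite -(mulr0 2); apply: cvgMl_tmp; rewrite -(normr0 V) -(subrr v).
  by apply: cvg_norm; apply: cvgB; [exact: cvg_cst|exact: cvg_id].
- have d0 : 0 < rho / 2 - `|v| by lra.
  apply: filterS (near_dist_lt v d0) => w vw.
  have wv : `|w| <= `|v| + `|v - w|.
    by rewrite distrC -{1}(subrK v w) addrC ler_normD.
  have := @coord_exp_estimate R n G rho w v (lexx _).
  move=> /(_ _ vr); have h1 : 2 * `|w| < rho by lra.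
  have h2 : `|w| <= rho by have := normr_ge0 w; lra.
  have h3 : `|v| <= rho by lra.
  move=> /(_ h1 h2 h3).
  have : 4 * C * rho * `|w - v| <= 1 * `|w - v| by rewrite ler_wpM2r.
  have : `|E w - E v| <= `|E w - E v - (w - v)| + `|w - v|.
    by rewrite -{1}(subrK (w - v) (E w - E v)) ler_normD.
  rewrite [`|v - w|]distrC; lra.
Qed.

(** The exponential is the [2 ^ j]-th power of its value at a small multiple of the vector, where
    the coordinate formula is continuous. *)
Lemma lexp_continuous : continuous lexp.
Proof.
move=> v; have rho0 := exp_radius_gt0 G.
have rho2 : 0 < rho / 2 by rewrite divr_gt0.
have [j vj] := exists_small_scale v rho2.
rewrite /continuous_at.
have -> : lexp = (fun w => lexp ((2 ^+ j)^-1 *: w) ^+ (2 ^ j))%g.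
  by apply/funext => w; exact: lexp_pow2.
apply: (@cvg_expg _ _ _ _ (nbhs v)).
have sc : (2 ^+ j)^-1 *: w @[w --> v] --> (2 ^+ j)^-1 *: v.
  exact: scaler_continuous.
set u := (2 ^+ j)^-1 *: v in vj sc *.
have uc : {for u, continuous lexp}.
  have uE : 2 * `|u| < rho by rewrite mulrC -ltr_pdivlMr.
  have PE : P (E w) @[w --> u] --> lexp u.
    rewrite lexp_small//.
    apply: (@cvg_comp _ _ _ E P _ _ _ (coord_exp_continuous uE)).
    apply: from_coord_continuous_radius.
    apply: le_lt_trans (coord_exp_le uE) _; exact: lt_trans uE (exp_radius_lt G).
  suff lu : lexp w @[w --> u] --> lexp u by exact: lu.
  apply: (@near_eq_cvg_to _ _ (nbhs u) _ (fun w => P (E w)) lexp _ _ PE).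
  have d0 : 0 < rho / 2 - `|u| by lra.
  near=> w; rewrite /= lexp_small//.
  have uw : `|u - w| < rho / 2 - `|u| by near: w; exact: near_dist_lt.
  have : `|w| <= `|u| + `|u - w|.
    by rewrite distrC -{1}(subrK u w) addrC ler_normD.
  lra.
exact: (@cvg_comp _ _ _ (fun w => (2 ^+ j)^-1 *: w) lexp _ _ _ sc uc).
Unshelve. all: by end_near. Qed.

End OneParameter.

(** * One-parameter subgroups *)

Section Homomorphisms.
Context {R : realType} {n : nat} (G : lieGroup R n).
Local Notation V := 'rV[R]_n.
Local Notation phi := (chart_map (id_chart G)).
Local Notation psi := (chart_inv (id_chart G)).
Local Notation x1 := (phi 1%g).
Local Notation dom := (chart_dom (id_chart G)).
Local Notation cod := (chart_cod (id_chart G)).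
Local Notation P := (@from_coord R n G).
Local Notation Q := (@to_coord R n G).
Local Notation m := (coord_mul G).
Local Notation C := (mul_const G).
Local Notation r := (mul_radius G).
Local Notation rho := (exp_radius G).
Local Notation E := (coord_exp G).
Local Notation lexp := (lexp G).

Lemma cvg_expr_half : (2 ^+ k)^-1 @[k --> \oo] --> (0 : R).
Proof.
have -> : (fun k => (2 ^+ k)^-1) = (fun k => (2^-1 : R) ^+ k).
  by apply/funext => k; rewrite exprVn.
by apply: cvg_expr; rewrite ger0_norm ?invr_ge0// invf_lt1// ltr1n.
Qed.

Lemma dyadic_cvg (s : R) : 0 <= s ->
  (2 ^+ k)^-1 * (Num.truncn (2 ^+ k * s))%:R @[k --> \oo] --> s.
Proof.
move=> s0.
apply: (@cvg_dominated R R nat \oo _ _ (fun=> s) (fun k => (2 ^+ k)^-1)).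
- exact: cvg_cst.
- exact: cvg_expr_half.
- apply: nearW => k; have K0 : (0 : R) < 2 ^+ k by rewrite exprn_gt0.
  have ks0 : 0 <= 2 ^+ k * s by rewrite mulr_ge0// ltW.
  have /andP[tl th] := truncn_itv ks0; rewrite -natr1 in th.
  rewrite ler_norml; apply/andP; split.
    rewrite -(ler_pM2l K0) mulrN divff ?gt_eqF// mulrBr mulrA divff ?gt_eqF//; lra.
  rewrite -(ler_pM2l K0) divff ?gt_eqF// mulrBr mulrA divff ?gt_eqF//; lra.
Qed.

Lemma cvg_lexp (T : Type) (F : set_system T) {FF : Filter F} (f : T -> V) (v : V) :
  f @ F --> v -> lexp (f x) @[x --> F] --> lexp v.
Proof. by move=> fv; apply: (@cvg_comp _ _ _ f lexp _ _ _ fv); exact: lexp_continuous. Qed.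

(** Binary truncations of [s] and [t] have the common denominator [2 ^+ k], so both factors are
    powers of one element and the exponents add; continuity does the rest. *)
Lemma lexp_add_nonneg (v : V) (s t : R) : 0 <= s -> 0 <= t ->
  lexp ((s + t) *: v) = (lexp (s *: v) * lexp (t *: v))%g.
Proof.
move=> s0 t0; pose a k := Num.truncn (2 ^+ k * s); pose b k := Num.truncn (2 ^+ k * t).
have ca := dyadic_cvg s0; have cb := dyadic_cvg t0.
have H k : lexp ((2 ^+ k)^-1 * (a k)%:R *: v + (2 ^+ k)^-1 * (b k)%:R *: v) =
  (lexp ((2 ^+ k)^-1 * (a k)%:R *: v) * lexp ((2 ^+ k)^-1 * (b k)%:R *: v))%g.
  rewrite -scalerDl -mulrDr -natrD ![(2 ^+ k)^-1 * _]mulrC -!scalerA !lexpMn.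
  exact: expgnDr.
have c1 : lexp ((2 ^+ k)^-1 * (a k)%:R *: v + (2 ^+ k)^-1 * (b k)%:R *: v)
    @[k --> \oo] --> lexp ((s + t) *: v).
  by rewrite scalerDl; apply: cvg_lexp; apply: cvgD; apply: cvgZr_tmp.
apply: (cvg_group_unique c1); under eq_fun do rewrite H.
by apply: cvg_mulg; apply: cvg_lexp; apply: cvgZr_tmp.
Qed.

Lemma lexp_add (v : V) (s t : R) :
  lexp ((s + t) *: v) = (lexp (s *: v) * lexp (t *: v))%g.
Proof.
have aux (w : V) (p q : R) : 0 <= p -> 0 <= q ->
    lexp ((p - q) *: w) = (lexp (p *: w) * lexp (- q *: w))%g.
  move=> p0 q0; have [pq|/ltW pq] := leP q p.
    have pq0 : 0 <= p - q by rewrite subr_ge0.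
    have := @lexp_add_nonneg w (p - q) q pq0 q0; rewrite subrK => ->.
    by rewrite scaleNr lexpN mulgK.
  have -> : - q *: w = p *: - w + (q - p) *: - w.
    by rewrite -scalerDl addrC subrK scalerN scaleNr.
  have pq0 : 0 <= q - p by rewrite subr_ge0.
  rewrite -scalerDl (@lexp_add_nonneg (- w) p (q - p) p0 pq0) scalerN lexpN.
  by rewrite mulgA mulgV mul1g scalerN -scaleNr opprB.
have [s0|/ltW s0] := leP 0 s; have [t0|/ltW t0] := leP 0 t.
- exact: lexp_add_nonneg.
- by have := @aux v s (- t) s0; rewrite opprK oppr_ge0; apply.
- have s0' : 0 <= - s by rewrite oppr_ge0.
  have := @aux (- v) (- s) t s0' t0.
  by rewrite !scalerN -!scaleNr !opprK opprD !opprK.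
- have := @lexp_add_nonneg (- v) (- s) (- t); rewrite !oppr_ge0 => /(_ s0 t0).
  by rewrite !scalerN -!scaleNr !opprD !opprK.
Qed.

Lemma to_coord_lexp (v : V) : 2 * `|v| < rho -> Q (lexp v) = E v.
Proof.
move=> vr; rewrite lexp_small// from_coordK_radius//.
apply: le_lt_trans (coord_exp_le vr) _; exact: lt_trans vr (exp_radius_lt G).
Qed.

Lemma derive_quotient0 (W : normedModType R) (f : R -> W) :
  (fun h : R => h^-1 *: ((f \o shift 0) (h *: 1) - f 0)) =
  (fun h : R => h^-1 *: (f h - f 0)).
Proof.
by apply/funext => h /=; congr (_ *: (f _ - _)); rewrite addr0 [LHS]mulr1.
Qed.

Lemma lexp_is_derive (v : V) :
  is_derive (0 : R) (1 : R) (phi \o (fun t : R => lexp (t *: v))) v.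
Proof.
have c : (fun h : R => h^-1 *: Q (lexp (h *: v))) @ 0^' --> v.
  apply: (@cvg_dominated R V R 0^' _ _ (fun=> v) (fun h => 4 * C * `|h| * `|v| ^+ 2)).
  - exact: cvg_cst.
  - have lim0 : 4 * C * `|h| * `|v| ^+ 2 @[h --> (0 : R)^'] --> 4 * C * `|0 : R| * `|v| ^+ 2.
      apply: cvgMr_tmp; apply: cvgMl_tmp; apply: cvg_norm; exact: nbhs_dnbhs.
    by rewrite normr0 mulr0 mul0r in lim0.
  - have rho0 := exp_radius_gt0 G.
    have d0 : 0 < rho / (2 * (`|v| + 1)) by rewrite divr_gt0// mulr_gt0// ltr_wpDl.
    near=> h.
    have h0 : h != 0 by near: h; exact: nbhs_dnbhs_neq.
    have hd : `|h| < rho / (2 * (`|v| + 1)) by near: h; exact: dnbhs0_lt.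
    have hr : 2 * `|h *: v| < rho.
      move: hd; rewrite ltr_pdivlMr ?mulr_gt0 ?ltr_wpDl// normrZ => hd.
      apply: le_lt_trans hd; rewrite mulrCA ler_pM2l ?normr_gt0//.
      by rewrite ler_wpM2l// lerDl.
    rewrite to_coord_lexp//.
    have H := coord_exp_second_order hr.
    have -> : h^-1 *: E (h *: v) - v = h^-1 *: (E (h *: v) - h *: v).
      by rewrite scalerBr scalerA mulVf// scale1r.
    rewrite normrZ normfV ler_pdivrMl ?normr_gt0//; apply: le_trans H _.
    by rewrite normrZ le_eqVlt; apply/orP; left; apply/eqP; ring.
have e : (fun h : R => h^-1 *: (((phi \o (fun t : R => lexp (t *: v))) \o shift 0)
    (h *: 1) - (phi \o (fun t : R => lexp (t *: v))) 0)) =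
    (fun h : R => h^-1 *: Q (lexp (h *: v))).
  by rewrite derive_quotient0; apply/funext => h /=; rewrite scale0r lexp0.
split; first by rewrite /derivable e; exact: (cvgP _ c).
by rewrite /derive e; exact: cvg_lim.
Unshelve. all: by end_near. Qed.

Lemma lexp_one_parameter (v : V) :
  one_parameter_subgroup (fun t : R => lexp (t *: v)) v.
Proof.
split; [|exact: lexp_add|exact: lexp_is_derive].
by move=> t; apply: cvg_lexp; exact: scalel_continuous.
Qed.

Lemma derive_along_seq (f : R -> V) (v : V) (h : nat -> R) :
  is_derive (0 : R) (1 : R) f v -> h @ \oo --> (0 : R) -> (forall k, h k != 0) ->
  (h k)^-1 *: (f (h k) - f 0) @[k --> \oo] --> v.
Proof.
move=> [df dv] h0 hn0.
have c : (fun h : R => h^-1 *: ((f \o shift 0) (h *: 1) - f 0)) @ 0^' --> v.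
  by rewrite -dv; exact: df.
have hc : h @ \oo --> 0^'.
  move=> A /= nA; apply: (@filterS nat \oo _ (fun k => h k != 0 -> A (h k))).
    by move=> k; apply; exact: hn0.
  by have hA := h0 _ nA; exact: hA.
rewrite derive_quotient0 in c.
exact: (@cvg_comp _ _ _ h (fun h : R => h^-1 *: (f h - f 0)) _ _ _ hc c).
Qed.

(** The values of [gamma] at [(2 ^+ k)^-1] have velocity [v], and their [2 ^ k]-th powers all equal
    [gamma 1]; this replaces uniqueness for a differential equation. *)
Lemma one_parameter_unique (gamma : R -> G) (v : V) :
  one_parameter_subgroup gamma v -> gamma 1 = lexp v.
Proof.
move=> [cg ga dg].
have g0 : gamma 0 = 1%g.
  have := ga 0 0; rewrite addr0 => g00.
  by rewrite -(mulgK (gamma 0) (gamma 0)) -g00 mulgV.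
have gX (t : R) k : gamma (k%:R * t) = (gamma t ^+ k)%g.
  elim: k => [|k IH]; first by rewrite mul0r expg0.
  by rewrite -natr1 mulrDl mul1r ga IH -expgSr.
apply/esym/(@lexp_seq R n G (fun k => gamma (2 ^+ k)^-1)).
- rewrite -g0; apply: (@cvg_comp _ _ _ (fun k => (2 ^+ k)^-1) gamma _ _ _ cvg_expr_half).
  exact: cg.
- have nz k : ((2 : R) ^+ k)^-1 != 0 by rewrite invr_neq0// expf_neq0// pnatr_eq0.
  have H := derive_along_seq dg cvg_expr_half nz.
  have e : (fun k => 2 ^+ k *: Q (gamma (2 ^+ k)^-1)) =
      (fun k => ((2 ^+ k)^-1)^-1 *: ((phi \o gamma) (2 ^+ k)^-1 - (phi \o gamma) 0)).
    by apply/funext => k; rewrite /= invrK /to_coord g0.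
  by rewrite e; exact: H.
- have -> : (fun k => (gamma ((2 ^+ k)^-1)%R ^+ (2 ^ k))%g) = (fun=> gamma 1).
    apply/funext => k; have e0 : (2 : R) ^+ k != 0 by rewrite expf_neq0// pnatr_eq0.
    by rewrite -gX natrX divff.
  exact: cvg_cst.
Qed.

Lemma lie_expE (v : V) : lie_exp G v = lexp v.
Proof.
rewrite /lie_exp.
have ex : [set x : G | exists2 gamma, one_parameter_subgroup gamma v & gamma 1 = x] (lexp v).
  by exists (fun t : R => lexp (t *: v)); [exact: lexp_one_parameter|rewrite scale1r].
have := @xgetI G 1%g _ _ ex.
by move=> [gamma /one_parameter_unique <- <-].
Qed.

End Homomorphisms.

(** * The adjoint action *)

Section Adjoint.
Context {R : realType} {n : nat} {G : lieGroup R n}.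
Local Notation V := 'rV[R]_n.
Local Notation phi := (chart_map (id_chart G)).
Local Notation psi := (chart_inv (id_chart G)).
Local Notation x1 := (phi 1%g).
Local Notation dom := (chart_dom (id_chart G)).
Local Notation cod := (chart_cod (id_chart G)).
Local Notation P := (@from_coord R n G).
Local Notation Q := (@to_coord R n G).
Local Notation lexp := (lexp G).

(** The part of smoothness that the exponential sees. Endomorphisms and conjugations both satisfy
    it, so that their differentials are treated together. *)
Definition lie_hom (f : G -> G) : Prop :=
  [/\ forall x y, f (x * y)%g = (f x * f y)%g, continuous f,
      forall v : V, derivable (phi \o f \o psi) x1 v & linear (lie_diff f)].

Lemma lie_hom1 (f : G -> G) : lie_hom f -> f 1%g = 1%g.
Proof.
move=> [fM _ _ _]; have := fM 1%g 1%g; rewrite mulg1 => f11.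
by rewrite -(mulgK (f 1%g) (f 1%g)) -f11 mulgV.
Qed.

Lemma lie_homX (f : G -> G) x k : lie_hom f -> f (x ^+ k)%g = (f x ^+ k)%g.
Proof.
move=> hf; have [fM _ _ _] := hf; elim: k => [|k IH]; first exact: lie_hom1.
by rewrite !expgS fM IH.
Qed.

Lemma half_pow_neq0 k : ((2 : R) ^+ k)^-1 != 0.
Proof. by rewrite invr_neq0// expf_neq0// pnatr_eq0. Qed.

Lemma lie_hom_seq (f : G -> G) (v : V) : lie_hom f ->
  2 ^+ k *: Q (f (P ((2 ^+ k)^-1 *: v))) @[k --> \oo] --> lie_diff f v.
Proof.
move=> hf; have [_ _ fd _] := hf.
have F0 : x1 + (0 : R) *: v = x1 by rewrite scale0r addr0.
have dF : is_derive (0 : R) (1 : R) (fun t : R => (phi \o f \o psi) (x1 + t *: v))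
    (lie_diff f v).
  split; first by apply: derivable_line; rewrite F0.
  by rewrite derive_line F0.
have := derive_along_seq dF (@cvg_expr_half R) half_pow_neq0.
have -> : (fun k => ((2 ^+ k)^-1)^-1 *: ((phi \o f \o psi) (x1 + (2 ^+ k)^-1 *: v)
     - (phi \o f \o psi) (x1 + (0 : R) *: v))) =
  (fun k => 2 ^+ k *: Q (f (P ((2 ^+ k)^-1 *: v)))).
  apply/funext => k; rewrite invrK F0 /to_coord /=; congr (_ *: (_ - _)).
  by rewrite chart_mapK ?(lie_hom1 hf)//; exact: id_chart_dom.
by [].
Qed.

(** The images under [f] of the points with coordinates [(2 ^+ k)^-1 *: v] have velocity
    [lie_diff f v], and their powers are images of powers. *)
Lemma lie_hom_lexp (f : G -> G) (v : V) : lie_hom f ->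
  f (lexp v) = lexp (lie_diff f v).
Proof.
move=> hf; have [_ fc _ _] := hf.
have xv := @pow2_scaled_cvg R n v.
have P1 := @from_coord_cvg1 R n G _ (pow2_scale_cvg0 xv).
apply/esym/(@lexp_seq R n G (fun k => f (P ((2 ^+ k)^-1 *: v)))).
- rewrite -(lie_hom1 hf).
  by apply: (@cvg_comp _ _ _ (fun k => P ((2 ^+ k)^-1 *: v)) f _ _ _ P1); exact: fc.
- exact: lie_hom_seq.
- have -> : (fun k => (f (P ((2 ^+ k)^-1 *: v)) ^+ (2 ^ k))%g) =
      (fun k => f (P ((2 ^+ k)^-1 *: v) ^+ (2 ^ k))%g).
    by apply/funext => k; rewrite lie_homX.
  apply: (@cvg_comp _ _ _ (fun k => (P ((2 ^+ k)^-1 *: v) ^+ (2 ^ k))%g) f _ _ _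
    (lexp_limit xv)).
  exact: fc.
Qed.

Lemma lexp_line_inj (v w : V) :
  (forall t : R, lexp (t *: v) = lexp (t *: w)) -> v = w.
Proof.
move=> vw; have [_ dv] := lexp_is_derive G v; have [_ dw] := lexp_is_derive G w.
have e : (fun t : R => lexp (t *: v)) = (fun t : R => lexp (t *: w)) by apply/funext.
by rewrite -[LHS]dv -[RHS]dw e.
Qed.

Lemma lie_diffZ (f : G -> G) (t : R) (v : V) : lie_hom f ->
  lie_diff f (t *: v) = t *: lie_diff f v.
Proof.
move=> [_ _ _ lf]; pose fM := GRing.isLinear.Build _ _ _ _ _ lf.
pose fL : {linear _ -> _} := HB.pack (lie_diff f) fM.
exact: (linearZ_LR fL).
Qed.

(** Identities between differentials are deduced from identities in the group through this
    criterion; multiplicativity and naturality of [Ad] are instances. *)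
Lemma lie_diff_unique (f : G -> G) (v w : V) : lie_hom f ->
  (forall t : R, f (lexp (t *: v)) = lexp (t *: w)) -> lie_diff f v = w.
Proof.
move=> hf H; apply: lexp_line_inj => t.
by rewrite -lie_diffZ// -lie_hom_lexp// H.
Qed.

Lemma differentiable_lie_hom (f : G -> G) :
  (forall x y, f (x * y)%g = (f x * f y)%g) -> continuous f ->
  (exists2 F : V -> V, differentiable F x1 & \forall y \near x1, F y = (phi \o f \o psi) y) ->
  lie_hom f.
Proof.
move=> fM fc [F dF nF]; split => //.
  by move=> v; apply: (near_eq_derivable nF); exact: diff_derivable.
have E v : lie_diff f v = 'D_v F x1 by apply/esym/near_eq_derive.
by move=> k v w; rewrite !E !deriveE// linearP.
Qed.

Lemma lie_endomorphism_hom (f : G -> G) : lie_endomorphism f -> lie_hom f.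
Proof.
move=> [fM fc fs]; apply: differentiable_lie_hom => //.
exists (phi \o f \o psi); last first.
  by apply: filterE.
have [+ _] := fs _ _ (id_chart_atlas G) (id_chart_atlas G) 1%N; apply.
have f1 : f 1%g = 1%g.
  have := fM 1%g 1%g; rewrite mulg1 => f11.
  by rewrite -(mulgK (f 1%g) (f 1%g)) -f11 mulgV.
split; first exact: cod_unit.
by rewrite chart_mapK ?f1//; exact: id_chart_dom.
Qed.

Definition conj_by (g x : G) : G := (g * x * g^-1)%g.

Lemma conj_by_continuous g : continuous (conj_by g).
Proof.
move=> x; apply: (@cvg_mulg _ _ _ _ (nbhs x)); last exact: cvg_cst.
by apply: (@cvg_mulg _ _ _ _ (nbhs x)); [exact: cvg_cst|exact: cvg_id].
Qed.

(** Left translation by [g] may leave the identity chart, so conjugation is read through a chart [c]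
    at [g] and a chart [d] at its inverse: [F1] multiplies by [g] on the left, [F2] by the inverse
    on the right. *)
Lemma conj_by_hom g : lie_hom (conj_by g).
Proof.
apply: differentiable_lie_hom; [|exact: conj_by_continuous|].
  by move=> x y; rewrite /conj_by !mulgA mulgVK.
have [c ac dc] := lie_atlas_cover g.
have [d ad dd] := lie_atlas_cover (g^-1)%g.
have a1 := id_chart_atlas G.
pose M1 (p : V * V) : V := chart_map c (chart_inv c p.1 * psi p.2)%g.
pose M2 (p : V * V) : V := phi (chart_inv c p.1 * chart_inv d p.2)%g.
pose F1 (y : V) : V := M1 (chart_map c g, y).
pose F2 (z : V) : V := M2 (z, chart_map d (g^-1)%g).
have psi1 : psi x1 = 1%g by apply: chart_mapK; exact: id_chart_dom.
have F1x1 : F1 x1 = chart_map c g.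
  by rewrite /F1 /M1 /= psi1 mulg1 chart_mapK.
have dpair1 (a y : V) : differentiable (fun y : V => (a, y)) y.
  by apply: differentiable_pair; [exact: differentiable_cst|].
have dpair2 (a y : V) : differentiable (fun y : V => (y, a)) y.
  by apply: differentiable_pair; [|exact: differentiable_cst].
have dF1 : differentiable F1 x1.
  apply: (@differentiable_comp _ _ _ _ (fun y : V => (chart_map c g, y)) M1) => //.
  have [+ _] := lie_mul_smooth ac a1 ac 1%N; apply.
  split => /=; [by exists g|exact: cod_unit|by rewrite psi1 mulg1 chart_mapK].
have dF2 : differentiable F2 (F1 x1).
  apply: (@differentiable_comp _ _ _ _ (fun y : V => (y, chart_map d (g^-1)%g)) M2) => //.
  have [+ _] := lie_mul_smooth ac ad a1 1%N; apply; rewrite F1x1.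
  split => /=; [by exists g|by exists (g^-1)%g|].
  by rewrite !chart_mapK// mulgV; exact: id_chart_dom.
exists (F2 \o F1); first exact: differentiable_comp.
have gc : (g * psi y)%g @[y --> x1] --> (g * psi x1)%g.
  apply: (@cvg_mulg _ _ _ _ (nbhs x1)); first exact: cvg_cst.
  by apply: chart_inv_continuous; exact: cod_unit.
rewrite psi1 mulg1 in gc; near=> y.
have dy : chart_dom c (g * psi y)%g.
  near: y; have nz := gc (chart_dom c); apply: nz.
  by apply: open_nbhs_nbhs; split => //; exact: chart_dom_open.
by rewrite /F2 /F1 /M1 /M2 /= chart_mapK// chart_mapK// chart_mapK.
Unshelve. all: by end_near. Qed.

Definition Ad (g : G) : V -> V := lie_diff (conj_by g).

Lemma conj_lexp (g : G) (v : V) : (g * lexp v * g^-1)%g = lexp (Ad g v).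
Proof. exact: (lie_hom_lexp v (conj_by_hom g)). Qed.

Lemma Ad_linear g : linear (Ad g).
Proof. by have [] := conj_by_hom g. Qed.

Lemma AdZ g t v : Ad g (t *: v) = t *: Ad g v.
Proof. exact: lie_diffZ (conj_by_hom g). Qed.

Lemma Ad1 v : Ad 1%g v = v.
Proof.
apply: (lie_diff_unique (conj_by_hom _)) => t.
by rewrite /conj_by mul1g invg1 mulg1.
Qed.

Lemma AdM g h v : Ad (g * h)%g v = Ad g (Ad h v).
Proof.
apply: (lie_diff_unique (conj_by_hom _)) => t.
rewrite -(AdZ g) -(AdZ h) -(conj_lexp g) -(conj_lexp h).
by rewrite /conj_by invgM !mulgA.
Qed.

Lemma lie_diff_Ad (f : G -> G) g v : lie_hom f ->
  lie_diff f (Ad g v) = Ad (f g) (lie_diff f v).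
Proof.
move=> hf; have [fM _ _ _] := hf; apply: (lie_diff_unique hf) => t.
have fV : f (g^-1)%g = (f g)^-1%g.
  by apply: (mulgI (f g)); rewrite -fM !mulgV lie_hom1.
rewrite -(AdZ g t v) -(conj_lexp g) !fM fV (lie_hom_lexp _ hf) conj_lexp.
by rewrite (lie_diffZ _ _ hf) AdZ.
Qed.

End Adjoint.

Lemma cvg_le (R : realType) (T : Type) (F : set_system T) {FF : ProperFilter F}
    (f g : T -> R) (a b : R) :
  f @ F --> a -> g @ F --> b -> (\forall x \near F, f x <= g x) -> a <= b.
Proof.
move=> fa gb fg; have h : f x - g x @[x --> F] --> a - b by exact: cvgB.
rewrite -subr_le0 -(cvg_lim _ h)//; apply: (@limr_le _ _ FF); first exact: cvgP h.
by near=> x; rewrite subr_le0; near: x.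
Unshelve. all: by end_near. Qed.

Section BilinearLimits.
Context {R : realType} {p q : nat} {W : normedModType R}.
Variable B : 'rV[R]_p -> 'rV[R]_q -> W.
Hypothesis bB : bilinear_map B.

Lemma bilinearBl u v w : B (u - v) w = B u w - B v w.
Proof. by have := bB.1 w (-1) v u; rewrite !scaleN1r ![- _ + _]addrC. Qed.

Lemma bilinearBr u v w : B u (v - w) = B u v - B u w.
Proof. by have := bB.2 u (-1) w v; rewrite !scaleN1r ![- _ + _]addrC. Qed.

Lemma bilinear0l w : B 0 w = 0.
Proof. by rewrite -(subrr 0) bilinearBl subrr. Qed.

Lemma bilinear0r w : B w 0 = 0.
Proof. by rewrite -(subrr 0) bilinearBr subrr. Qed.

Lemma bilinearZl k u w : B (k *: u) w = k *: B u w.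
Proof. by have := bB.1 w k u 0; rewrite bilinear0l !addr0. Qed.

Lemma bilinearZr k u w : B u (k *: w) = k *: B u w.
Proof. by have := bB.2 u k w 0; rewrite bilinear0r !addr0. Qed.

Lemma cvg_bilinear (T : Type) (F : set_system T) {FF : Filter F}
    (f : T -> 'rV[R]_p) (g : T -> 'rV[R]_q) a b :
  f @ F --> a -> g @ F --> b -> B (f x) (g x) @[x --> F] --> B a b.
Proof.
move=> fa gb; have [K K0 BK] := bilinear_row_bound bB.
apply: (@cvg_dominated R W T F _ _ (fun=> B a b)
  (fun x => K * `|f x - a| * `|g x| + K * `|a| * `|g x - b|)).
- exact: cvg_cst.
- have -> : (0 : R) = K * `|a - a| * `|b| + K * `|a| * `|b - b|.
    by rewrite !subrr !normr0 !mulr0 mul0r addr0.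
  apply: cvgD; apply: cvgM.
  + by apply: cvgMl_tmp; apply: cvg_norm; apply: cvgB => //; exact: cvg_cst.
  + exact: cvg_norm.
  + exact: cvg_cst.
  + by apply: cvg_norm; apply: cvgB => //; exact: cvg_cst.
- near=> x.
  have -> : B (f x) (g x) - B a b = B (f x - a) (g x) + B a (g x - b).
    by rewrite bilinearBl bilinearBr addrA subrK.
  by apply: le_trans (ler_normD _ _) _; apply: lerD; exact: BK.
Unshelve. all: by end_near. Qed.

End BilinearLimits.

Lemma bilinear_antisym (R : realType) (p : nat) (W : lmodType R)
    (B : 'rV[R]_p -> 'rV[R]_p -> W) :
  bilinear_map B -> bilinear_map (fun v w => B v w - B w v).
Proof.
move=> [b1 b2]; split=> [w k u v|v k w w'] /=.
  by rewrite b1 b2 scalerBr opprD addrACA.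
by rewrite b1 b2 scalerBr opprD addrACA.
Qed.


Lemma cvg_linear (R : realType) (p : nat) (W : normedModType R)
    (L : 'rV[R]_p -> W) (T : Type) (F : set_system T) {FF : Filter F}
    (f : T -> 'rV[R]_p) a :
  linear L -> f @ F --> a -> L (f x) @[x --> F] --> L a.
Proof.
move=> lL fa.
apply: (@cvg_dominated R W T F _ _ (fun=> L a)
  (fun x => (\sum_i `|L (delta_mx 0 i)|) * `|f x - a|)).
- exact: cvg_cst.
- have {2}-> : (0 : R) = (\sum_i `|L (delta_mx 0 i)|) * `|a - a|.
    by rewrite subrr normr0 mulr0.
  by apply: cvgMl_tmp; apply: cvg_norm; apply: cvgB => //; exact: cvg_cst.
- near=> x.
  have -> : L (f x) - L a = L (f x - a).
    by have := lL (-1) a (f x); rewrite !scaleN1r ![- _ + _]addrC.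
  exact: linear_row_bound.
Unshelve. all: by end_near. Qed.

Lemma row_rearrange1 (R : realType) (n : nat) (u b c x y z : 'rV[R]_n) :
  z - x + b - c = (u - y - x - c) - (u - z - y - b).
Proof. by apply/rowP => j; rewrite !mxE; ring. Qed.

Lemma row_rearrange2 (R : realType) (n : nat) (t x u v w : 'rV[R]_n) :
  t - x - (u - v) = (t - x + w - u) - (w - v).
Proof. by apply/rowP => j; rewrite !mxE; ring. Qed.

(** Bootstrapping on norms: [y], [X], [T] stand for those of [y], [X] and [Ad (P y) X], and [a] for
    that of [Ad (P y) X - X]. The crude bound [a <= X] comes first; reinserted, it shows that [a] is
    of order [y * X], so that [bD] is quadratic in [y]. *)
Lemma Ad_estimate_arith (R : realType) (K eta e y X T a A bT bX bD : R) :
  0 <= K -> 0 <= y -> 0 <= X -> 0 <= T -> 0 <= a ->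
  0 < eta -> eta <= 1 -> eta <= e / 6 ->
  3 * (K + 1) * y <= 1 -> 6 * (K * (K + 1) + 1) * y <= e ->
  A <= eta * y * (X + T) -> bT <= K * T * y -> bX <= K * y * X ->
  bD <= K * a * y -> a <= A + (bT + bX) -> T <= a + X ->
  A + bD <= e * y * X.
Proof.
move=> K0 y0 X0 T0 a0 eta0 eta1 eta6 yK ye HA HT HX HD Ha HTa.
have yX : 0 <= y * X by rewrite mulr_ge0.
have ys : 0 <= y * (X + T) by rewrite mulr_ge0// addr_ge0.
have h1 : eta * (y * (X + T)) <= 1 * (y * (X + T)) by rewrite ler_wpM2r.
have h2 : a <= (K + 1) * y * (X + T) by lra.
have h3 : 3 * (K + 1) * y * (X + T) <= 1 * (X + T).
  by rewrite ler_wpM2r// addr_ge0.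
have aX : a <= X by lra.
have h4 : y * (X + T) <= y * (3 * X) by rewrite ler_wpM2l//; lra.
have h5 : a <= (K + 1) * (y * (3 * X)).
  apply: le_trans h2 _; rewrite -mulrA ler_wpM2l//; lra.
have h6 : K * a * y <= K * ((K + 1) * (y * (3 * X))) * y.
  by rewrite ler_wpM2r// ler_wpM2l.
have h7 : 6 * (K * (K + 1) + 1) * y * (y * X) <= e * (y * X) by rewrite ler_wpM2r.
have h8 : eta * (y * (X + T)) <= e / 6 * (y * (3 * X)).
  by apply: ler_pM => //; exact: ltW.
have h9 : 0 <= y * (y * X) by rewrite mulr_ge0.
lra.
Qed.

(** * Expansion of the adjoint action near the identity *)

Section Bracket.
Context {R : realType} {n : nat} {G : lieGroup R n}.
Local Notation V := 'rV[R]_n.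
Local Notation phi := (chart_map (id_chart G)).
Local Notation x1 := (phi 1%g).
Local Notation dom := (chart_dom (id_chart G)).
Local Notation P := (@from_coord R n G).
Local Notation Q := (@to_coord R n G).
Local Notation m := (coord_mul G).
Local Notation lexp := (lexp G).
Local Notation beta := (mul_form G).
Local Notation brk := (lie_bracket G).

Lemma lie_bracket_bilinear : bilinear_map (lie_bracket G).
Proof. exact: (bilinear_antisym (mul_form_bilinear G)). Qed.

Opaque mul_form lie_bracket.

Lemma lexp_coord_seq (v : V) :
  2 ^+ k *: Q (lexp ((2 ^+ k)^-1 *: v)) @[k --> \oo] --> v.
Proof.
have := derive_along_seq (lexp_is_derive G v) (@cvg_expr_half R) (@half_pow_neq0 R).
have -> : (fun k => ((2 ^+ k)^-1)^-1 *: ((phi \o (fun t : R => lexp (t *: v))) (2 ^+ k)^-1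
     - (phi \o (fun t : R => lexp (t *: v))) 0)) =
  (fun k => 2 ^+ k *: Q (lexp ((2 ^+ k)^-1 *: v))).
  by apply/funext => k; rewrite invrK /= scale0r lexp0.
by [].
Qed.

Lemma lexp_seq_cvg1 (v : V) : lexp ((2 ^+ k)^-1 *: v) @[k --> \oo] --> (1%g : G).
Proof.
rewrite -(lexp0 G) -(scale0r v).
by apply: cvg_lexp; apply: cvgZr_tmp; exact: cvg_expr_half.
Qed.

(** If [z] and [x] are the coordinates of the exponentials of [Ad (P y) X] and [X], both scaled by
    [(2 ^+ k)^-1], then [m z y = m y x]. Both sides are expanded to second order, multiplied by
    [2 ^+ k] and passed to the limit. *)
Lemma Ad_estimate_aux (e : R) : 0 < e -> exists2 d : R, 0 < d & forall y X : V, `|y| < d ->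
  `|Ad (P y) X - X + beta (Ad (P y) X) y - beta y X|
    <= e * `|y| * (`|X| + `|Ad (P y) X|).
Proof.
move=> e0; have [r1 r10 Hr1] := coord_mul_second_order G e0.
pose d := Num.min r1 (mul_radius G).
exists d => [|y X]; first by rewrite lt_min r10 mul_radius_gt0.
rewrite lt_min => /andP[yr1 yr].
set T := Ad (P y) X.
pose z k := Q (lexp ((2 ^+ k)^-1 *: T)); pose x k := Q (lexp ((2 ^+ k)^-1 *: X)).
have zT := @lexp_coord_seq T; have xX := @lexp_coord_seq X.
have z0 := pow2_scale_cvg0 zT; have x0 := pow2_scale_cvg0 xX.
have nz := near_small r10 z0; have nx := near_small r10 x0.
have dz := near_seq_dom (@lexp_seq_cvg1 T); have dx := near_seq_dom (@lexp_seq_cvg1 X).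
have bb := mul_form_bilinear G.
have bT : (2 ^+ k *: z k - 2 ^+ k *: x k + beta (2 ^+ k *: z k) y - beta y (2 ^+ k *: x k))
    @[k --> \oo] --> T - X + beta T y - beta y X.
  apply: cvgB; last by apply: (cvg_bilinear bb); [exact: cvg_cst|exact: xX].
  apply: cvgD; first by apply: cvgB; [exact: zT|exact: xX].
  by apply: (cvg_bilinear bb); [exact: zT|exact: cvg_cst].
have bR : e * `|y| * (`|2 ^+ k *: x k| + `|2 ^+ k *: z k|) @[k --> \oo]
    --> e * `|y| * (`|X| + `|T|).
  by apply: cvgMl_tmp; apply: cvgD; apply: cvg_norm; [exact: xX|exact: zT].
apply: (cvg_le (cvg_norm bT) bR).
have N : \forall k \near \oo, (`|z k| < r1 /\ `|x k| < r1) /\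
    (dom (lexp ((2 ^+ k)^-1 *: T)) /\ dom (lexp ((2 ^+ k)^-1 *: X))).
  exact: filterI (filterI nz nx) (filterI dz dx).
apply: filterS N => k [[zr1 xr1] [dzk dxk]].
have K0 : (0 : R) < 2 ^+ k by rewrite exprn_gt0.
have Pz : P (z k) = lexp ((2 ^+ k)^-1 *: T) by exact: to_coordK.
have Px : P (x k) = lexp ((2 ^+ k)^-1 *: X) by exact: to_coordK.
have mzy : m (z k) y = m y (x k).
  rewrite /coord_mul Pz Px /T -(AdZ (P y)) -(conj_lexp (P y)) mulgVK.
  by [].
have H1 := Hr1 _ _ zr1 yr1; have H2 := Hr1 _ _ yr1 xr1; rewrite mzy in H1.
rewrite (bilinearZl bb) (bilinearZr bb).
move: H1 H2; move: (m y (x k)) (beta (z k) y) (beta y (x k)) => u b c.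
move: (z k) (x k) => z' x' H1 H2.
rewrite -scalerBr -scalerDr -scalerBr (row_rearrange1 u b c x' y z').
rewrite !normrZ gtr0_norm// -mulrDr mulrCA ler_pM2l//.
apply: le_trans (ler_normB _ _) _; rewrite mulrDr.
by apply: lerD; [exact: H2|apply: le_trans H1 _; rewrite mulrAC].
Qed.

(** With [T] for [Ad (P y) X], replacing [beta T y] by [beta X y] in the previous estimate produces
    the bracket; the difference [beta (T - X) y] is quadratic in [y]. *)
Lemma Ad_estimate (e : R) : 0 < e -> exists2 d : R, 0 < d & forall y X : V, `|y| < d ->
  `|Ad (P y) X - X - brk y X| <= e * `|y| * `|X|.
Proof.
move=> e0; have bb := mul_form_bilinear G.
have [K K0 BK] := bilinear_row_bound bb.
pose eta := Num.min 1 (e / 6).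
have eta0 : 0 < eta by rewrite lt_min ltr01 divr_gt0.
have [d1 d10 Hd1] := Ad_estimate_aux eta0.
pose d := Num.min d1 (Num.min (3 * (K + 1))^-1 (e / (6 * (K * (K + 1) + 1)))).
have KK0 : 0 < K * (K + 1) by rewrite mulr_gt0// ltr_wpDr.
exists d => [|y X].
  rewrite !lt_min d10 invr_gt0 mulr_gt0 ?addr_gt0//=.
  by rewrite divr_gt0// mulr_gt0// addr_gt0.
rewrite !lt_min => /and3P[yd1 yd2 yd3].
have := Hd1 y X yd1; set T := Ad (P y) X => H.
have eta1 : eta <= 1 by rewrite ge_min lexx.
have eta6 : eta <= e / 6 by rewrite ge_min lexx orbT.
have H1 : `|T - X| <= `|T - X + beta T y - beta y X| + (`|beta T y| + `|beta y X|).
  have e1 : T - X = (T - X + beta T y - beta y X) - (beta T y - beta y X).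
    by rewrite opprB addrA subrK addrK.
  rewrite {1}e1.
  by apply: le_trans (ler_normB _ _) (lerD (lexx _) (ler_normB _ _)).
have BT := BK T y; have BX := BK y X.
have T0 : `|T| <= `|T - X| + `|X| by rewrite -{1}(subrK X T) ler_normD.
have x0 : 0 <= `|X| := normr_ge0 X.
have t0 : 0 <= `|T| := normr_ge0 T.
have y0 : 0 <= `|y| := normr_ge0 y.
have s0 : 0 <= `|T - X| := normr_ge0 (T - X).
have bTX := BK (T - X) y.
have eqn : T - X - brk y X =
    (T - X + beta T y - beta y X) - beta (T - X) y.
  by rewrite lie_bracketE (bilinearBl bb); exact: row_rearrange2.
rewrite eqn; apply: le_trans (ler_normB _ _) _.
have K10 : 0 < 3 * (K + 1) by rewrite mulr_gt0// ltr_wpDr.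
have K60 : 0 < 6 * (K * (K + 1) + 1) by rewrite mulr_gt0// ltr_wpDr// ltW.
have yd2' : 3 * (K + 1) * `|y| <= 1 by rewrite -ler_pdivlMl// mulr1 ltW.
have yd3' : 6 * (K * (K + 1) + 1) * `|y| <= e.
  by rewrite -ler_pdivlMl// mulrC ltW.
exact: (Ad_estimate_arith (ltW K0) y0 x0 t0 s0 eta0 eta1 eta6 yd2' yd3' H BT BX bTX H1 T0).
Qed.

End Bracket.

Lemma normed_cvg_unique (R : realType) (V : normedModType R) (f : nat -> V) (a b : V) :
  f @ \oo --> a -> f @ \oo --> b -> a = b.
Proof. by move=> fa fb; rewrite -(cvg_lim _ fa)// -(cvg_lim _ fb). Qed.

(** * The bracket as derivative of the adjoint action *)

Section AdjointDerivative.
Context {R : realType} {n : nat} {G : lieGroup R n}.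
Local Notation V := 'rV[R]_n.
Local Notation phi := (chart_map (id_chart G)).
Local Notation dom := (chart_dom (id_chart G)).
Local Notation P := (@from_coord R n G).
Local Notation Q := (@to_coord R n G).
Local Notation lexp := (lexp G).
Local Notation brk := (lie_bracket G).

Opaque mul_form lie_bracket.

Lemma is_derive0P (f : R -> V) (v : V) :
  is_derive (0 : R) (1 : R) f v <-> h^-1 *: (f h - f 0) @[h --> (0 : R)^'] --> v.
Proof.
split=> [[df <-]|c].
  have c : (fun h : R => h^-1 *: ((f \o shift 0) (h *: 1) - f 0)) @ 0^' --> 'D_1 f 0.
    exact: df.
  by rewrite derive_quotient0 in c.
rewrite -derive_quotient0 in c.
by split; [exact: (cvgP _ c)|exact: cvg_lim].
Qed.

Lemma lexp_line_cvg1 (Y : V) : lexp (h *: Y) @[h --> (0 : R)^'] --> (1%g : G).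
Proof.
rewrite -(lexp0 G) -(scale0r Y).
by apply: cvg_lexp; apply: cvgZr_tmp; exact: nbhs_dnbhs.
Qed.

(** The chart coordinate [y h] of the exponential of [h *: Y], divided by [h], tends to [Y];
    [Ad_estimate] with an arbitrarily small constant then compares the difference quotient with the
    bracket. *)
Lemma Ad_is_derive (Y X : V) :
  is_derive (0 : R) (1 : R) (fun t : R => Ad (lexp (t *: Y)) X) (brk Y X).
Proof.
apply/is_derive0P.
have c1 := (is_derive0P _ _).1 (lexp_is_derive G Y).
pose y (h : R) := Q (lexp (h *: Y)).
have cy : h^-1 *: y h @[h --> (0 : R)^'] --> Y.
  suff <- : (fun h : R => h^-1 *: ((phi \o (fun t : R => lexp (t *: Y))) h
      - (phi \o (fun t : R => lexp (t *: Y))) 0)) = (fun h : R => h^-1 *: y h) by [].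
  by apply/funext => h; rewrite /= scale0r lexp0.
have l1 := @lexp_line_cvg1 Y.
have y0 : y h @[h --> (0 : R)^'] --> (0 : V).
  rewrite -(to_coord1 G).
  apply: (@cvg_comp _ _ _ (fun h : R => lexp (h *: Y)) Q _ _ _ l1).
  exact: to_coord_continuous (id_chart_dom G).
have bb := @lie_bracket_bilinear R n G.
have cb : brk (h^-1 *: y h) X @[h --> (0 : R)^'] --> brk Y X.
  by apply: (cvg_bilinear bb) => //; exact: cvg_cst.
apply: (@cvg_sub0 _ _ _ _ _ (fun h : R => h^-1 *: (Ad (lexp (h *: Y)) X
   - Ad (lexp ((0 : R) *: Y)) X)) (fun h : R => brk (h^-1 *: y h) X) _ _ cb).
apply/cvgr0Pnorm_le => e e0.
pose Y1 : R := `|Y| + 1; pose X1 : R := `|X| + 1.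
have Y10 : 0 < Y1 by rewrite ltr_wpDl.
have X10 : 0 < X1 by rewrite ltr_wpDl.
have e10 : 0 < e / (Y1 * X1) by rewrite divr_gt0// mulr_gt0.
have [d d0 Hd] := @Ad_estimate R n G _ e10.
have n1 : \forall h \near (0 : R)^', dom (lexp (h *: Y)).
  by have nz := l1 _ (near_dom1 G); exact nz.
have n2 : \forall h \near (0 : R)^', `|y h| < d.
  exact: (@cvgr0_norm_lt _ _ _ _ _ y y0 d d0).
have n3 : \forall h \near (0 : R)^', `|h^-1 *: y h| < Y1.
  by apply: (cvgr_norm_lt Y cy); rewrite /Y1 ltrDl.
near=> h.
have dh : dom (lexp (h *: Y)) by near: h; exact: n1.
have yd : `|y h| < d by near: h; exact: n2.
have yY : `|h^-1 *: y h| < Y1 by near: h; exact: n3.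
have h0 : h != 0 by near: h; exact: nbhs_dnbhs_neq.
have Py : P (y h) = lexp (h *: Y) by exact: to_coordK.
have := Hd (y h) X yd; rewrite Py => H.
have -> : ((fun h : R => h^-1 *: (Ad (lexp (h *: Y)) X - Ad (lexp ((0 : R) *: Y)) X)) -
    (fun h : R => brk (h^-1 *: y h) X)) h =
    h^-1 *: (Ad (lexp (h *: Y)) X - X - brk (y h) X).
  rewrite /= scale0r lexp0 Ad1 -[LHS]/(h^-1 *: _ - _) (bilinearZl bb).
  by rewrite [in RHS]scalerBr.
rewrite normrZ; apply: le_trans (ler_wpM2l (normr_ge0 _) H) _.
have -> : `|h^-1| * (e / (Y1 * X1) * `|y h| * `|X|) =
    e / (Y1 * X1) * (`|h^-1 *: y h| * `|X|) by rewrite normrZ; ring.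
apply: (@le_trans _ _ (e / (Y1 * X1) * (Y1 * X1))); last first.
  by rewrite divfK// gt_eqF// mulr_gt0.
apply: ler_wpM2l; first exact: ltW.
by apply: ler_pM => //; [exact: ltW|rewrite /X1 lerDl].
Unshelve. all: by end_near. Qed.

Lemma Ad_seq (Y X : V) :
  2 ^+ k *: (Ad (lexp ((2 ^+ k)^-1 *: Y)) X - X) @[k --> \oo] --> brk Y X.
Proof.
have := derive_along_seq (Ad_is_derive Y X) (@cvg_expr_half R) (@half_pow_neq0 R).
have -> : (fun k => ((2 ^+ k)^-1)^-1 *: (Ad (lexp ((2 ^+ k)^-1 *: Y)) X
    - Ad (lexp ((0 : R) *: Y)) X)) =
  (fun k => 2 ^+ k *: (Ad (lexp ((2 ^+ k)^-1 *: Y)) X - X)).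
  by apply/funext => k; rewrite invrK scale0r lexp0 Ad1.
by [].
Qed.

(** The derivative of the relation [lie_diff_Ad], which says that [f] intertwines the adjoint
    actions. *)
Lemma lie_hom_bracket (f : G -> G) (Y X : V) : lie_hom f ->
  lie_diff f (brk Y X) = brk (lie_diff f Y) (lie_diff f X).
Proof.
move=> hf; have [_ _ _ lf] := hf.
have c1 : lie_diff f (2 ^+ k *: (Ad (lexp ((2 ^+ k)^-1 *: Y)) X - X)) @[k --> \oo]
    --> lie_diff f (brk Y X) by exact: cvg_linear lf (@Ad_seq Y X).
have c2 := @Ad_seq (lie_diff f Y) (lie_diff f X).
have e : (fun k => lie_diff f (2 ^+ k *: (Ad (lexp ((2 ^+ k)^-1 *: Y)) X - X))) =
    (fun k => 2 ^+ k *: (Ad (lexp ((2 ^+ k)^-1 *: lie_diff f Y)) (lie_diff f X)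
      - lie_diff f X)).
  apply/funext => k; rewrite (lie_diffZ _ _ hf); congr (_ *: _).
  have lB u v : lie_diff f (u - v) = lie_diff f u - lie_diff f v.
    by have := lf (-1) v u; rewrite !scaleN1r ![- _ + _]addrC.
  by rewrite lB (lie_diff_Ad _ _ hf) (lie_hom_lexp _ hf) (lie_diffZ _ _ hf).
rewrite e in c1.
exact: (normed_cvg_unique c1 c2).
Qed.

Lemma Ad_bracket (g : G) (Y X : V) : Ad g (brk Y X) = brk (Ad g Y) (Ad g X).
Proof. exact: lie_hom_bracket (conj_by_hom g). Qed.

(** The Jacobi identity, obtained by differentiating the fact that every [Ad g] preserves the
    bracket. *)
Lemma bracket_derivation (Y v w : V) :
  brk Y (brk v w) = brk (brk Y v) w + brk v (brk Y w).
Proof.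
have bb := @lie_bracket_bilinear R n G.
pose A k := Ad (lexp ((2 ^+ k)^-1 *: Y)).
have c1 := @Ad_seq Y (brk v w); rewrite -/(A _) in c1.
have cv := @Ad_seq Y v; have cw := @Ad_seq Y w.
have Aw : A k w @[k --> \oo] --> w.
  have -> : (fun k => A k w) = (fun k => (A k w - w) + w).
    by apply/funext => k; rewrite subrK.
  rewrite -[X in _ --> X]add0r; apply: cvgD; last exact: cvg_cst.
  exact: (pow2_scale_cvg0 cw).
have c2 : brk (2 ^+ k *: (A k v - v)) (A k w) + brk v (2 ^+ k *: (A k w - w))
    @[k --> \oo] --> brk (brk Y v) w + brk v (brk Y w).
  apply: cvgD; first exact: (cvg_bilinear bb cv Aw).
  by apply: (cvg_bilinear bb) => //; exact: cvg_cst.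
have e : (fun k => 2 ^+ k *: (Ad (lexp ((2 ^+ k)^-1 *: Y)) (brk v w) - brk v w)) =
    (fun k => brk (2 ^+ k *: (A k v - v)) (A k w) + brk v (2 ^+ k *: (A k w - w))).
  apply/funext => k; rewrite (bilinearZl bb) (bilinearZr bb) -scalerDr.
  congr (_ *: _); rewrite (bilinearBl bb) (bilinearBr bb) Ad_bracket -/(A k).
  by rewrite addrA subrK.
rewrite e in c1.
exact: (normed_cvg_unique c1 c2).
Qed.

Lemma Ad_is_derive_at (Y X : V) (t : R) :
  is_derive t (1 : R) (fun t : R => Ad (lexp (t *: Y)) X) (Ad (lexp (t *: Y)) (brk Y X)).
Proof.
have lA := @Ad_linear R n G (lexp (t *: Y)).
have c := (is_derive0P _ _).1 (Ad_is_derive Y X).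
have c1 : Ad (lexp (t *: Y)) (h^-1 *: (Ad (lexp (h *: Y)) X - Ad (lexp ((0 : R) *: Y)) X))
    @[h --> (0 : R)^'] --> Ad (lexp (t *: Y)) (brk Y X) by exact: cvg_linear lA c.
have e : (fun h : R => h^-1 *: (((fun t : R => Ad (lexp (t *: Y)) X) \o shift t) (h *: 1)
     - (fun t : R => Ad (lexp (t *: Y)) X) t)) =
  (fun h : R => Ad (lexp (t *: Y)) (h^-1 *: (Ad (lexp (h *: Y)) X
    - Ad (lexp ((0 : R) *: Y)) X))).
  apply/funext => h; rewrite scale0r lexp0 Ad1 AdZ; congr (_ *: _).
  have -> : Ad (lexp (t *: Y)) (Ad (lexp (h *: Y)) X - X) =
      Ad (lexp (t *: Y)) (Ad (lexp (h *: Y)) X) - Ad (lexp (t *: Y)) X.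
    by have := lA (-1) X (Ad (lexp (h *: Y)) X); rewrite !scaleN1r ![- _ + _]addrC.
  rewrite -(AdM (lexp (t *: Y)) (lexp (h *: Y)) X) -(lexp_add G Y t h) [t + h]addrC.
  by rewrite /shift /= [h *: (1 : R)]mulr1.
split; first by rewrite /derivable e; exact: (cvgP _ c1).
by rewrite /derive e; exact: cvg_lim.
Qed.

(** Each coordinate [c] of [t |-> Ad (lexp (t *: Y)) X] has derivative [a * c], so its product with
    [expR (- a * t)] is constant. *)
Lemma Ad_eigenvector (Y X : V) (a : R) :
  brk Y X = a *: X -> Ad (lexp Y) X = expR a *: X.
Proof.
move=> YX; apply/rowP => j; rewrite mxE.
pose c (t : R) : R := Ad (lexp (t *: Y)) X 0 j.
have dc (t : R) : is_derive t (1 : R) c (a * c t).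
  have [dA vA] := Ad_is_derive_at Y X t.
  split; first exact: (derivable_mxP _ _ _).1 dA 0 j.
  have := derive_mx dA; rewrite vA YX AdZ => /rowP/(_ j).
  by rewrite !mxE => ->.
pose u (t : R) : R := expR (- a * t) * c t.
have du (t : R) : is_derive t (1 : R) u 0.
  have d0 : is_derive t (1 : R) (fun s : R => - a * s) (- a).
    have := @is_deriveZ R R R id (- a) t 1 1 (is_derive_id _ _).
    by rewrite [_ *: 1]mulr1.
  have d1 := is_derive1_comp (is_derive_expR (- a * t)) d0.
  have d2 := is_deriveM d1 (dc t).
  apply: (is_derive_eq d2).
  rewrite -![_ *: _]/(_ * _) /=; ring.
have := is_derive_0_is_cst 1 0 du; rewrite /u mulr0 expR0 mul1r mulr1.
rewrite /c scale1r scale0r lexp0 Ad1 => H.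
have := congr1 (fun x => expR a * x) H.
by rewrite mulrA -expRD subrr expR0 mul1r.
Qed.

End AdjointDerivative.

(** * Symmetric operators *)

Section InnerProduct.
Context {R : realType} {n : nat}.
Local Notation V := 'rV[R]_n.
Variable S : 'M[R]_n.

(** Valued in [R^o], a module over [R], so that [bilinear_map] applies to it. *)
Definition form (v w : V) : R^o := (v *m S *m w^T) 0 0.

Definition inner_product : Prop := S^T = S /\ forall v : V, v != 0 -> 0 < form v v.

Lemma form_bilinear : bilinear_map form.
Proof.
split=> [w k u v|v k w w']; rewrite /form.
  by rewrite !mulmxDl -!scalemxAl !mxE.
by rewrite linearP mulmxDr -scalemxAr !mxE.
Qed.

Hypothesis innerS : inner_product.

Lemma formC v w : form v w = form w v.
Proof.
rewrite /form -[in LHS](trmxK (v *m S *m w^T)) mxE; congr (fun_of_matrix _ 0 0).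
by rewrite !trmx_mul trmxK innerS.1 mulmxA.
Qed.

Lemma form_ge0 v : 0 <= form v v.
Proof.
have [->|v0] := eqVneq v 0; last exact/ltW/innerS.2.
by rewrite /form !mul0mx mxE.
Qed.

Lemma form_cvg (T : Type) (F : set_system T) {FF : Filter F} (f g : T -> V) a b :
  f @ F --> a -> g @ F --> b -> form (f x) (g x) @[x --> F] --> form a b.
Proof. exact: (cvg_bilinear form_bilinear). Qed.

Lemma formZ (t : R) v : form (t *: v) (t *: v) = t ^+ 2 * form v v.
Proof.
rewrite (bilinearZl form_bilinear) (bilinearZr form_bilinear).
by rewrite -![_ *: _]/(_ * _) mulrA.
Qed.

Lemma form_self_continuous : continuous (fun v => form v v).
Proof.
by move=> v; have h := @form_cvg V (nbhs v) _ id id v v (@cvg_id _ _) (@cvg_id _ _); exact: h.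
Qed.

Lemma mulmx_continuous l (Y : 'M[R]_(n, l)) : continuous (fun v : V => v *m Y).
Proof.
have lin_mul : linear (fun v : V => v *m Y).
  by move=> a u v; rewrite mulmxDl scalemxAl.
by move=> v; have h := @cvg_linear R n _ _ V (nbhs v) _ id v lin_mul (@cvg_id _ _); exact: h.
Qed.

Lemma sphere_compact : compact [set v : V | `|v| = 1].
Proof.
apply: bounded_closed_compact.
  by exists 1; split => // x x1 v /= ->; exact: ltW.
have -> : [set v : V | `|v| = 1] = (fun v : V => `|v|) @^-1` [set (1 : R)] by [].
by apply: closed_comp; [move=> v _; exact: norm_continuous|exact: closed_eq].
Qed.

Lemma form_lower_bound : exists2 c : R, 0 < c & forall v, c * `|v| ^+ 2 <= form v v.
Proof.
(* For [n = 0] the unit sphere is empty and offers no minimum; any positive constant works there. *)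
have [[v0 v01]|noS] := pselect (exists v : V, `|v| = 1); last first.
  exists 1 => // v; have [->|vn0] := eqVneq v 0.
    by rewrite normr0 expr0n mulr0 form_ge0.
  exfalso; apply: noS; exists (`|v|^-1 *: v).
  by rewrite normrZ normfV normr_id mulVf// normr_eq0.
have S0 : [set v : V | `|v| = 1] !=set0 by exists v0.
have cF : {within [set v : V | `|v| = 1], continuous (fun v => form v v)}.
  by apply: continuous_subspaceT; exact: form_self_continuous.
have [v v1 vmin] := EVT_min_rV S0 sphere_compact cF.
rewrite inE /= in v1.
have vn0 : v != 0 by rewrite -normr_eq0 v1 oner_neq0.
exists (form v v); first exact: innerS.2.
move=> w; have [->|wn0] := eqVneq w 0; first by rewrite normr0 expr0n mulr0 form_ge0.
have nw0 : 0 < `|w| by rewrite normr_gt0.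
have := vmin (`|w|^-1 *: w); rewrite formZ.
have -> : `|w|^-1 *: w \in [set v | `|v| = 1].
  by rewrite inE /= normrZ normfV normr_id mulVf// gt_eqF.
move=> /(_ isT); rewrite exprVn ler_pdivlMl ?exprn_gt0//.
by rewrite mulrC.
Qed.

Variable A : 'M[R]_n.
Hypothesis symA : A *m S = S *m A^T.

Lemma form_sym v w : form (v *m A) w = form v (w *m A).
Proof. by rewrite /form -(mulmxA v A S) symA trmx_mul !mulmxA. Qed.

(** The first-order term vanishes at a maximum: [b / (|q| + 1)] is small enough for the linear term
    to dominate the quadratic one. *)
Lemma quadratic_nonpos (b q : R) : 0 <= b ->
  (forall t : R, 2 * t * b + t ^+ 2 * q <= 0) -> b = 0.
Proof.
move=> b0 H; apply/eqP; rewrite eq_le b0 andbT leNgt; apply/negP => b_gt0.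
have q0 : 0 < `|q| + 1 by rewrite ltr_wpDl.
have := H (b / (`|q| + 1)).
have -> : 2 * (b / (`|q| + 1)) * b + (b / (`|q| + 1)) ^+ 2 * q =
  b ^+ 2 / (`|q| + 1) ^+ 2 * (2 * (`|q| + 1) + q) by field; rewrite gt_eqF.
rewrite pmulr_rle0; last by rewrite divr_gt0// exprn_gt0.
have := ler_norm (- q); rewrite normrN; have := normr_ge0 q; lra.
Qed.

(* A maximum point of the Rayleigh quotient on a stable subspace is an
   eigenvector. *)
Lemma stable_eigenvector k (X : 'M[R]_(n, k)) :
  (forall v : V, v *m X = 0 -> v *m A *m X = 0) ->
  (exists2 v : V, v != 0 & v *m X = 0) ->
  exists2 v : V, v != 0 /\ v *m X = 0 & exists a, v *m A = a *: v.
Proof.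
move=> stX [v0 v0n0 v0X].
pose D := [set v : V | `|v| = 1] `&` [set v : V | v *m X = 0].
have cD : compact D.
  apply: (@subclosed_compact _ _ [set v : V | `|v| = 1]); last by move=> v [].
    apply: closedI.
      by apply: compact_closed; [exact: norm_hausdorff|exact: sphere_compact].
    have -> : [set v : V | v *m X = 0] = (fun v : V => v *m X) @^-1` [set 0] by [].
    apply: closed_comp; last exact/accessible_closed_set1/hausdorff_accessible/norm_hausdorff.
    by move=> v _; exact: mulmx_continuous.
  exact: sphere_compact.
have unit_norm (u : V) : u != 0 -> `| `|u|^-1 *: u | = 1.
  by move=> u0; rewrite normrZ normfV normr_id mulVf// normr_eq0.
have D0 : D !=set0.
  exists (`|v0|^-1 *: v0); split; first exact: unit_norm.
  by rewrite /= -scalemxAl v0X scaler0.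
pose f (v : V) : R := form (v *m A) v / form v v.
have Dn0 v : D v -> v != 0 by move=> [/= v1 _]; rewrite -normr_eq0 v1 oner_neq0.
have cf : {within D, continuous f}.
  apply: continuous_in_subspaceT => v /[!inE] /Dn0 vn0.
  have c1 : form (x *m A) x @[x --> v] --> form (v *m A) v.
    have h := @form_cvg V (nbhs v) _ (fun v => v *m A) id _ v
      (@mulmx_continuous _ A v) (@cvg_id _ _); exact: h.
  have vv0 : form v v != 0 by rewrite gt_eqF// innerS.2.
  have c2 : (form x x : R)^-1 @[x --> v] --> (form v v : R)^-1.
    have h := @cvgV _ _ _ _ _ _ vv0 (@form_self_continuous v); exact: h.
  have h := cvgM c1 c2; exact: h.
have [v /[!inE] Dv vmax] := EVT_max_rV D0 cD cf.
have vn0 := Dn0 v Dv; have [_ /= vX] := Dv.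
have vv0 := innerS.2 v vn0.
pose a := f v.
have le_a (u : V) : u *m X = 0 -> form (u *m A) u <= a * form u u.
  move=> uX; have [->|un0] := eqVneq u 0.
    by rewrite mul0mx (bilinear0r form_bilinear) mulr0.
  have Du : (`|u|^-1 *: u) \in D.
    by rewrite inE; split; [exact: unit_norm|rewrite /= -scalemxAl uX scaler0].
  have := vmax _ Du; rewrite -/a /f.
  have uu0 := innerS.2 u un0.
  have nu0 : 0 < (`|u|^-1) ^+ 2 by rewrite exprn_gt0// invr_gt0 normr_gt0.
  rewrite -scalemxAl (bilinearZl form_bilinear) (bilinearZr form_bilinear).
  rewrite formZ -![_ *: _]/(_ * _) mulrA -expr2 -mulf_div divff ?gt_eqF// mul1r.
  by rewrite ler_pdivrMr.
have va : form (v *m A) v = a * form v v by rewrite /a /f divfK// gt_eqF.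
exists v => //; exists a; apply/eqP; rewrite -subr_eq0.
set w := v *m A - a *: v.
have wX : w *m X = 0 by rewrite /w mulmxBl stX// -scalemxAl vX scaler0 subr0.
have vAw : v *m A = w + a *: v by rewrite subrK.
clearbody w; suff ww0 : form w w = 0.
  by apply: contraT => wn0; have := innerS.2 w wn0; rewrite ww0 ltxx.
(* First variation of [le_a] at [v] in the direction [w]: the term linear in [t] is
   [2 * t * form w w]. *)
apply: (@quadratic_nonpos _ (form (w *m A) w - a * form w w)); first exact: form_ge0.
move=> t; have utX : (v + t *: w) *m X = 0.
  by rewrite mulmxDl vX -scalemxAl wX scaler0 addr0.
have bD1 x y z : form (x + y) z = form x z + form y z.
  by have := form_bilinear.1 z 1 x y; rewrite !scale1r.
have bD2 x y z : form x (y + z) = form x y + form x z.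
  by have := form_bilinear.2 x 1 y z; rewrite !scale1r.
have bZ1 s x z : form (s *: x) z = s * form x z := bilinearZl form_bilinear s x z.
have bZ2 s x z : form x (s *: z) = s * form x z := bilinearZr form_bilinear s x z.
have := le_a _ utX; rewrite mulmxDl -scalemxAl !(bD1, bD2, bZ1, bZ2) va.
have e1 : form (w *m A) v = form (v *m A) w by rewrite formC form_sym.
have e2 : form w v = form v w by exact: formC.
have e3 : form (v *m A) w = form w w + a * form v w.
  by rewrite vAw bD1 bZ1.
rewrite e1 e2 e3 -subr_ge0 => H; rewrite -oppr_ge0; apply: le_trans H _.
by rewrite le_eqVlt; apply/orP; left; apply/eqP; ring.
Qed.

(** By induction on [k], sums of eigenspaces reach rank [minn k n]: while the sum is proper, its
    orthogonal complement is stable by symmetry and contains an eigenvector, whose eigenvalue is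
    new. *)
Lemma symmetric_diagonalizable : diagonalizable A.
Proof.
apply/diagonalizablePeigen.
pose W (rs : seq R) := (\sum_(r <- rs) eigenspace A r)%MS.
suff /(_ n)[rs urs] : forall k, exists2 rs, uniq rs & (minn k n <= \rank (W rs))%N.
  rewrite minnn => fullW; exists rs => //.
  apply/eqmxP; rewrite submx1 sub1mx row_full_unit -row_free_unit.
  by rewrite /row_free eqn_leq rank_leq_row.
elim=> [|k [rs urs IH]]; first by exists [::] => //; rewrite min0n.
have [fullW|ltW_n] := leqP n (\rank (W rs)).
  by exists rs => //; rewrite geq_min fullW orbT.
have WA_stable : (W rs *m A <= W rs)%MS.
  rewrite /W; elim: (rs) => [|r l IHl]; first by rewrite !big_nil mul0mx sub0mx.
  rewrite !big_cons addsmxMr addsmxS//.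
  have /eigenspaceP -> := submx_refl (eigenspace A r); exact: scalemx_sub.
(* The condition [v *m (S *m (W rs)^T) = 0] is orthogonality to [W rs]. *)
have [v [vn0 vX] [a va]] : exists2 v : V, v != 0 /\ v *m (S *m (W rs)^T) = 0
    & exists a, v *m A = a *: v.
  apply: stable_eigenvector.
    move=> v vX; have /submxP[D DW] := WA_stable.
    rewrite mulmxA -(mulmxA v A S) symA mulmxA -(mulmxA (v *m S)) -trmx_mul DW.
    by rewrite trmx_mul mulmxA -(mulmxA v S) vX mul0mx.
  have : kermx (S *m (W rs)^T) != 0.
    rewrite -mxrank_eq0 mxrank_ker subn_eq0 -ltnNge.
    by apply: leq_ltn_trans ltW_n; rewrite -[X in (_ <= X)%N]mxrank_tr mxrankM_maxr.
  move=> /rowV0Pn[v /sub_kermxP vX vn0]; by exists v.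
have vW : ~~ (v <= W rs)%MS.
  apply/negP => /submxP[D vD]; have := innerS.2 v vn0.
  rewrite /form {2}vD trmx_mul mulmxA -(mulmxA v S) vX mul0mx mxE ltxx.
  by [].
have va_eig : (v <= eigenspace A a)%MS by apply/eigenspaceP.
have anrs : a \notin rs.
  apply: contra vW => ars; apply: submx_trans va_eig _.
  by rewrite /W (big_rem a)//= addsmxSl.
exists (a :: rs); first by rewrite /= anrs.
rewrite /W big_cons -/(W rs).
have : (W rs < eigenspace A a + W rs)%MS.
  rewrite ltmxE addsmxSr /=; apply: contra vW; apply: submx_trans.
  exact: submx_trans va_eig (addsmxSl _ _).
rewrite ltmxErank => /andP[_ lt]; rewrite geq_min; apply/orP; left.
move: IH; rewrite geq_min [(n <= _)%N]leqNgt ltW_n orbF => IH.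
exact: leq_ltn_trans IH lt.
Qed.

End InnerProduct.

Lemma joint_eigenbasis (R : realType) (n : nat) (S : 'M[R]_n) (As : seq 'M[R]_n) :
  inner_product S -> {in As, forall A, A *m S = S *m A^T} ->
  {in As &, forall A B, A *m B = B *m A} ->
  exists2 P : 'M[R]_n, P \in unitmx &
    {in As, forall A i, exists a, row i P *m A = a *: row i P}.
Proof.
move=> iS symA commA.
have /codiagonalizableP[P Pu /allP PA] : {in As &, forall A B, comm_mx A B} /\
    {in As, forall A, diagonalizable A}.
  by split => // A AAs; apply: symmetric_diagonalizable (symA A AAs).
exists P => // A AAs i.
have /diagonalizable_forPex[D /(simmxPp (stablemx_unit _ Pu)) PD] := PA A AAs.
exists (D 0 i); rewrite -row_mul PD row_mul row_diag_mx -scalemxAl.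
by rewrite -rowE.
Qed.

(** * Cartan involutions and the infinitesimal decomposition *)

Lemma mul_rV_linear (R : realType) (n : nat) (f : 'rV[R]_n -> 'rV[R]_n) u :
  linear f -> u *m lin1_mx f = f u.
Proof.
move=> lf; pose fM := GRing.isLinear.Build _ _ _ _ _ lf.
pose fL : {linear _ -> _} := HB.pack f fM.
exact: (mul_rV_lin1 fL).
Qed.

Lemma row_mx_ext (R : realType) (n : nat) (A B : 'M[R]_n) :
  (forall v : 'rV[R]_n, v *m A = v *m B) -> A = B.
Proof. by move=> AB; apply/row_matrixP => i; rewrite !rowE. Qed.

(** * The Killing form of a bracket *)

Section Killing.
Context {R : realType} {n : nat}.
Local Notation V := 'rV[R]_n.
Variable brk : V -> V -> V.
Hypothesis brk_bilinear : bilinear_map brk.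
Hypothesis brk_derivation : forall Y v w,
  brk Y (brk v w) = brk (brk Y v) w + brk v (brk Y w).

Definition admx (v : V) : 'M[R]_n := lin1_mx (brk v).

Lemma mul_admx v w : w *m admx v = brk v w.
Proof. exact: (mul_rV_linear w (brk_bilinear.2 v)). Qed.

Lemma admx_linear : linear admx.
Proof.
move=> k u v; apply: row_mx_ext => w.
by rewrite mulmxDr -scalemxAr !mul_admx (brk_bilinear.1 w k u v).
Qed.

(** Vectors are rows, so matrices compose in the order opposite to maps. *)
Lemma admx_bracket v w : admx (brk v w) = admx w *m admx v - admx v *m admx w.
Proof.
apply: row_mx_ext => u; rewrite mulmxBr !mulmxA !mul_admx.
by rewrite (brk_derivation v w u) addrK.
Qed.

Definition trace_form v w : R^o := \tr (admx v *m admx w).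

Lemma trace_form_bilinear : bilinear_map trace_form.
Proof.
split=> [w k u v|v k w w'] /=; rewrite /trace_form admx_linear.
  by rewrite mulmxDl -scalemxAl mxtraceD mxtraceZ.
by rewrite mulmxDr -scalemxAr mxtraceD mxtraceZ.
Qed.

Lemma trace_formC v w : trace_form v w = trace_form w v.
Proof. exact: mxtrace_mulC. Qed.

Lemma trace_form_bracket u v w : trace_form (brk u v) w = - trace_form v (brk u w).
Proof.
have tB (A B : 'M[R]_n) : \tr (A - B) = \tr A - \tr B by rewrite raddfB.
rewrite /trace_form !admx_bracket mulmxBl mulmxBr !tB opprB.
rewrite !mulmxA; congr (_ - _).
by rewrite [RHS]mxtrace_mulC !mulmxA.
Qed.

(** An automorphism conjugates the adjoint matrices, and the trace does not see conjugation. *)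
Lemma trace_form_automorphism (L L' : V -> V) v w : linear L -> linear L' ->
  cancel L L' -> cancel L' L ->
  (forall x y, L (brk x y) = brk (L x) (L y)) ->
  trace_form (L v) (L w) = trace_form v w.
Proof.
move=> lL lL' LK LK' Lb.
pose M := lin1_mx L; pose M' := lin1_mx L'.
have adL x : admx (L x) = M' *m admx x *m M.
  apply: row_mx_ext => u; rewrite !mulmxA mul_admx (mul_rV_linear _ lL') mul_admx.
  by rewrite (mul_rV_linear _ lL) Lb LK'.
have MM' : M *m M' = 1%:M.
  apply: row_mx_ext => u; rewrite mulmxA (mul_rV_linear _ lL).
  by rewrite (mul_rV_linear _ lL') LK mulmx1.
rewrite /trace_form !adL -!mulmxA (mulmxA M M') MM' mul1mx mxtrace_mulC.
by rewrite -!mulmxA MM' mulmx1.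
Qed.

End Killing.

Lemma form_matrix (R : realType) (n : nat) (B : 'rV[R]_n -> 'rV[R]_n -> R^o) v w :
  bilinear_map B ->
  form (\matrix_(i, j) B (delta_mx 0 i) (delta_mx 0 j)) v w = B v w.
Proof.
move=> bB; rewrite (bilinear_row_expand v w (form_bilinear _)).
rewrite (bilinear_row_expand v w bB); apply: eq_bigr => i _; apply: eq_bigr => j _.
by congr (_ *: _); rewrite /form -rowE trmx_delta -colE !mxE.
Qed.

Lemma form_symP (R : realType) (n : nat) (S A : 'M[R]_n) :
  (forall v w, form S (v *m A) w = form S v (w *m A)) -> A *m S = S *m A^T.
Proof.
move=> H; apply/matrixP => i j.
have := H (delta_mx 0 i) (delta_mx 0 j); rewrite /form trmx_mul -!mulmxA.
rewrite !trmx_delta [A *m _]mulmxA [S *m _]mulmxA.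
by rewrite -!colE -!rowE !mxE.
Qed.


(** * The inner product of a Cartan involution *)

Section Cartan.
Context {R : realType} {n : nat}.
Local Notation V := 'rV[R]_n.
Variable brk : V -> V -> V.
Hypothesis brk_bilinear : bilinear_map brk.
Hypothesis brk_derivation : forall Y v w,
  brk Y (brk v w) = brk (brk Y v) w + brk v (brk Y w).
Local Notation killing := (trace_form brk).

Variable dth : V -> V.
Hypotheses (ldth : linear dth) (dthK : involutive dth).
Hypothesis dth_brk : forall v w, dth (brk v w) = brk (dth v) (dth w).
Hypothesis dth_pos : forall v, v != 0 -> 0 < - killing v (dth v).

Let kb : bilinear_map killing. Proof. exact: trace_form_bilinear. Qed.

Definition cartan_mx : 'M[R]_n :=
  \matrix_(i, j) (- killing (delta_mx 0 i) (dth (delta_mx 0 j))).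

Lemma cartan_formE v w : form cartan_mx v w = - killing v (dth w).
Proof.
rewrite /cartan_mx.
apply: (form_matrix v w (B := fun v w => - killing v (dth w) : R^o)).
split=> [x k u u'|x k u u'] /=.
  by rewrite (kb.1 (dth x) k u u') opprD scalerN.
by rewrite ldth (kb.2 x k (dth u) (dth u')) opprD scalerN.
Qed.

Lemma killing_theta v w : killing (dth v) (dth w) = killing v w.
Proof. exact: (trace_form_automorphism brk_bilinear v w ldth ldth dthK dthK dth_brk). Qed.

Lemma cartan_inner : inner_product cartan_mx.
Proof.
split=> [|v vn0]; last by rewrite cartan_formE; exact: dth_pos.
apply/matrixP => i j; rewrite !mxE; congr (- _).
by rewrite -killing_theta dthK trace_formC.
Qed.

(** Invariance of the Killing form and [dth Y = - Y] contribute one sign each, and the two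
    cancel. *)
Lemma admx_sym Y : dth Y = - Y ->
  admx brk Y *m cartan_mx = cartan_mx *m (admx brk Y)^T.
Proof.
move=> thY; apply: form_symP => v w.
rewrite !(mul_admx brk_bilinear) !cartan_formE.
rewrite (trace_form_bracket brk_bilinear brk_derivation) opprK dth_brk thY.
have -> : brk (- Y) (dth w) = - brk Y (dth w).
  by have := bilinearZl brk_bilinear (-1) Y (dth w); rewrite !scaleN1r.
have := bilinearZr kb (-1) v (brk Y (dth w)).
by rewrite !scaleN1r => ->; rewrite opprK.
Qed.

(** Such an [L] is an isometry of the inner product; the constant only compares this inner product
    with the maximum norm, and so serves every [L] at once. *)
Lemma automorphism_bounded : exists2 C : R, 0 < C &
  forall L L' : V -> V, linear L -> linear L' -> cancel L L' -> cancel L' L ->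
    (forall x y, L (brk x y) = brk (L x) (L y)) ->
    (forall v, L (dth v) = dth (L v)) ->
    forall v, `|L v| <= C * `|v|.
Proof.
have [c c0 Hc] := form_lower_bound cartan_inner.
have [K K0 HK] := bilinear_row_bound (form_bilinear cartan_mx).
have Kc0 : 0 < K / c by rewrite divr_gt0.
(* The ratio of squared norms is bounded by [K / c], whose square root is below [K / c + 1]. *)
exists (K / c + 1) => [|L L' lL lL' LK LK' Lb Lth v]; first by rewrite ltr_wpDr// ltW.
have H : c * `|L v| ^+ 2 <= K * `|v| ^+ 2.
  apply: le_trans (Hc _) _.
  have -> : form cartan_mx (L v) (L v) = form cartan_mx v v.
    rewrite !cartan_formE -Lth; congr (- _).
    exact: (trace_form_automorphism brk_bilinear v (dth v) lL lL').
  by apply: le_trans (ler_norm _) _; rewrite expr2 mulrA; exact: HK.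
rewrite -(@ler_pXn2r _ 2) ?nnegrE ?mulr_ge0//; last by rewrite addr_ge0// ltW.
have {}H : `|L v| ^+ 2 <= K / c * `|v| ^+ 2.
  by rewrite mulrAC ler_pdivlMr// mulrC.
apply: le_trans H _; rewrite exprMn ler_wpM2r ?exprn_ge0//.
by rewrite sqrrD expr1n mulr1; have := sqr_ge0 (K / c); lra.
Qed.

End Cartan.

Lemma linear_packed (R : pzRingType) (U V : lmodType R) (f : U -> V) :
  linear f -> exists g : {linear U -> V}, f = g.
Proof.
move=> lf; pose fM := GRing.isLinear.Build _ _ _ _ _ lf.
pose fL : {linear U -> V} := HB.pack f fM.
by exists fL.
Qed.

(** * Joint eigenbasis and solution of the linear problem *)

Section Eigenbasis.
Context {R : realType} {n : nat}.
Local Notation V := 'rV[R]_n.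
Variable brk : V -> V -> V.
Hypothesis brk_bilinear : bilinear_map brk.
Hypothesis brk_derivation : forall Y v w,
  brk Y (brk v w) = brk (brk Y v) w + brk v (brk Y w).
Hypothesis brkC : forall v w, brk v w = - brk w v.
Local Notation killing := (trace_form brk).

Variables dth dsi : V -> V.
Hypotheses (ldth : linear dth) (dthK : involutive dth).
Hypothesis dth_brk : forall v w, dth (brk v w) = brk (dth v) (dth w).
Hypothesis dth_pos : forall v, v != 0 -> 0 < - killing v (dth v).
Hypotheses (ldsi : linear dsi) (dsiK : involutive dsi).
Hypothesis dsi_brk : forall v w, dsi (brk v w) = brk (dsi v) (dsi w).
Hypothesis dsi_dth : forall v, dsi (dth v) = dth (dsi v).

Variable a : {vspace V}.
Hypothesis a_minus : forall v, v \in a -> dth v = - v /\ dsi v = - v.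
Hypothesis a_abelian : forall v w, v \in a -> w \in a -> brk v w = 0.

Let S := cartan_mx brk dth.
Let tau v := dsi (dth v).

Let tau_linear : linear tau.
Proof. by move=> k u v; rewrite /tau ldth ldsi. Qed.

Let tauK : involutive tau.
Proof. by move=> v; rewrite /tau -dsi_dth dsiK dthK. Qed.

Let tau_brk v w : tau (brk v w) = brk (tau v) (tau w).
Proof. by rewrite /tau dth_brk dsi_brk. Qed.

Let dsiN v : dsi (- v) = - dsi v.
Proof. by have [g ->] := linear_packed ldsi; rewrite raddfN. Qed.

Let tau_fix v : v \in a -> tau v = v.
Proof. by move=> /a_minus[h1 h2]; rewrite /tau h1 dsiN h2 opprK. Qed.

Let tauM := lin1_mx tau.

Lemma tau_sym : tauM *m S = S *m tauM^T.
Proof.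
apply: form_symP => v w; rewrite !(mul_rV_linear _ tau_linear).
rewrite !(cartan_formE brk_bilinear ldth); congr (- _).
rewrite -[in RHS](trace_form_automorphism brk_bilinear v _ tau_linear tau_linear tauK tauK tau_brk).
by rewrite /tau -!dsi_dth dsiK dthK.
Qed.

(** Joint diagonalization of [tau], the composite of [dsi] and [dth], and of the adjoint maps of a
    basis of [a]. They commute because [tau] fixes [a] pointwise and [a] is abelian. *)
Lemma root_eigenbasis : exists2 P : 'M[R]_n, P \in unitmx & forall i,
  (dsi (dth (row i P)) = row i P \/ dsi (dth (row i P)) = - row i P) /\
  forall Y, Y \in a -> exists t : R, brk Y (row i P) = t *: row i P.
Proof.
pose As := tauM :: [seq admx brk v | v <- vbasis a].
have inS : inner_product S := cartan_inner brk_bilinear ldth dthK dth_brk dth_pos.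
have symAs : {in As, forall A, A *m S = S *m A^T}.
  move=> A; rewrite inE => /orP[/eqP->|/mapP[v va ->]]; first exact: tau_sym.
  by apply: admx_sym => //; apply: (a_minus (vbasis_mem va)).1.
have comm_tau v : v \in a -> tauM *m admx brk v = admx brk v *m tauM.
  move=> va; apply: row_mx_ext => u; rewrite !mulmxA.
  rewrite !(mul_rV_linear _ tau_linear) !(mul_admx brk_bilinear).
  by rewrite tau_brk (tau_fix va).
have commAs : {in As &, forall A B, A *m B = B *m A}.
  move=> A B; rewrite !inE => /orP[/eqP->|/mapP[v va ->]] /orP[/eqP->|/mapP[w wa ->]].
  - by [].
  - exact/comm_tau/vbasis_mem.
  - exact/esym/comm_tau/vbasis_mem.
  - apply/esym/eqP; rewrite -subr_eq0 -(admx_bracket brk_bilinear brk_derivation).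
    rewrite (a_abelian (vbasis_mem va) (vbasis_mem wa)).
    apply/eqP/row_mx_ext => u; rewrite (mul_admx brk_bilinear).
    by rewrite (bilinear0l brk_bilinear) mulmx0.
have [P Pu PA] := joint_eigenbasis inS symAs commAs.
exists P => // i; split.
  have [t] := PA _ (mem_head _ _) i; rewrite (mul_rV_linear _ tau_linear) => te.
  have rn0 : row i P != 0.
    apply/eqP => r0; have : row i P *m invmx P = 0 by rewrite r0 mul0mx.
    rewrite -row_mul mulmxV// => /rowP/(_ i); rewrite !mxE eqxx => /eqP.
    by rewrite oner_eq0.
  have t2 : t ^+ 2 = 1.
    have := tauK (row i P); rewrite te; have [g tg] := linear_packed tau_linear.
    rewrite tg linearZ /= -tg te scalerA -expr2 -{2}[row i P]scale1r => /eqP.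
    by rewrite -subr_eq0 -scalerBl scaler_eq0 (negPf rn0) orbF subr_eq0 => /eqP.
  move/eqP: t2; rewrite sqrf_eq1 => /orP[/eqP t1|/eqP t1]; rewrite t1 in te.
    by left; rewrite scale1r in te.
  by right; rewrite scaleN1r in te.
move=> Y Ya; rewrite (coord_vbasis Ya).
have ev v : v \in vbasis a -> exists t : R, brk v (row i P) = t *: row i P.
  move=> va; have [|t] := PA (admx brk v) _ i.
    by rewrite inE; apply/orP; right; apply/mapP; exists v.
  by rewrite (mul_admx brk_bilinear) => te; exists t.
apply: (big_ind (fun y => exists t : R, brk y (row i P) = t *: row i P)).
- by exists 0; rewrite (bilinear0l brk_bilinear) scale0r.
- move=> x y [t xt] [s ys]; exists (t + s).
  have := brk_bilinear.1 (row i P) 1 x y; rewrite !scale1r => ->.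
  by rewrite xt ys scalerDl.
- move=> j _; have [|t te] := ev (vbasis a)`_j; first exact: memt_nth.
  by eexists; rewrite (bilinearZl brk_bilinear) te scalerA.
Qed.


Hypothesis a_maximal : forall b : {vspace V}, (a <= b)%VS ->
  (forall v, v \in b -> dth v = - v /\ dsi v = - v) ->
  (forall v w, v \in b -> w \in b -> brk v w = 0) -> b = a.

(** The formula of [root_space], for the abstract bracket [brk]. *)
Definition weight_space (alpha : 'Hom(subvs_of a, R^o)) (X : V) : Prop :=
  forall Y : subvs_of a, brk (vsval Y) X = (alpha Y : R) *: X.

(** The eigenvalue is read off at a coordinate where [e] does not vanish, which makes its linearity
    in [Y] evident. *)
Lemma weight_of_eigenvector e : e != 0 ->
  (forall Y, Y \in a -> exists t : R, brk Y e = t *: e) ->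
  exists alpha, weight_space alpha e.
Proof.
move=> /rV0Pn[j ej] He.
pose f (Y : subvs_of a) : R^o := brk (vsval Y) e 0 j / e 0 j.
have lf : linear f.
  move=> k u v; rewrite /f linearP (brk_bilinear.1 e k (vsval u) (vsval v)) !mxE.
  by rewrite mulrDl -mulrA.
have [g fg] := linear_packed lf.
exists (linfun g) => Y; rewrite lfunE -fg /f.
by have [t ->] := He _ (subvsP Y); rewrite mxE mulfK.
Qed.

(** Adjoining the line of [u] to [a] gives an abelian subspace of the same kind, so maximality
    forces [u] into [a]. *)
Lemma centralizer_minus u : dth u = - u -> dsi u = - u ->
  (forall Y, Y \in a -> brk Y u = 0) -> u \in a.
Proof.
move=> u1 u2 u3.
have ub v : v \in (a + <[u]>)%VS -> exists2 w, w \in a & exists k : R, v = w + k *: u.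
  by move=> /memv_addP[w wa [_ /vlineP[k ->] ->]]; exists w => //; exists k.
have [gt tg] := linear_packed ldth; have [gs sg] := linear_packed ldsi.
have uu : brk u u = 0.
  have := brkC u u => /eqP; rewrite -addr_eq0 -mulr2n -scaler_nat scaler_eq0.
  by rewrite pnatr_eq0 /= => /eqP.
suff <- : (a + <[u]>)%VS = a by rewrite memvE; exact: addvSr.
apply: a_maximal.
- exact: addvSl.
- move=> v /ub[w wa [k ->]]; have [w1 w2] := a_minus wa.
  rewrite tg sg !linearD !linearZ /= -tg -sg w1 w2 u1 u2.
  by rewrite ?scalerN ?opprD.
- move=> v w /ub[v' va [k ->]] /ub[w' wa [l ->]].
  have bD x y z : brk (x + y) z = brk x z + brk y z.
    by have := brk_bilinear.1 z 1 x y; rewrite !scale1r.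
  have bD' x y z : brk z (x + y) = brk z x + brk z y.
    by have := brk_bilinear.2 z 1 x y; rewrite !scale1r.
  rewrite !bD !bD' !(bilinearZl brk_bilinear) !(bilinearZr brk_bilinear).
  rewrite a_abelian// uu (u3 v')// [brk u w']brkC (u3 w')//.
  by rewrite oppr0 !scaler0 !addr0.
Qed.

(** Stands for [Ad] of the exponential; the linear problem uses its linearity and its effect on
    eigenvectors. *)
Variable AdE : V -> V -> V.
Hypothesis AdE_linear : forall Y, linear (AdE Y).
Hypothesis AdE_eigen : forall Y X (t : R), brk Y X = t *: X -> AdE Y X = expR t *: X.

(** The involution changes the sign of every element of [a], hence of every weight. *)
Lemma brk_dth alpha e (Y : subvs_of a) : weight_space alpha e ->
  brk (vsval Y) (dth e) = - (alpha Y : R) *: dth e.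
Proof.
move=> we; have [Ya _] := a_minus (subvsP Y).
have := dth_brk (vsval Y) e; rewrite Ya we.
have -> : brk (- vsval Y) (dth e) = - brk (vsval Y) (dth e).
  by have := bilinearZl brk_bilinear (-1) (vsval Y) (dth e); rewrite !scaleN1r.
have [g ->] := linear_packed ldth; rewrite linearZ /= => /eqP.
by rewrite -eqr_oppLR => /eqP <-; rewrite scaleNr.
Qed.

Section Vector.
Variables (c : R) (e : V) (alpha : 'Hom(subvs_of a, R^o)) (Y : subvs_of a).
Hypothesis c0 : 0 < c.
Hypothesis we : weight_space alpha e.
Let f := dth e.
Let E : R := expR (alpha Y : R).
Let F : R := (expR (alpha Y : R))^-1.

(** Both [Z] and [AdE (vsval Y) Z] are bounded, since neither bound implies the other uniformly in
    [Y]: the first makes the factor in [H] small, the second keeps the contraction uniform. *)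
Definition sections_at (C : R) (W X A Z : V) : Prop :=
  [/\ dth X = X, A \in a, dsi Z = Z & X + A + AdE (vsval Y) Z = W] /\
  [/\ `|X| <= C, `|A| <= C, `|Z| <= C & `|AdE (vsval Y) Z| <= C].

Let AdEf (x y : R) : AdE (vsval Y) (x *: e + y *: f) = (x * E) *: e + (y * F) *: f.
Proof.
have [g gE] := linear_packed (AdE_linear (vsval Y)).
rewrite gE linearD !linearZ /= -gE (AdE_eigen (we Y)) (AdE_eigen (brk_dth Y we)).
by rewrite expRN !scalerA.
Qed.

Let dthf (x y : R) : dth (x *: e + y *: f) = y *: e + x *: f.
Proof.
have [g gE] := linear_packed ldth.
by rewrite gE linearD !linearZ /= -gE /f dthK addrC.
Qed.

Let E0 : 0 < E. Proof. exact: expR_gt0. Qed.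
Let F0 : 0 < F. Proof. by rewrite invr_gt0. Qed.
Let EF : E * F = 1. Proof. by rewrite mulfV// gt_eqF. Qed.

Let comb_le (k x y : R) : `|x| <= k -> `|y| <= k ->
  `|x *: e + y *: f| <= k * (`|e| + `|f|).
Proof.
move=> xk yk; apply: le_trans (ler_normD _ _) _; rewrite !normrZ mulrDr.
by rewrite lerD// ler_wpM2r.
Qed.

(* On the plane spanned by [e] and [f = dth e] the map [AdE Y] is [diag(E, 1/E)],
   and [x *: (e + f) + AdE Y (z *: (e + s *: f)) = e] is a linear system in
   [x], [z] with determinant [s / E - E]. *)
Lemma section_of (k s x z : R) : s = 1 \/ s = -1 -> dsi f = s *: e ->
  x + z * E = 1 -> x + s * z * F = 0 -> `|x| <= k -> `|z| <= k ->
  exists X A Z, sections_at ((1 + k) * (`|e| + `|f|)) e X A Z.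
Proof.
move=> s1 fe xz1 xz0 xk zk.
have k0 : 0 <= k by apply: le_trans xk.
have ss : s * s = 1 by case: s1 => ->; rewrite ?mulr1// mulrNN mulr1.
have sn : `|s| = 1 by case: s1 => ->; rewrite ?normrN normr1.
have zE : z * E = 1 - x by rewrite -xz1 addrC addKr.
have zF : s * z * F = - x by apply/eqP; rewrite -addr_eq0 addrC xz0.
have ef : dsi e = s *: f by rewrite -[f in RHS]dsiK fe; have [g ->] := linear_packed ldsi;
  rewrite linearZ scalerA ss scale1r.
exists (x *: e + x *: f), 0, (z *: e + (s * z) *: f); split; split.
- by rewrite dthf addrC.
- exact: mem0v.
- have [g gE] := linear_packed ldsi.
  rewrite gE linearD !linearZ /= -gE ef fe !scalerA addrC mulrAC ss mul1r.
  by rewrite [z * s]mulrC.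
- rewrite addr0 AdEf zE zF addrACA -!scalerDl subrr scale0r addr0.
  by rewrite addrC subrK scale1r.
- by apply: comb_le; rewrite (le_trans xk)// lerDr.
- by rewrite normr0 mulr_ge0 ?addr_ge0.
- apply: comb_le; first by rewrite (le_trans zk)// lerDr.
  by rewrite normrM sn mul1r (le_trans zk)// lerDr.
- rewrite AdEf zE zF; apply: comb_le; last by rewrite normrN (le_trans xk)// lerDr.
  by apply: le_trans (ler_normB _ _) _; rewrite normr1 lerD2l.
Qed.

(** As [E * F = 1], one of [E] and [F] is at least 1, so [(E + F)^-1] is at most 1 whatever the
    weight and [Y]. *)
Lemma section_minus : dsi f = - e ->
  exists X A Z, sections_at ((1 + 1) * (`|e| + `|f|)) e X A Z.
Proof.
move=> fe; have EF0 : 0 < E + F by rewrite addr_gt0.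
have e0 := E0; have f0 := F0; have ef := EF.
pose z := (E + F)^-1.
have z0 : 0 < z by rewrite invr_gt0.
have zEF : z * (E + F) = 1 by rewrite mulVf// gt_eqF.
apply: (@section_of _ (-1) (z * F) z).
- by right.
- by rewrite fe scaleN1r.
- by rewrite -mulrDr addrC.
- by rewrite mulN1r mulNr subrr.
- rewrite ger0_norm; last by rewrite mulr_ge0 ?ltW.
  have : z * F <= z * (E + F) by rewrite ler_wpM2l ?ltW// ltrDr.
  by rewrite zEF.
- rewrite gtr0_norm// /z invf_le1//.
  have [E1|/ltW E1] := leP 1 E; first by rewrite (le_trans E1)// lerDl ltW.
  have F1 : 1 <= F by rewrite /F invf_ge1.
  by rewrite (le_trans F1)// lerDr ltW.
Qed.

(** Here [E = 1] makes the 2 x 2 system singular. The half of [e] on which [dth] acts by -1 goes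
    into [a] by [centralizer_minus], and [Z] is 0. *)
Lemma section_zero : alpha = 0 -> dsi f = e ->
  exists X A Z, sections_at ((1 + 1) * (`|e| + `|f|)) e X A Z.
Proof.
move=> al0 fe.
have ef : dsi e = f by rewrite -fe dsiK.
have mid : 2^-1 *: e + 2^-1 *: f + (2^-1 *: e + (- 2^-1) *: f) = e.
  have hh : 2^-1 + 2^-1 = 1 :> R by lra.
  by rewrite addrACA -!scalerDl subrr scale0r addr0 hh scale1r.
have [gs sE] := linear_packed ldsi; have [ga aE] := linear_packed (AdE_linear (vsval Y)).
have h1 (x : R) : `|x| = 2^-1 -> `|x| <= 1 + 1 by move=> ->; lra.
exists (2^-1 *: e + 2^-1 *: f), (2^-1 *: e + (- 2^-1) *: f), 0; split; split.
- by rewrite dthf.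
- apply: centralizer_minus.
  + by rewrite dthf opprD !scaleNr opprK addrC.
  + by rewrite sE linearD !linearZ /= -sE ef fe opprD !scaleNr opprK addrC.
  + move=> Z Za; have := we (vsproj a Z); have := brk_dth (vsproj a Z) we.
    rewrite vsprojK// al0 lfunE oppr0 !scale0r => b1 b2.
    rewrite -(scale1r (2^-1 *: e)) (brk_bilinear.2 Z 1).
    by rewrite !(bilinearZr brk_bilinear) b1 b2 !scaler0 addr0.
- by rewrite sE linear0.
- by rewrite aE linear0 addr0 mid.
- by apply: comb_le; apply: h1; rewrite gtr0_norm.
- by apply: comb_le; apply: h1; rewrite ?normrN gtr0_norm.
- by rewrite normr0 mulr_ge0 ?addr_ge0.
- by rewrite aE linear0 normr0 mulr_ge0 ?addr_ge0.
Qed.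

(** The gap [|E - F|] is at least [expR c - (expR c)^-1], and the sign of [alpha Y] decides which of
    [E] and [F] is at most 1. The inner 1 in the constant comes from the case of large [F], where
    [F / (F - E) = 1 + E / (F - E)]. *)
Lemma section_plus : c < `|alpha Y : R| -> dsi f = e ->
  exists X A Z, sections_at
    ((1 + (1 + (expR c - (expR c)^-1)^-1)) * (`|e| + `|f|)) e X A Z.
Proof.
move=> lc fe.
set q := expR c; set d := q - q^-1.
have q1 : 1 < q by rewrite expR_gt1.
have q0 : 0 < q by rewrite expR_gt0.
have d0 : 0 < d by rewrite subr_gt0 (lt_trans _ q1)// invf_lt1.
have e0 := E0; have f0 := F0; have ef := EF.
have [Edom|Fdom] : d <= E - F /\ F <= 1 \/ d <= F - E /\ E <= 1.
  have := lc; rewrite lter_normr => /orP[l1|l1]; [left|right].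
  - have qE : q <= E by rewrite ler_expR ltW.
    have Fq : F <= q^-1 by rewrite lef_pV2 ?posrE.
    by split; [exact: lerB|rewrite (le_trans Fq)// invf_le1// ltW].
  - have qF : q <= F by rewrite /F -expRN ler_expR ltW.
    have Eq : E <= q^-1 by rewrite -[E]invrK lef_pV2 ?posrE.
    by split; [exact: lerB|rewrite (le_trans Eq)// invf_le1// ltW].
- have EF0 : 0 < E - F by exact: lt_le_trans d0 Edom.1.
  have zd : (E - F)^-1 <= d^-1 by rewrite lef_pV2 ?posrE ?Edom.1.
  have z0 : 0 < (E - F)^-1 by rewrite invr_gt0.
  apply: (@section_of _ 1 (- (E - F)^-1 * F) (E - F)^-1).
  + by left.
  + by rewrite fe scale1r.
  + by rewrite mulNr addrC -mulrBr mulVf// gt_eqF.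
  + by rewrite mul1r mulNr addNr.
  + rewrite mulNr normrN ger0_norm; last by rewrite mulr_ge0 ?ltW.
    have : (E - F)^-1 * F <= (E - F)^-1 by exact: ler_piMr (ltW z0) Edom.2.
    by have := zd; lra.
  + by rewrite gtr0_norm//; have := zd; lra.
- have EF0 : 0 < F - E by exact: lt_le_trans d0 Fdom.1.
  have zd : (F - E)^-1 <= d^-1 by rewrite lef_pV2 ?posrE ?Fdom.1.
  have z0 : 0 < (F - E)^-1 by rewrite invr_gt0.
  have zE : (F - E)^-1 * (F - E) = 1 by rewrite mulVf// gt_eqF.
  have zE1 : (F - E)^-1 * E <= (F - E)^-1 by exact: ler_piMr (ltW z0) Fdom.2.
  move: (F - E)^-1 zd z0 zE zE1 => z zd z0 zE zE1; rewrite mulrBr in zE.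
  apply: (@section_of _ 1 (z * F) (- z)).
  + by left.
  + by rewrite fe scale1r.
  + by rewrite mulNr.
  + by rewrite mul1r mulNr subrr.
  + rewrite ger0_norm; last by rewrite mulr_ge0 ?ltW.
    by have := zd; move: (z * F) (z * E) zE zE1 => zF z'; lra.
  + by rewrite normrN gtr0_norm//; have := zd; lra.
Qed.

End Vector.

Definition fixed_weight (alpha : 'Hom(subvs_of a, R^o)) : Prop :=
  alpha != 0 /\ exists X, [/\ X != 0, weight_space alpha X & dsi (dth X) = X].

(** Solutions are chosen on the eigenbasis, which does not depend on [Y], and extended linearly.
    Only finitely many vectors then need a bound uniform in [Y], and linearity lets the contraction
    argument bound differences. *)
Lemma decomposition (c : R) : 0 < c -> exists2 C : R, 0 < C &
  forall Y : subvs_of a,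
    (forall alpha, fixed_weight alpha -> c < `|alpha Y : R|) ->
    exists sk sa sh : V -> V, [/\ linear sk, linear sa, linear sh &
      forall W, sections_at Y (C * `|W|) W (sk W) (sa W) (sh W)].
Proof.
move=> c0; have [P Pu PP] := root_eigenbasis.
have rn0 i : row i P != 0.
  apply/eqP => r0; have : row i P *m invmx P = 0 by rewrite r0 mul0mx.
  rewrite -row_mul mulmxV// => /rowP/(_ i); rewrite !mxE eqxx => /eqP.
  by rewrite oner_eq0.
(* The constant of [section_plus]; it dominates the constant [1 + 1] of the other two cases. *)
pose k : R := 1 + (1 + (expR c - (expR c)^-1)^-1).
have k2 : 1 + 1 <= k.
  have q1 : 1 < expR c by rewrite expR_gt1.
  rewrite lerD2l lerDl invr_ge0 subr_ge0 ltW// (lt_trans _ q1)//.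
  by rewrite invf_lt1// expR_gt0.
have k0 : 0 < k by apply: lt_le_trans k2; rewrite addr_gt0.
pose D i := k * (`|row i P| + `|dth (row i P)|).
have D0 i : 0 <= D i by apply: mulr_ge0; [exact: ltW|apply: addr_ge0].
(* Bounds the coordinates of a vector in the eigenbasis by its norm. *)
pose K : R := \sum_i `|(delta_mx 0 i : V) *m invmx P|.
have K0 : 0 <= K by apply: sumr_ge0.
pose C := (\sum_i D i) * K.
have C0 : 0 <= C by rewrite mulr_ge0 ?sumr_ge0.
exists (C + 1) => [|Y HY]; first by rewrite ltr_wpDl ?ltr01.
have Hi i : exists s : V * V * V,
    sections_at Y (D i) (row i P) s.1.1 s.1.2 s.2.
  have up j W X A Z : (1 + 1 <= j -> sections_at Y (j * (`|row i P| + `|dth (row i P)|)) W X A Z ->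
    j <= k -> sections_at Y (D i) W X A Z).
    move=> _ [? [h1 h2 h3 h4]] jk; split=> //.
    have jD : j * (`|row i P| + `|dth (row i P)|) <= D i by rewrite ler_wpM2r ?addr_ge0.
    by split; apply: le_trans jD.
  suff [X [A [Z H]]] : exists X A Z, sections_at Y (D i) (row i P) X A Z by exists (X, A, Z).
  have [tE wE] := PP i; have [alpha we] := weight_of_eigenvector (rn0 i) wE.
  case: tE => tE; last first.
    have [X [A [Z H]]] := section_minus Y we tE.
    by exists X, A, Z; apply: up H k2.
  have [al0|aln0] := eqVneq alpha 0.
    have [X [A [Z H]]] := section_zero Y we al0 tE.
    by exists X, A, Z; apply: up H k2.
  have lc : c < `|alpha Y : R|.
    by apply: HY; split => //; exists (row i P).
  by apply: (section_plus c0 we lc tE).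
have [s Hs] := choice Hi.
pose w (W : V) i := (W *m invmx P) 0 i.
have wl i : linear (w ^~ i : V -> R^o).
  by move=> t u v; rewrite /w mulmxDl -scalemxAl !mxE.
have sl (x : 'I_n -> V) : linear (fun W => \sum_i w W i *: x i).
  move=> t u v; rewrite scaler_sumr -big_split /=; apply: eq_bigr => i _.
  by rewrite (wl i) scalerDl scalerA.
have wW W : W = \sum_i w W i *: row i P.
  by rewrite -[LHS]mulmx1 -(mulVmx Pu) mulmxA mulmx_sum_row.
have wle W i : `|w W i| <= K * `|W|.
  apply: le_trans (coord_norm_le _ _) _.
  apply: (@linear_row_bound _ _ _ (fun W : V => W *m invmx P)).
  by move=> t u v; rewrite mulmxDl -scalemxAl.
have bound W (x : 'I_n -> V) : (forall i, `|x i| <= D i) ->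
    `|\sum_i w W i *: x i| <= (C + 1) * `|W|.
  move=> xD; apply: le_trans (ler_norm_sum _ _ _) _.
  apply: (@le_trans _ _ (C * `|W|)); last by rewrite ler_wpM2r// lerDl.
  rewrite -mulrA mulr_suml; apply: ler_sum => i _.
  by rewrite normrZ mulrC ler_pM.
exists (fun W => \sum_i w W i *: (s i).1.1), (fun W => \sum_i w W i *: (s i).1.2),
  (fun W => \sum_i w W i *: (s i).2); split; try exact: sl.
have lsum (f : V -> V) (x : 'I_n -> V) W : linear f ->
    f (\sum_i w W i *: x i) = \sum_i w W i *: f (x i).
  by move=> /linear_packed[g ->]; rewrite linear_sum; apply: eq_bigr => i _; rewrite linearZ.
move=> W; split; split.
- rewrite lsum//; apply: eq_bigr => i _; by have [[-> _ _ _] _] := Hs i.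
- by apply: memv_suml => i _; apply: memvZ; have [[_ ? _ _] _] := Hs i.
- rewrite lsum//; apply: eq_bigr => i _; by have [[_ _ -> _] _] := Hs i.
- rewrite (lsum _ _ _ (AdE_linear _)) -!big_split /= [RHS]wW; apply: eq_bigr => i _.
  by rewrite -!scalerDr; have [[_ _ _ ->] _] := Hs i.
- by apply: bound => i; have [_ []] := Hs i.
- by apply: bound => i; have [_ []] := Hs i.
- by apply: bound => i; have [_ []] := Hs i.
- by rewrite (lsum _ _ _ (AdE_linear _)); apply: bound => i; have [_ []] := Hs i.
Qed.

End Eigenbasis.

(* A root violating the bound is not simple, hence a sum of two positive roots,
   one of which violates it too; iterating would yield infinitely many
   eigenvalues of the adjoint action of [Y0]. *)
Lemma positive_roots_gt (R : realType) (n : nat)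
    (brk : 'rV[R]_n -> 'rV[R]_n -> 'rV[R]_n) (a : {vspace 'rV[R]_n})
    (P : set 'Hom(subvs_of a, R^o)) (Y0 Y : subvs_of a) (c : R) :
  bilinear_map brk -> 0 < c ->
  (forall alpha, P alpha -> 0 < (alpha Y0 : R)) ->
  (forall alpha, P alpha -> exists2 X, X != 0 & weight_space brk alpha X) ->
  (forall alpha, simple_roots P alpha -> c < (alpha Y : R)) ->
  forall alpha, P alpha -> c < (alpha Y : R).
Proof.
move=> bb c0 P0 Pw Hs alpha Pa; rewrite ltNge; apply/negP => bad.
have step b : P b -> (b Y : R) <= c ->
    exists b', [/\ P b', (b' Y : R) <= c & (b' Y0 : R) < b Y0].
  move=> Pb bY.
  have : ~ simple_roots P b by move=> /Hs; rewrite ltNge bY.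
  move=> /not_andP[//|/contrapT[b1 [b2 [Pb1 Pb2 bE]]]].
  have Y0E : b Y0 = b1 Y0 + b2 Y0 by rewrite bE add_lfunE.
  have YE : b Y = b1 Y + b2 Y by rewrite bE add_lfunE.
  have := P0 _ Pb1; have := P0 _ Pb2.
  have [b1c|b1c] := leP (b1 Y : R) c.
    by exists b1; split=> //; rewrite Y0E ltrDl.
  exists b2; split=> //; last by rewrite Y0E ltrDr.
  by have := bY; rewrite YE; lra.
pose ev (t : R) := root (char_poly (admx brk (vsval Y0))) t.
have Pev b : P b -> ev (b Y0).
  move=> /Pw[X Xn0 wX]; rewrite /ev -eigenvalue_root_char.
  by apply/eigenvalueP; exists X => //; rewrite (mul_admx bb) wX.
have chain k : exists rs : seq R, [/\ size rs = k, uniq rs, all ev rs &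
    exists b, [/\ P b, (b Y : R) <= c & all (fun r => (b Y0 : R) < r) rs]].
  elim: k => [|k [rs [sk urs ers [b [Pb bY brs]]]]].
    by exists [::]; split=> //; exists alpha.
  have [b' [Pb' b'Y b'b]] := step b Pb bY.
  exists ((b Y0 : R) :: rs); split=> //=; rewrite ?sk ?urs ?ers ?andbT //.
  - by apply/negP => /(allP brs); rewrite ltxx.
  - exact: Pev.
  - exists b'; split=> //; rewrite b'b; apply/allP => r /(allP brs).
    exact: lt_trans.
have [rs [srs urs ers _]] := chain (size (char_poly (admx brk (vsval Y0)))).
have := max_poly_roots _ ers urs; rewrite srs ltnn => H.
suff : false by [].
by apply: H; rewrite monic_neq0 // char_poly_monic.
Qed.

(** * The linear problem in the Lie algebra of the group *)

Section GroupDecomposition.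
Context {R : realType} {n : nat} {G : lieGroup R n}.
Local Notation V := 'rV[R]_n.
Local Notation lexp := (lexp G).
Local Notation brk := (lie_bracket G).

Lemma lie_bracketC v w : brk v w = - brk w v.
Proof. by rewrite !lie_bracketE opprB. Qed.

Lemma lexp_lie_diff (f : G -> G) (t : R) (v : V) : lie_hom f ->
  lexp (t *: lie_diff f v) = f (lexp (t *: v)).
Proof.
move=> hf; have e1 := lie_hom_lexp (t *: v) hf; have e2 := lie_diffZ t v hf.
exact: etrans (congr1 lexp (esym e2)) (esym e1).
Qed.

Lemma lie_diff_commute (f h : G -> G) v : lie_hom f -> lie_hom h ->
  (forall x, f (h x) = h (f x)) ->
  lie_diff f (lie_diff h v) = lie_diff h (lie_diff f v).
Proof.
move=> hf hh fh; apply: (lie_diff_unique hf) => t.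
have e1 := lexp_lie_diff t v hh; have e2 := lexp_lie_diff t (lie_diff f v) hh.
have e3 := lexp_lie_diff t v hf.
exact: etrans (congr1 f e1) (etrans (fh _) (etrans (congr1 h (esym e3)) (esym e2))).
Qed.

Lemma lie_diff_involutive (f : G -> G) : lie_hom f -> involutive f ->
  involutive (lie_diff f).
Proof.
move=> hf ff v; apply: (lie_diff_unique hf) => t.
exact: etrans (congr1 f (lexp_lie_diff t v hf)) (ff _).
Qed.

Lemma lie_involution_hom (f : G -> G) : lie_involution f -> lie_hom f.
Proof. by move=> [/lie_endomorphism_hom]. Qed.

Lemma lie_hom_linear (f : G -> G) : lie_hom f -> linear (lie_diff f).
Proof. by case. Qed.


Variables theta sigma : G -> G.
Hypothesis cartan : cartan_involution theta.
Hypothesis sigma_inv : lie_involution sigma.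
Hypothesis sigma_theta : forall x, sigma (theta x) = theta (sigma x).

Opaque lie_bracket.

Let hth : lie_hom theta. Proof. exact: lie_involution_hom cartan.1. Qed.
Let hsi : lie_hom sigma. Proof. exact: lie_involution_hom. Qed.
Let dth_brk v w : lie_diff theta (brk v w) = brk (lie_diff theta v) (lie_diff theta w).
Proof. exact: lie_hom_bracket. Qed.
Let dsi_brk v w : lie_diff sigma (brk v w) = brk (lie_diff sigma v) (lie_diff sigma w).
Proof. exact: lie_hom_bracket. Qed.
Let dthK : involutive (lie_diff theta).
Proof. exact: lie_diff_involutive hth cartan.1.2. Qed.
Let dsiK : involutive (lie_diff sigma).
Proof. exact: lie_diff_involutive hsi sigma_inv.2. Qed.
Let dsi_dth v : lie_diff sigma (lie_diff theta v) = lie_diff theta (lie_diff sigma v).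
Proof. exact: lie_diff_commute. Qed.
Let dth_pos v : v != 0 -> 0 < - trace_form brk v (lie_diff theta v).
Proof. exact: cartan.2. Qed.

Lemma Ad_bounded : exists2 C : R, 0 < C &
  forall (k : G) v, theta k = k -> `|Ad k v| <= C * `|v|.
Proof.
have [C C0 HC] := automorphism_bounded lie_bracket_bilinear
  (lie_hom_linear hth) dthK dth_brk dth_pos.
have AdK (g : G) v : Ad g (Ad g^-1%g v) = v by rewrite -AdM mulgV Ad1.
exists C => // k v kk.
apply: (HC (Ad k) (Ad k^-1%g) (Ad_linear k) (Ad_linear _) _ (AdK k)).
- by move=> u; have := AdK k^-1%g u; rewrite invgK.
- exact: Ad_bracket.
- by move=> u; rewrite (lie_diff_Ad k u hth) kk.
Qed.

Variable a : {vspace V}.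
Hypothesis a_maximal :
  maximal_abelian_in G (minus_space theta `&` minus_space sigma) a.
Variable Sigma_pos : set 'Hom(subvs_of a, R^o).
Hypothesis Sigma_pos_system : positive_system (restricted_roots G a) Sigma_pos.

(** The absolute value accounts for negative roots: if [X] has weight [alpha], then
    [lie_diff theta X] has weight [- alpha] and is again fixed by the composite of the two
    differentials. *)
Lemma fixed_root_gt (c : R) (Y : subvs_of a) : 0 < c ->
  (forall alpha, simple_roots (Sigma_pos `&` fixed_roots a sigma theta) alpha ->
    c < (alpha Y : R)) ->
  forall alpha, fixed_weight brk (lie_diff theta) (lie_diff sigma) alpha ->
    c < `|alpha Y : R|.
Proof.
move=> c0 HY; have [Y0 [Y0n Sp]] := Sigma_pos_system.
have [am _ _] := a_maximal.
have gt := @positive_roots_gt R n brk a (Sigma_pos `&` fixed_roots a sigma theta)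
  Y0 Y c lie_bracket_bilinear c0.
have pos alpha : (Sigma_pos `&` fixed_roots a sigma theta) alpha -> c < alpha Y.
  apply: gt => // beta; first by rewrite Sp => -[[_ b0] _].
  by move=> [_ [[_ [X Xn0 wX]] _]]; exists X.
move=> alpha [an0 [X [Xn0 wX sX]]].
have Sa : restricted_roots G a alpha by split => //; exists X.
have /lt_total/orP[aneg|apos] := Y0n _ Sa.
  rewrite -normrN; apply: lt_le_trans (ler_norm _).
  have wX' : weight_space brk (- alpha) (lie_diff theta X).
    move=> Z; rewrite opp_lfunE.
    apply: (brk_dth lie_bracket_bilinear (lie_hom_linear hth) dth_brk) => //.
    by move=> v /am[? ?].
  have tX0 : lie_diff theta X != 0.
    apply: contraNneq Xn0 => tX0; rewrite -(dthK X) tX0.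
    by have [g ->] := linear_packed (lie_hom_linear hth); rewrite linear0.
  have an0' : - alpha != 0 by rewrite oppr_eq0.
  have := pos (- alpha); rewrite opp_lfunE; apply; split.
    by rewrite Sp; split; [split => //; exists (lie_diff theta X)|rewrite opp_lfunE oppr_gt0].
  split; first by split => //; exists (lie_diff theta X).
  exists (lie_diff theta X); split; [exact: tX0|exact: wX'|].
  by rewrite (dsi_dth (lie_diff theta X)) sX.
apply: lt_le_trans (ler_norm _); apply: pos; split; first by rewrite Sp.
by split => //; exists X.
Qed.

Lemma group_decomposition (c : R) : 0 < c -> exists2 C : R, 0 < C &
  forall Y : subvs_of a,
    (forall alpha, simple_roots (Sigma_pos `&` fixed_roots a sigma theta) alpha ->
      c < (alpha Y : R)) ->
    exists sk sa sh : V -> V, [/\ linear sk, linear sa, linear sh &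
      forall W, sections_at (lie_diff theta) (lie_diff sigma) (fun Y => Ad (lexp Y))
        Y (C * `|W|) W (sk W) (sa W) (sh W)].
Proof.
move=> c0; have [am aab amax] := a_maximal.
have [||||C C0 HC] := @decomposition R n brk lie_bracket_bilinear bracket_derivation
  lie_bracketC (lie_diff theta) (lie_diff sigma) (lie_hom_linear hth) dthK dth_brk
  dth_pos (lie_hom_linear hsi) dsiK dsi_brk dsi_dth a _ aab _
  (fun Y => Ad (lexp Y)) _ _ c c0.
- by move=> v /am[].
- by move=> b ab bm babel; apply: amax.
- by move=> Y; exact: Ad_linear.
- by move=> Y X t; exact: Ad_eigenvector.
exists C => // Y HY; apply: HC.
exact: fixed_root_gt.
Qed.

End GroupDecomposition.

(** * Comparison of Riemannian and coordinate balls *)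

(** With [S] the primitive of [f], the function [S - s * z] is nondecreasing when [|s| <= 1]; taking
    [s] equal to 1 and -1 gives the bound without integrating the derivative of [z]. *)
Lemma integral_bound_increment (R : realType) (f z : R -> R) (T : R) :
  (forall t : R, 0 <= t <= 1 -> {for t, continuous f}) ->
  (forall t : R, 0 <= t <= 1 -> 0 <= f t) -> 0 <= T <= 1 ->
  (forall t : R, 0 <= t <= T -> derivable z t 1 /\ `|'D_1 z t| <= f t) ->
  `|z T - z 0| <= (\int[lebesgue_measure]_(t in `[0, 1]) f t)%R.
Proof.
move=> cf f0 /andP[T0 T1] dz.
have cfw : {within `[0, 1], continuous f}.
  by apply: continuous_in_subspaceT => t; rewrite inE/= in_itv/= => /cf.
have intf := continuous_compact_integrable (@segment_compact R 0 1) cfw.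
pose S x := (\int[lebesgue_measure]_(t in `[0, x]) f t)%R.
have S0 : S 0 = 0 by rewrite /S set_itv1 Rintegral_set1.
have cS : {within `[0, 1], continuous S} := parameterized_integral_continuous ler01 intf.
have dS (x : R) : 0 < x < 1 -> derivable S x 1 /\ derive1 S x = f x.
  move=> /andP[x0 x1]; apply: (continuous_FTC1 x1 intf) => //.
  by apply: cf; rewrite !ltW.
have S1 : S T <= (\int[lebesgue_measure]_(t in `[0, 1]) f t)%R.
  change (S T <= S 1).
  apply: (@ger0_derive1_le_cc _ S 0 1) => //; rewrite ?in_itv/= ?T0 ?T1 ?lexx ?ler01//.
    by move=> x; rewrite in_itv /= => /dS[].
  move=> x; rewrite in_itv /= => x01; have [_ ->] := dS _ x01.
  by move: x01 => /andP[x0 x1]; apply: f0; rewrite !ltW.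
move: (\int[lebesgue_measure]_(t in `[0, 1]) f t)%R S S0 cS dS S1 => I S S0 cS dS S1.
apply: le_trans S1; rewrite ler_norml.
have cz : {within `[0, T], continuous z}.
  apply: derivable_within_continuous => t; rewrite in_itv /= => t0T.
  by have [] := dz _ t0T.
have cST : {within `[0, T], continuous S}.
  by apply: continuous_subspaceW cS => t /=; rewrite !in_itv/= => /andP[-> /le_trans]; apply.
have key (s : R) : `|s| <= 1 -> s * (z T - z 0) <= S T.
  move=> s1; pose h t := S t - s * z t.
  suff : h 0 <= h T by rewrite /h S0; lra.
  have dh (x : R) : x \in `]0, T[ -> is_derive x 1 h (f x - s * 'D_1 z x).
    rewrite in_itv /= => /andP[x0 xT].
    have [dSx Sx] := dS x (introT andP (conj x0 (lt_le_trans xT T1))).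
    have [dzx _] := dz x (introT andP (conj (ltW x0) (ltW xT))).
    have h1 : is_derive x 1 S (f x) by apply: DeriveDef dSx _; rewrite -Sx derive1E.
    have h2 : is_derive x 1 z ('D_1 z x) by split.
    exact: is_deriveB.
  apply: (@ger0_derive1_le_cc _ h 0 T); rewrite ?in_itv/= ?T0 ?lexx//.
  - by move=> x /dh[].
  - move=> x xT; rewrite derive1E; have [_ ->] := dh x xT.
    move: xT; rewrite in_itv /= => /andP[x0 xT].
    have [_ dzx] := dz x (introT andP (conj (ltW x0) (ltW xT))).
    rewrite subr_ge0 (le_trans (ler_norm _))// normrM (le_trans _ dzx)//.
    by rewrite ler_piMl.
  - move=> t; apply: cvgB; first exact: cST.
    by apply: cvgM; [exact: cvg_cst|exact: cz].
have := key 1; have := key (-1); rewrite normrN normr1 lexx => /(_ isT) k1 /(_ isT) k2.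
by apply/andP; split; lra.
Qed.

Lemma form_le (R : realType) (n : nat) (S : 'M[R]_n) (v : 'rV[R]_n) :
  `|form S v v : R| <= (n%:R * n%:R * `|S|) * `|v| ^+ 2.
Proof.
have S_le i j : `|S i j| <= `|S|.
  rewrite [leRHS]/Num.Def.normr/= mx_normrE.
  exact: (le_bigmax _ (fun ij => `|S ij.1 ij.2|) (i, j)).
rewrite /form mxE; apply: le_trans (ler_norm_sum _ _ _) _.
have -> : n%:R * n%:R * `|S| * `|v| ^+ 2 = \sum_(j < n) (n%:R * `|S| * `|v| ^+ 2).
  by rewrite sumr_const card_ord -[RHS]mulr_natl !mulrA.
apply: ler_sum => j _; rewrite normrM !mxE.
have -> : n%:R * `|S| * `|v| ^+ 2 = (\sum_(i < n) (`|v| * `|S|)) * `|v|.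
  by rewrite sumr_const card_ord -[in RHS]mulr_natl expr2; ring.
apply: ler_pM => //; last exact: coord_norm_le.
apply: le_trans (ler_norm_sum _ _ _) _; apply: ler_sum => i _.
by rewrite normrM ler_pM// coord_norm_le.
Qed.

Lemma cvg_sumr (R : realType) (I T : Type) (r : seq I) (F : set_system T)
    {FF : Filter F} (f : I -> T -> R) (a : I -> R) :
  (forall i, f i x @[x --> F] --> a i) ->
  \sum_(i <- r) f i x @[x --> F] --> \sum_(i <- r) a i.
Proof.
move=> fa; elim: r => [|i r IH].
  by rewrite big_nil; under eq_cvg do rewrite big_nil; exact: cvg_cst.
rewrite big_cons; under eq_cvg do rewrite big_cons.
exact: cvgD (fa i) IH.
Qed.

Section Metric.
Context {R : realType} {n : nat} {G : lieGroup R n} (m : riemannian_metric G).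
Local Notation V := 'rV[R]_n.
Local Notation phi := (chart_map (id_chart G)).
Local Notation psi := (chart_inv (id_chart G)).
Local Notation x1 := (phi 1%g).
Local Notation dom := (chart_dom (id_chart G)).
Local Notation cod := (chart_cod (id_chart G)).
Local Notation P := (@from_coord R n G).
Local Notation Q := (@to_coord R n G).
Local Notation gm := (gram m (id_chart G)).

(** Near the identity the Gram matrix stays so close to its value there that the quadratic form of
    [v] changes by at most [c / 2 * |v| ^+ 2], half of its lower bound. *)
Lemma gram_bounds : exists r c C : R, [/\ 0 < r, 0 < c, 0 < C &
  forall x v : V, `|x| <= r -> cod (x1 + x) /\
    c * `|v| <= Num.sqrt (form (gm (x1 + x)) v v : R) <= C * `|v|].
Proof.
have pos (v : V) : v != 0 -> 0 < form (gm x1) v v.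
  exact: (gram_pos m (id_chart_atlas G) (cod_unit G)).
have iS : inner_product (gm x1).
  split; first exact: (gram_sym m (id_chart_atlas G) (cod_unit G)).
  exact: pos.
have [c c0 Hc] := form_lower_bound iS.
have gc : {for x1, continuous gm}.
  exact: (gram_smooth m (id_chart_atlas G) 0%N x1 (cod_unit G)).
(* The factor [n%:R * n%:R] comes from [form_le]; the added 1 keeps the denominator positive. *)
pose d : R := c / 2 / (n%:R * n%:R + 1).
have n0 : 0 < n%:R * n%:R + 1 :> R by rewrite ltr_wpDl// mulr_ge0.
have d0 : 0 < d by rewrite !divr_gt0.
have near1 : \forall x \near x1, `|gm x1 - gm x| < d.
  by have /cvgrPdist_lt/(_ d d0) := gc.
have near2 : \forall x \near x1, cod x.
  by apply: open_nbhs_nbhs; split; [exact: chart_cod_open|exact: cod_unit].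
have [r /= r0 Hr] := (nbhs_ballP _ _).1 (filterI near1 near2).
pose M : R := n%:R * n%:R * `|gm x1| + c.
have M0 : 0 < M by rewrite ltr_wpDl// !mulr_ge0.
exists (r / 2), (Num.sqrt (c / 2)), (Num.sqrt M); split.
- by rewrite divr_gt0.
- by rewrite sqrtr_gt0 divr_gt0.
- by rewrite sqrtr_gt0.
move=> x v xr.
have : ball x1 r (x1 + x).
  rewrite -ball_normE /= opprD addrA subrr sub0r normrN.
  by apply: le_lt_trans xr _; rewrite ltr_pdivrMr// ltr_pMr// ltr1n.
move=> /Hr[gd cx]; split=> //.
have dif : `|form (gm (x1 + x)) v v - form (gm x1) v v : R| <= c / 2 * `|v| ^+ 2.
  have -> : form (gm (x1 + x)) v v - form (gm x1) v v =
      form (gm (x1 + x) - gm x1) v v.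
    by rewrite /form mulmxBr mulmxBl !mxE.
  apply: le_trans (form_le _ _) _; rewrite ler_wpM2r ?exprn_ge0//.
  have gd' : `|gm (x1 + x) - gm x1| <= d by rewrite distrC ltW.
  apply: (@le_trans _ _ (n%:R * n%:R * d)); first by rewrite ler_wpM2l// mulr_ge0.
  rewrite /d mulrA ler_pdivrMr// [leLHS]mulrC ler_wpM2l ?divr_ge0 ?(ltW c0)//.
  by rewrite lerDl.
have up := form_le (gm x1) v; have lo := Hc v.
have v2 : 0 <= `|v| ^+ 2 by rewrite exprn_ge0.
have sv : `|v| = Num.sqrt (`|v| ^+ 2) by rewrite sqrtr_sqr normr_id.
rewrite sv -!sqrtrM ?divr_ge0 ?(ltW c0) ?(ltW M0)//.
move: dif up lo; rewrite /M; move: (form (gm (x1 + x)) v v) (form (gm x1) v v) => f1 f2.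
move: (n%:R * n%:R * `|gm x1|) => K; move: (`|v| ^+ 2) v2 => q q0.
rewrite !ler_norml => /andP[a1 a2] /andP[b1 b2] b3.
have cq : 0 <= c * q by rewrite mulr_ge0 ?(ltW c0).
have e1 : c / 2 * q = c * q / 2 by rewrite mulrAC.
have e2 : (K + c) * q = K * q + c * q by rewrite mulrDl.
rewrite e1 in a1 a2 *; rewrite e2.
by apply/andP; split; rewrite ler_wsqrtr//; lra.
Qed.


Definition speed (c : chart R G n) (u : R -> V) (t : R) : R :=
  Num.sqrt (form (gram m c (u t)) (derive1 u t) (derive1 u t)).

Lemma segment_lengthE c u :
  segment_length m c u = (\int[lebesgue_measure]_(t in `[0, 1]) speed c u t)%R.
Proof. by []. Qed.

Lemma speed_ge0 c u t : 0 <= speed c u t.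
Proof. exact: sqrtr_ge0. Qed.

Lemma form_cvg2 (T : Type) (F : set_system T) {FF : Filter F}
    (S : T -> 'M[R]_n) (f : T -> V) S0 v0 :
  S @ F --> S0 -> f @ F --> v0 ->
  (form (S x) (f x) (f x) : R) @[x --> F] --> (form S0 v0 v0 : R).
Proof.
move=> cS cf.
have E S' v' : form S' v' v' = \sum_j (\sum_i v' 0 i * S' i j) * v' 0 j :> R.
  by rewrite /form mxE; apply: eq_bigr => j _; rewrite !mxE.
rewrite E; under eq_cvg do rewrite E.
have cfj j : (f x 0 j) @[x --> F] --> v0 0 j.
  by apply: (@cvg_comp _ _ _ f (fun M : V => M 0 j) F _ _ cf); exact: coord_continuous.
have cSij i j : (S x i j) @[x --> F] --> S0 i j.
  by apply: (@cvg_comp _ _ _ S (fun M : 'M[R]_n => M i j) F _ _ cS); exact: coord_continuous.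
apply: cvg_sumr => j; apply: cvgM; last exact: cfj.
by apply: cvg_sumr => i; apply: cvgM; [exact: cfj|exact: cSij].
Qed.

Lemma speed_continuous c u t : lie_atlas c -> {for t, continuous u} ->
  {for t, continuous (derive1 u)} -> chart_cod c (u t) ->
  {for t, continuous (speed c u)}.
Proof.
move=> cA cu cdu cc.
have cg : gram m c (u s) @[s --> t] --> gram m c (u t).
  apply: (@cvg_comp _ _ _ u (gram m c) _ _ _ cu).
  exact: (gram_smooth m cA 0%N (u t) cc).
have cf := @form_cvg2 _ (nbhs t) (nbhs_filter t) _ _ _ _ cg cdu.
have h := @cvg_comp _ _ _ _ Num.sqrt _ _ _ cf (@sqrt_continuous R _).
exact: h.
Qed.


Lemma speed_integrable c u : lie_atlas c -> continuous u -> continuous (derive1 u) ->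
  (forall t, t \in `[0, 1] -> chart_cod c (u t)) ->
  lebesgue_measure.-integrable `[(0 : R), 1] (EFin \o speed c u).
Proof.
move=> cA cu cdu cc; apply: continuous_compact_integrable (@segment_compact R 0 1) _.
apply: continuous_in_subspaceT => t; rewrite inE/= => t01.
exact: (speed_continuous cA (cu t) (cdu t) (cc t t01)).
Qed.

Lemma derivable_continuous (u : R -> V) : (forall t, derivable u t 1) -> continuous u.
Proof. by move=> du t; apply/differentiable_continuous/derivable1_diffP. Qed.

(** The straight coordinate segment from the identity to [P x] is an admissible curve of speed at
    most [C * |x|]. *)
Lemma id_ball_from_coord : exists r C : R, [/\ 0 < r, 0 < C &
  forall (x : V) (eps : R), `|x| <= r -> C * `|x| < eps -> id_ball m eps (P x)].
Proof.
have [r [c [C [r0 c0 C0 H]]]] := gram_bounds.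
exists r, C; split=> // x eps xr xe.
pose u (t : R) : V := x1 + t *: x.
have du (t : R) : is_derive (t : R) (1 : R) u x.
  have h1 : is_derive (t : R) (1 : R) (fun s : R => s *: x) ((1 : R) *: x).
    apply: DeriveDef; first by apply/diff_derivable; apply: ex_diff.
    by rewrite deriveE; [rewrite diff_val|apply: ex_diff].
  have h2 := @is_deriveD _ _ _ (cst x1) (fun s : R => s *: x) t 1 _ _ (is_derive_cst _ _ _) h1.
  by rewrite add0r scale1r in h2.
have u1E : derive1 u = cst x by apply/funext => t; rewrite derive1E; have [_ ->] := du t.
have tx (t : R) : t \in `[0, 1] -> `|t *: x| <= r.
  rewrite in_itv /= => /andP[t0 t1]; rewrite normrZ ger0_norm//.
  by apply: le_trans xr; rewrite ler_piMl.
have ucod t : t \in `[0, 1] -> cod (u t) by move=> /tx/H => /(_ x)[].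
have cdu : continuous (derive1 u) by rewrite u1E; exact: cst_continuous.
have du' (t : R) : derivable u t 1 by have [] := du t.
have cl0 : curve_length m (psi (u 1)) (P x) 0.
  by rewrite /u scale1r; exact: curve_length_nil.
have cl := curve_length_cons (id_chart_atlas G) du' cdu ucod cl0.
rewrite addr0 /u scale0r addr0 chart_mapK in cl; last exact: id_chart_dom.
rewrite /id_ball /= /riemannian_dist.
apply: (@le_lt_trans _ _ (segment_length m (id_chart G) u)%:E).
  by apply: ereal_inf_lbound; exists (segment_length m (id_chart G) u).
rewrite lte_fin; apply: le_lt_trans xe; rewrite segment_lengthE.
have mI : measurable (`[0, 1]%classic : set R) by exact: measurable_itv.
apply: (@le_trans _ _ (\int[lebesgue_measure]_(t in `[(0 : R), 1]) (C * `|x|))%R).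
  apply: le_Rintegral => //.
  - by apply: speed_integrable => //; [exact: id_chart_atlas|exact: derivable_continuous].
  - apply: continuous_compact_integrable (@segment_compact R 0 1) _.
    by apply: continuous_subspaceT => ?; exact: cst_continuous.
  - move=> t t01; have [_ /andP[_ h]] := H _ x (tx t t01).
    by rewrite /speed u1E.
rewrite Rintegral_cst//=; have h := @lebesgue_measure_itv R `[0, 1].
by rewrite /= lte01 sube0 in h; rewrite h/= mulr1.
Qed.

End Metric.

(** * Confinement of short curves to the identity chart *)

Section Distance.
Context {R : realType} {n : nat} {G : lieGroup R n} (m : riemannian_metric G).
Local Notation V := 'rV[R]_n.
Local Notation phi := (chart_map (id_chart G)).
Local Notation psi := (chart_inv (id_chart G)).
Local Notation x1 := (phi 1%g).
Local Notation dom := (chart_dom (id_chart G)).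
Local Notation cod := (chart_cod (id_chart G)).
Local Notation P := (@from_coord R n G).
Local Notation Q := (@to_coord R n G).
Local Notation gm := (gram m (id_chart G)).

Variables (r c0 : R).
Hypothesis c0_gt0 : 0 < c0.
Hypothesis bounds : forall x v : V, `|x| <= r ->
  cod (x1 + x) /\ c0 * `|v| <= Num.sqrt (form (gm (x1 + x)) v v : R).

Section Segment.
Variables (c : chart R G n) (u : R -> V).
Hypothesis cA : lie_atlas c.
Hypothesis du : forall t, derivable u t 1.
Hypothesis cdu : continuous (derive1 u).
Hypothesis cc : forall t, t \in `[0, 1] -> chart_cod c (u t).

Let cu : continuous u. Proof. exact: derivable_continuous. Qed.

Let gamma (t : R) : G := chart_inv c (u t).
Let good (s : R) : Prop := dom (gamma s) /\ `|Q (gamma s)| < r.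

(** By [gram_change], the speed measured in the chart [c] of the segment can be read in the identity
    chart, where [bounds] applies. *)
Lemma segment_derivative (t : R) : t \in `[0, 1] -> good t ->
  derivable (fun s => Q (gamma s)) t 1 /\
  c0 * `|'D_1 (fun s => Q (gamma s)) t| <= speed m c u t.
Proof.
move=> t01 [gd gr].
pose tau := phi \o chart_inv c.
have dtau : differentiable tau (u t).
  have [+ _] := lie_atlas_compatible cA (id_chart_atlas G) 1%N.
  by apply; split; [exact: cc|exact: gd].
have dut : differentiable u t by apply/derivable1_diffP.
pose w := derive1 u t.
have dtu : is_derive t (1 : R) (tau \o u) ('D_w tau (u t)).
  apply: DeriveDef.
    by apply/derivable1_diffP; exact: differentiable_comp.
  have e1 : 'D_1 (tau \o u) t = 'd (tau \o u) t 1.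
    by apply: deriveE; exact: differentiable_comp.
  have e2 : 'd (tau \o u) t 1 = 'd tau (u t) ('d u t 1).
    have e := diff_comp dut dtau.
    exact: (congr1 (fun h : R -> V => h (1 : R)) e).
  have e3 : 'd u t 1 = w := etrans (esym (deriveE _ dut)) (esym (derive1E u t)).
  have e4 : 'D_w tau (u t) = 'd tau (u t) w := deriveE w dtau.
  exact: etrans e1 (etrans e2 (etrans (congr1 ('d tau (u t)) e3) (esym e4))).
have dQ : is_derive t (1 : R) (fun s => Q (gamma s)) ('D_w tau (u t)).
  have h := @is_deriveB _ _ _ (tau \o u) (cst x1) t 1 _ _ dtu (is_derive_cst _ _ _).
  by rewrite subr0 in h; exact: h.
split; first by have [] := dQ.
have [_ ->] := dQ.
have qr : `|Q (gamma t)| <= r by exact: ltW.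
have [_ h] := bounds ('D_w tau (u t)) qr.
apply: le_trans h _; rewrite /speed -/w.
have -> : x1 + Q (gamma t) = tau (u t) by rewrite /to_coord addrC subrK.
rewrite /form (gram_change m _ _ cA (id_chart_atlas G) (cc t01))//; exact: gd.
Qed.

Lemma segment_increment (T : R) : T \in `[0, 1] ->
  (forall t, t \in `[0, T] -> good t) ->
  c0 * `|Q (gamma T) - Q (gamma 0)| <= segment_length m c u.
Proof.
rewrite in_itv /= => /andP[T0 T1] gT.
have s0 : 0 <= segment_length m c u by apply: Rintegral_ge0 => t _; exact: speed_ge0.
have dk t : t \in `[0, T] -> t \in `[0, 1].
  by rewrite !in_itv /= => /andP[-> tT]; exact: le_trans T1.
rewrite mulrC -ler_pdivlMr//.
apply: row_norm_le => [|j]; first by rewrite divr_ge0// ltW.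
have mxB (v w : V) : (v - w) 0 j = v 0 j - w 0 j by rewrite !mxE.
rewrite ler_pdivlMr// mxB mulrC.
pose z (t : R) : R := Q (gamma t) 0 j.
have -> : c0 * `|Q (gamma T) 0 j - Q (gamma 0) 0 j| = `|(c0 * z T) - (c0 * z 0)|.
  by rewrite -mulrBr normrM gtr0_norm.
apply: (@integral_bound_increment R (speed m c u) (fun t => c0 * z t) T).
- move=> t t01; have tI : t \in `[0, 1] by rewrite in_itv.
  exact: (speed_continuous cA (@cu t) (@cdu t) (cc tI)).
- by move=> t _; exact: speed_ge0.
- by rewrite T0.
move=> t t0T; have tT : t \in `[0, T] by rewrite in_itv.
have [d1 d2] := segment_derivative (dk t tT) (gT t tT).
have dz : is_derive t (1 : R) z ('D_1 (fun s => Q (gamma s)) t 0 j).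
  split; first exact: (derivable_mxP _ _ _).1 d1 0 j.
  by rewrite (derive_mx d1) mxE.
have dcz : is_derive t (1 : R) (fun t => c0 * z t) (c0 * 'D_1 (fun s => Q (gamma s)) t 0 j).
  by have := is_deriveZ c0 dz.
split; first by have [] := dcz.
have [_ ->] := dcz; apply: le_trans d2.
by rewrite normrM gtr0_norm// ler_wpM2l ?(ltW c0_gt0)// coord_norm_le.
Qed.

Variable x : V.
Hypothesis gamma0 : gamma 0 = P x.
Hypothesis short : segment_length m c u < c0 * (r - `|x|).

Let del : R := segment_length m c u / c0.

Let del0 : 0 <= del.
Proof. by rewrite divr_ge0 ?(ltW c0_gt0)//; apply: Rintegral_ge0 => t _; exact: speed_ge0. Qed.

Let xdel : `|x| + del < r.
Proof. by rewrite addrC -ltrBrDr ltr_pdivrMr// mulrC. Qed.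

Let xr : `|x| <= r.
Proof. by apply: ltW; apply: le_lt_trans xdel; rewrite lerDl. Qed.

Let Qx : Q (gamma 0) = x.
Proof. by rewrite gamma0 from_coordK//; have [] := bounds 0 xr. Qed.

Let good_bound (T : R) : T \in `[0, 1] -> (forall t, t \in `[0, T] -> good t) ->
  `|Q (gamma T) - x| <= del.
Proof.
move=> T01 gT; rewrite /del ler_pdivlMr// mulrC.
by have := segment_increment T01 gT; rewrite Qx.
Qed.

Let K : set G := P @` [set y | `|y| <= `|x| + del].

Let K_closed : closed K.
Proof.
apply: compact_closed; first exact: lie_hausdorff.
apply: continuous_compact.
  apply: continuous_in_subspaceT => y; rewrite inE /= => yx.
  apply: from_coord_continuous; have [] // := bounds 0 (x := y).
  exact/ltW/(le_lt_trans yx).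
apply: bounded_closed_compact.
  by exists (`|x| + del); split; [exact: num_real|move=> M xM v /= vx; apply: le_trans vx (ltW xM)].
have -> : [set y : V | `|y| <= `|x| + del] = (fun v : V => `|v|) @^-1` [set t : R | t <= `|x| + del] by [].
by apply: closed_comp; [move=> v _; exact: norm_continuous|exact: closed_le].
Qed.

Let gamma_continuous t : t \in `[0, 1] -> {for t, continuous gamma}.
Proof.
move=> t01; apply: (@cvg_comp _ _ _ u (chart_inv c) _ _ _ (@cu t)).
exact: chart_inv_continuous (cc t01).
Qed.

Let good_K (T : R) : T \in `[0, 1] -> (forall t, t \in `[0, T] -> good t) -> K (gamma T).
Proof.
move=> T01 gT; have /gT[gd _] : T \in `[0, T].
  by move: T01; rewrite !in_itv /= lexx => /andP[->].
exists (Q (gamma T)); last exact: to_coordK.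
rewrite /= -(subrK x (Q (gamma T))) addrC; apply: le_trans (ler_normD _ _) _.
by rewrite lerD2l good_bound.
Qed.

Let K_good_near (t : R) : t \in `[0, 1] -> K (gamma t) -> \forall s \near t, good s.
Proof.
move=> t01 [y /= yd yE].
have yr : `|y| < r by exact: le_lt_trans xdel.
have [ycod _] := bounds 0 (ltW yr).
have gd : dom (gamma t) by rewrite -yE; exact: chart_inv_dom.
have gQ : Q (gamma t) = y by rewrite -yE from_coordK.
have gc := gamma_continuous t01.
have n1 : \forall s \near t, dom (gamma s).
  by apply: gc; apply: open_nbhs_nbhs; split; [exact: chart_dom_open|].
have n2 : \forall s \near t, `|Q (gamma s)| < r.
  have qc : Q (gamma s) @[s --> t] --> Q (gamma t).
    apply: (@cvg_comp _ _ _ gamma Q _ _ _ gc); exact: to_coord_continuous.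
  have h := @cvgr_norm_lt R V R (nbhs t) (nbhs_filter t) _ _ qc r.
  by rewrite gQ in h; exact: h.
exact: filterI n1 n2.
Qed.

(* The coordinate ball [K] is closed in [G], and the curve cannot leave it at a
   first time, since up to that time its length controls the displacement. *)
Lemma segment_stays : exists x', gamma 1 = P x' /\ c0 * `|x' - x| <= segment_length m c u.
Proof.
pose A : set R := [set T | T \in `[0, 1] /\ forall t, t \in `[0, T] -> good t].
have A1 : A 1.
  have A0 : A 0.
    split; first by rewrite in_itv/= lexx ler01.
    move=> t; rewrite in_itv /= => t0; have -> : t = 0 by apply/eqP; rewrite eq_le andbC.
    split; last by rewrite Qx; apply: le_lt_trans xdel; rewrite lerDl.
    by rewrite gamma0; apply: chart_inv_dom; have [] := bounds 0 xr.
  have uA : ubound A 1 by move=> t [/andP[]].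
  have hA : has_sup A by split; [exists 0|exists 1].
  pose T := sup A.
  have T1 : T <= 1 by apply: ge_sup => //; exists 0.
  have T0 : 0 <= T by apply: (ub_le_sup hA.2).
  have T01 : T \in `[0, 1] by rewrite in_itv/= T0 T1.
  have KT : K (gamma T).
    apply: contrapT => nK.
    have nn : \forall s \near T, ~ K (gamma s).
      have gc := gamma_continuous T01.
      have nK' : nbhs (gamma T) (~` K).
        by apply: open_nbhs_nbhs; split=> //; rewrite openC.
      exact: gc nK'.
    have [e /= e0 He] := (nbhs_ballP _ _).1 nn.
    have [s As Ts] := sup_adherent e0 hA.
    apply: (He s); last exact: (good_K As.1 As.2).
    have sT : s <= T by apply: (ub_le_sup hA.2).
    by rewrite /ball /= ger0_norm ?subr_ge0//; move: Ts; rewrite -/T; lra.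
  have [e /= e0 He] := (nbhs_ballP _ _).1 (K_good_near T01 KT).
  have gT s : 0 <= s < T + e -> good s.
    move=> /andP[s0 sT]; have [sTe|sTe] := leP s (T - e / 2).
      have e20 : 0 < e / 2 by rewrite divr_gt0.
      have [t [_ gt] Tt] := sup_adherent e20 hA; apply: gt.
      by rewrite in_itv /= s0 (le_trans sTe)// ltW.
    apply: He; rewrite /ball /= ltr_norml; apply/andP; split; lra.
  have [Te|Te] := leP (T + e / 2) 1.
    have : T + e / 2 <= T.
      apply: (ub_le_sup hA.2); split.
        by rewrite in_itv /= Te andbT addr_ge0// divr_ge0// ltW.
      by move=> t; rewrite in_itv /= => /andP[t0 tT]; apply: gT; lra.
    by lra.
  split; first by rewrite in_itv/= lexx ler01.
  by move=> t; rewrite in_itv /= => /andP[t0 tT]; apply: gT; lra.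
have [gd _] : good 1 by apply: A1.2; rewrite in_itv/= lexx ler01.
exists (Q (gamma 1)); split; first by rewrite to_coordK.
by rewrite mulrC -ler_pdivlMr//; exact: good_bound A1.1 A1.2.
Qed.

End Segment.
Lemma curve_length_ge0 (y g : G) l : curve_length m y g l -> 0 <= l.
Proof.
elim=> // c u z l' _ _ _ _ _ l0; rewrite addr_ge0//.
by apply: Rintegral_ge0 => t _; exact: speed_ge0.
Qed.

(** Along the concatenation the budget [c0 * (r - |x|)] shrinks by at most the length of each
    segment, so the remaining length satisfies the hypothesis at the next starting point. *)
Lemma curve_stays (y g : G) l : curve_length m y g l ->
  forall x : V, y = P x -> l < c0 * (r - `|x|) ->
  exists z, g = P z /\ c0 * `|z - x| <= l.
Proof.
elim=> [h x -> _|c u z l' cA du cdu cc cl IH x yx lx].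
  by exists x; rewrite subrr normr0 mulr0.
have l0 := curve_length_ge0 cl.
have short : segment_length m c u < c0 * (r - `|x|).
  by apply: le_lt_trans lx; rewrite lerDl.
have [x' [x'E x'x]] := segment_stays cA du cdu cc yx short.
have c0x : c0 * `|x'| <= c0 * `|x| + segment_length m c u.
  apply: (@le_trans _ _ (c0 * `|x| + c0 * `|x' - x|)); last by rewrite lerD2l.
  rewrite -mulrDr ler_wpM2l ?(ltW c0_gt0)//.
  by have := ler_normD x (x' - x); rewrite addrC subrK.
have [|w [wE wx]] := IH x' x'E.
  by move: lx c0x; rewrite !mulrBr; lra.
exists w; split => //.
apply: (@le_trans _ _ (c0 * `|w - x'| + c0 * `|x' - x|)); last first.
  by rewrite addrC lerD.
rewrite -mulrDr ler_wpM2l ?(ltW c0_gt0)//.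
by have := ler_normD (w - x') (x' - x); rewrite addrA subrK.
Qed.

End Distance.

Lemma to_coord_id_ball (R : realType) (n : nat) (G : lieGroup R n)
    (m : riemannian_metric G) : exists C eps0 : R, [/\ 0 < C, 0 < eps0 &
  forall (eps : R) (g : G), eps < eps0 -> id_ball m eps g ->
    exists2 z : 'rV[R]_n, g = from_coord G z & `|z| <= C * eps].
Proof.
have [r [c [C [r0 c0 _ H]]]] := gram_bounds m.
exists c^-1, (c * r); split; rewrite ?invr_gt0 ?mulr_gt0// => eps g er.
move=> /ereal_inf_lt[_ [l cl <-]]; rewrite lte_fin => leps.
have [|||z [gz zl]] := @curve_stays R n G m r c c0 _ _ _ _ cl 0.
- by move=> x v xr; have [? /andP[? _]] := H x v xr.
- by rewrite from_coord0.
- by rewrite normr0 subr0; exact: lt_trans er.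
exists z => //; rewrite mulrC ler_pdivlMr// mulrC ltW//.
by apply: le_lt_trans leps; rewrite subr0 in zl.
Qed.

(** * The contraction argument *)

(** The map [v |-> v - f v + w0] contracts the ball of radius [2 * |w0|] into itself by the factor
    one half, and its fixed point solves the equation; the choice of the ball gives the bound on
    [w]. *)
Lemma near_identity_onto (R : realType) (n : nat) (f : 'rV[R]_n -> 'rV[R]_n) (s : R) :
  f 0 = 0 -> (forall v w, `|v| <= s -> `|w| <= s ->
    `|f v - f w - (v - w)| <= 2^-1 * `|v - w|) ->
  forall w0, 2 * `|w0| <= s -> exists2 w, f w = w0 & `|w| <= 2 * `|w0|.
Proof.
move=> f0 fl w0 ws; pose U := [set v : 'rV[R]_n | `|v| <= 2 * `|w0|].
pose T v := v - f v + w0.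
have w00 : 0 <= `|w0| := normr_ge0 w0.
have U0 : U 0 by rewrite /U /= normr0 mulr_ge0.
have Us v : U v -> `|v| <= s by move=> Uv; apply: le_trans ws.
have TT v w : U v -> U w -> `|T v - T w| <= 2^-1 * `|v - w|.
  move=> /Us vs /Us ws'; rewrite -normrN.
  have -> : - (T v - T w) = f v - f w - (v - w).
    by apply/rowP => j; rewrite !mxE; ring.
  exact: fl.
have TU v : U v -> U (T v).
  move=> Uv; have := TT v 0 Uv U0; rewrite subr0 {2}/T f0 subrr add0r => Tv.
  rewrite /U /= -(subrK w0 (T v)); apply: le_trans (ler_normD _ _) _.
  by move: Tv Uv; rewrite /U /=; lra.
pose TF : {fun U >-> U} := mkfun_fun (TU : set_fun U U T).
have q0 : (0 : R) <= 2^-1 by rewrite invr_ge0.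
have TC : is_contraction TF.
  exists (NngNum q0); split; first by rewrite /= invf_lt1// ltr1n.
  by move=> [v w] /= [Uv Uw]; exact: TT.
have cU : closed U.
  have -> : U = (fun v : 'rV[R]_n => `|v|) @^-1` [set t : R | t <= 2 * `|w0|] by [].
  by apply: closed_comp; [move=> v _; exact: norm_continuous|exact: closed_le].
have [|w Uw wT] := banach_fixed_point TC cU; first by exists 0.
exists w => //; apply/eqP; rewrite -subr_eq0 -oppr_eq0 opprB.
have : T w - w = 0 by rewrite -[T w]wT subrr.
by rewrite /T => <-; apply/eqP/rowP => j; rewrite !mxE; ring.
Qed.

(** * Lipschitz estimates for triple products of exponentials *)

Section TripleProduct.
Context {R : realType} {n : nat} (G : lieGroup R n).
Local Notation V := 'rV[R]_n.
Local Notation C := (mul_const G).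
Local Notation r := (mul_radius G).
Local Notation rho := (exp_radius G).
Local Notation E := (coord_exp G).
Local Notation m := (@coord_mul R n G).

Definition triple (x y z : V) : V := m (m (E x) (E y)) (E z).

(** The margin in [10 * t <= rho] keeps the intermediate coordinates below, of size up to [5 * t],
    inside the radius of the local product. *)
Lemma exp_pair (t d : R) (x y : V) : 10 * t <= rho -> `|x| <= t -> `|y| <= t ->
  0 < t -> `|x - y| <= d ->
  [/\ `|E x| <= 2 * t, `|E x - E y| <= 2 * d &
      `|E x - E y - (x - y)| <= 4 * (C * t * d)].
Proof.
move=> tr xt yt t0 xyd.
have C0 := mul_const_gt0 G.
have x0 : 0 <= `|x| := normr_ge0 x.
have y0 : 0 <= `|y| := normr_ge0 y.
have d0 : 0 <= `|x - y| := normr_ge0 (x - y).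
have x2 : 2 * `|x| < rho by lra.
have y2 : 2 * `|y| < rho by lra.
have H : `|E x - E y - (x - y)| <= 4 * (C * t * d).
  apply: le_trans (coord_exp_estimate _ x2 y2 xt yt) _; first by lra.
  by rewrite !mulrA ler_wpM2l// !mulr_ge0// ltW.
have Ct : 4 * (C * t * d) <= d.
  have := exp_radius_const G => h.
  have : C * t <= C * rho by rewrite ler_pM2l//; lra.
  rewrite -mulrA in h; move=> h'.
  by rewrite mulrA ler_piMl ?(le_trans d0)//; lra.
split=> //; first by apply: le_trans (coord_exp_le x2) _; lra.
have h : `|E x - E y| <= `|E x - E y - (x - y)| + `|x - y|.
  by have := ler_normD (E x - E y - (x - y)) (x - y); rewrite subrK.
apply: le_trans h _; lra.
Qed.


Lemma radius_scale (t : R) : 0 < t -> 10 * t <= rho -> 40 * (C * t) <= 1.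
Proof.
move=> t0 tr; have h := exp_radius_const G.
have : C * (10 * t) <= C * rho by rewrite ler_pM2l// mul_const_gt0.
rewrite mulrCA; rewrite -mulrA in h; move: (C * t) (C * rho) h => a b; lra.
Qed.

Lemma pair_product (t d : R) (x y x' y' : V) : 0 < t -> 10 * t <= rho -> 0 <= d ->
  `|x| <= 2 * t -> `|y| <= 2 * t -> `|x'| <= 2 * t -> `|y'| <= 2 * t ->
  `|x - x'| <= 2 * d -> `|y - y'| <= 2 * d ->
  [/\ `|m x y| <= 5 * t, `|m x y - m x' y'| <= 5 * d &
      `|m x y - m x' y' - (x - x') - (y - y')| <= 8 * (C * t * d)].
Proof.
move=> t0 tr d0 xt yt x't y't xd yd.
have C0 := mul_const_gt0 G; have rr := exp_radius_lt G; have r0 := mul_radius_gt0 G.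
have Ct := radius_scale t0 tr.
have H : `|m x y - m x' y' - (x - x') - (y - y')| <= 8 * (C * t * d).
  apply: le_trans (coord_mul_lip _ _ _ _) _; [lra|lra|lra|lra|].
  have -> : 8 * (C * t * d) = C * (2 * t * (2 * d) + 2 * t * (2 * d)) by ring.
  by rewrite ler_pM2l// lerD// ler_pM.
have H0 : `|m x y - x - y| <= C * (4 * t * t).
  have := @coord_mul_lip R n G x y 0 0; rewrite normr0 !subr0 mul0r addr0.
  rewrite (@coord_mul0r R n G 0) ?normr0// subr0 => h.
  apply: le_trans (h _ _ _ _) _; [lra|lra|lra|lra|].
  have -> : 4 * t * t = 2 * t * (2 * t) by ring.
  by rewrite ler_pM2l// ler_pM.
have Ctt : C * (4 * t * t) <= t.
  have -> : C * (4 * t * t) = 4 * (C * t) * t by ring.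
  by rewrite ler_piMl ?ltW//; lra.
have Ctd : 8 * (C * t * d) <= d by rewrite mulrA ler_piMl//; lra.
split=> //.
- have : `|m x y| <= `|m x y - x - y| + (`|x| + `|y|).
    rewrite -[X in `|X| <= _](subrK y) -[X in `|X + y| <= _](subrK x) -addrA.
    have -> : m x y - y - x = m x y - x - y by rewrite addrAC.
    by apply: le_trans (ler_normD _ _) _; rewrite lerD2l ler_normD.
  move: H0 Ctt xt yt; move: (`|m x y - x - y|) (C * (4 * t * t)) (`|m x y|) => a b c; lra.
- have : `|m x y - m x' y'| <= `|m x y - m x' y' - (x - x') - (y - y')| +
      (`|x - x'| + `|y - y'|).
    move: (m x y - m x' y') (x - x') (y - y') => w u v.
    rewrite -[X in `|X| <= _](subrK v) -[X in `|X + v| <= _](subrK u) -addrA.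
    have -> : w - v - u = w - u - v by rewrite addrAC.
    by apply: le_trans (ler_normD _ _) _; rewrite lerD2l ler_normD.
  move: H Ctd xd yd; move: (`|_ - _ - _ - _|) (`|m x y - m x' y'|) (8 * (C * t * d)) => a b c; lra.
Qed.

(** In coordinates the triple product is addition up to a map of Lipschitz constant of order [t].
    The 40 is 20 for the outer product, 8 for the inner one and 4 for each of the three
    exponentials. *)
Lemma triple_lip (t d : R) (x y z x' y' z' : V) : 0 < t -> 10 * t <= rho ->
  `|x| <= t -> `|y| <= t -> `|z| <= t -> `|x'| <= t -> `|y'| <= t -> `|z'| <= t ->
  `|x - x'| <= d -> `|y - y'| <= d -> `|z - z'| <= d ->
  `|triple x y z - triple x' y' z' - (x - x' + (y - y') + (z - z'))| <= 40 * (C * t * d).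
Proof.
move=> t0 tr xt yt zt x't y't z't xd yd zd.
have d0 : 0 <= d by apply: le_trans xd.
have C0 := mul_const_gt0 G; have rr := exp_radius_lt G.
have s2 (u : R) : u <= 2 * t -> u < r by lra.
have s5 (u : R) : u <= 5 * t -> u < r by lra.
have [ax axd hx] := exp_pair tr xt x't t0 xd.
have [ay ayd hy] := exp_pair tr yt y't t0 yd.
have [az azd hz] := exp_pair tr zt z't t0 zd.
have xd' : `|x' - x| <= d by rewrite distrC.
have yd' : `|y' - y| <= d by rewrite distrC.
have zd' : `|z' - z| <= d by rewrite distrC.
have [ax' _ _] := exp_pair tr x't xt t0 xd'.
have [ay' _ _] := exp_pair tr y't yt t0 yd'.
have [az' _ _] := exp_pair tr z't zt t0 zd'.
have [p5 pd hp] := pair_product t0 tr d0 ax ay ax' ay' axd ayd.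
have axd' : `|E x' - E x| <= 2 * d by rewrite distrC.
have ayd' : `|E y' - E y| <= 2 * d by rewrite distrC.
have [p5' _ _] := pair_product t0 tr d0 ax' ay' ax ay axd' ayd'.
have hq : `|triple x y z - triple x' y' z' - (m (E x) (E y) - m (E x') (E y'))
    - (E z - E z')| <= 20 * (C * t * d).
  apply: le_trans (coord_mul_lip (s5 _ p5) (s2 _ az) (s5 _ p5') (s2 _ az')) _.
  have -> : 20 * (C * t * d) = C * (2 * t * (5 * d) + 5 * t * (2 * d)) by ring.
  by rewrite ler_pM2l// lerD// ler_pM.
move: hq hp hx hy hz; rewrite /triple.
move: (m (m (E x) (E y)) (E z) - m (m (E x') (E y')) (E z')) => Q.
move: (m (E x) (E y) - m (E x') (E y')) => p.
move: (E x - E x') (E y - E y') (E z - E z') (x - x') (y - y') (z - z') => a b c u v w.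
move: (C * t * d) => k h1 h2 h3 h4 h5.
have -> : Q - (u + v + w) = (Q - p - c) + (p - a - b) + (a - u) + (b - v) + (c - w).
  by apply/rowP => j; rewrite !mxE; ring.
have nD (f g : V) : `|f + g| <= `|f| + `|g| := ler_normD f g.
have := nD (Q - p - c + (p - a - b) + (a - u) + (b - v)) (c - w).
have := nD (Q - p - c + (p - a - b) + (a - u)) (b - v).
have := nD (Q - p - c + (p - a - b)) (a - u).
have := nD (Q - p - c) (p - a - b).
lra.
Qed.

Lemma triple_lexp (t : R) (x y z : V) : 0 < t -> 10 * t <= rho ->
  `|x| <= t -> `|y| <= t -> `|z| <= t ->
  from_coord G (triple x y z) = (lexp G x * lexp G y * lexp G z)%g.
Proof.
move=> t0 tr xt yt zt.
have xx : `|x - x| <= 0 by rewrite subrr normr0.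
have yy : `|y - y| <= 0 by rewrite subrr normr0.
have zz : `|z - z| <= 0 by rewrite subrr normr0.
have [ax axd _] := exp_pair tr xt xt t0 xx.
have [ay ayd _] := exp_pair tr yt yt t0 yy.
have [az _ _] := exp_pair tr zt zt t0 zz.
have [p5 _ _] := pair_product t0 tr (lexx 0) ax ay ax ay axd ayd.
have rr := exp_radius_lt G; have r0 := mul_radius_gt0 G.
rewrite /triple from_coord_mul; [|lra|lra].
rewrite from_coord_mul; [|lra|lra].
by rewrite !lexp_small//; lra.
Qed.

End TripleProduct.

(** The path [t |-> lexp (t *: Z)] joins 1 to the exponential within the fixed points. The component
    matters because [H] is tied to [sigma] through identity components. *)
Lemma fixed_lexp_component (R : realType) (n : nat) (G : lieGroup R n)
    (f : G -> G) (Z : 'rV[R]_n) : lie_hom f -> lie_diff f Z = Z ->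
  connected_component [set x | f x = x] 1%g (lexp G Z).
Proof.
move=> hf fZ.
have [gc _ _] := lexp_one_parameter G Z.
pose g (t : R) : G := lexp G (t *: Z).
apply: (@connected_component_max _ _ (g @` `[0, 1])).
- by exists 0; rewrite /g ?scale0r ?lexp0//= in_itv/= lexx ler01.
- move=> _ [t _ <-] /=; rewrite /g (lie_hom_lexp (t *: Z) hf).
  by have e := lie_diffZ t Z hf; rewrite fZ in e; rewrite e.
- apply: connected_continuous_connected; first exact: segment_connected.
  by apply: continuous_subspaceT; exact: gc.
- by exists 1; rewrite /g ?scale1r//= in_itv/= lexx ler01.
Qed.

Lemma id_ball_lexp (R : realType) (n : nat) (G : lieGroup R n)
    (m : riemannian_metric G) : exists r C : R, [/\ 0 < r, 0 < C &
  forall (v : 'rV[R]_n) (eps : R), `|v| <= r -> C * `|v| < eps ->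
    id_ball m eps (lexp G v)].
Proof.
have [r [C [r0 C0 H]]] := id_ball_from_coord m.
have rho0 := exp_radius_gt0 G.
exists (Num.min (r / 2) (exp_radius G / 3)), (2 * C); split.
- by rewrite lt_min !divr_gt0.
- by rewrite mulr_gt0.
move=> v eps; rewrite le_min => /andP[vr vrho] ve.
have v0 : 0 <= `|v| := normr_ge0 v.
have v2 : 2 * `|v| < exp_radius G by lra.
rewrite lexp_small//; have Ev := coord_exp_le v2.
apply: H; first lra.
apply: le_lt_trans ve; have -> : 2 * C * `|v| = C * (2 * `|v|) by ring.
by rewrite ler_wpM2l ?(ltW C0).
Qed.

(** The radius [s] is chosen before the three linear maps and depends on [D] and the group alone;
    this makes the final radius independent of [k] and [b]. *)
Lemma triple_onto (R : realType) (n : nat) (G : lieGroup R n) (D : R) : 0 < D ->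
  exists2 s : R, 0 < s & forall a1 a2 a3 : 'rV[R]_n -> 'rV[R]_n,
    linear a1 -> linear a2 -> linear a3 ->
    (forall w, a1 w + a2 w + a3 w = w) ->
    (forall w, [/\ `|a1 w| <= D * `|w|, `|a2 w| <= D * `|w| & `|a3 w| <= D * `|w|]) ->
    forall w0, `|w0| <= s -> exists2 w, `|w| <= 2 * `|w0| &
      from_coord G w0 = (lexp G (a1 w) * lexp G (a2 w) * lexp G (a3 w))%g.
Proof.
move=> D0; have C0 := mul_const_gt0 G; have rho0 := exp_radius_gt0 G.
pose C := mul_const G; pose rho := exp_radius G.
(* The first bound gives [10 * t <= rho] for [t = D * s]; the second makes the Lipschitz constant
   [40 * C * t * D] at most one half. *)
pose s := Num.min (rho / (10 * D)) (80 * C * D * D)^-1.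
have s0 : 0 < s by rewrite lt_min !(divr_gt0, invr_gt0, mulr_gt0).
pose t := D * s.
have t0 : 0 < t by rewrite mulr_gt0.
have tr : 10 * t <= rho.
  have : s <= rho / (10 * D) by rewrite ge_min lexx.
  by rewrite ler_pdivlMr ?mulr_gt0// /t mulrC mulrA mulrAC.
have ts : 80 * (C * t * D) <= 1.
  have : s <= (80 * C * D * D)^-1 by rewrite ge_min lexx orbT.
  rewrite -[X in _ <= X]div1r ler_pdivlMr ?mulr_gt0//.
  by have -> : s * (80 * C * D * D) = 80 * (C * t * D) by rewrite /t; ring.
exists (s / 2) => [|a1 a2 a3 l1 l2 l3 asum ab w0 w0s]; first by rewrite divr_gt0.
have lB (a : 'rV[R]_n -> 'rV[R]_n) v w : linear a -> a v - a w = a (v - w).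
  by move=> /linear_packed[g ->]; rewrite linearB.
have at_ (w : 'rV[R]_n) : `|w| <= s -> [/\ `|a1 w| <= t, `|a2 w| <= t & `|a3 w| <= t].
  move=> ws; have [h1 h2 h3] := ab w.
  have h : D * `|w| <= t by rewrite ler_pM2l.
  by split; apply: le_trans h.
pose f w := triple G (a1 w) (a2 w) (a3 w).
have a0 (a : 'rV[R]_n -> 'rV[R]_n) : linear a -> a 0 = 0.
  by move=> /linear_packed[g ->]; rewrite linear0.
have f0 : f 0 = 0.
  have z : `|0 : 'rV[R]_n| < mul_radius G by rewrite normr0 mul_radius_gt0.
  rewrite /f (a0 a1 l1) (a0 a2 l2) (a0 a3 l3) /triple coord_exp0.
  by have e := coord_mul0r z; rewrite !e.
have [||w fw ww] := @near_identity_onto R n f s f0 _ w0.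
- move=> v w /at_[v1 v2 v3] /at_[w1 w2 w3].
  have [d1 d2 d3] := ab (v - w).
  have := @triple_lip R n G t (D * `|v - w|) _ _ _ _ _ _ t0 tr v1 v2 v3 w1 w2 w3.
  rewrite (lB a1 v w l1) (lB a2 v w l2) (lB a3 v w l3) asum => /(_ d1 d2 d3) h.
  apply: le_trans h _.
  have -> : 40 * (mul_const G * t * (D * `|v - w|)) = 40 * (C * t * D) * `|v - w|.
    by rewrite /C; ring.
  by rewrite ler_wpM2r//; lra.
- by have := normr_ge0 w0; lra.
exists w => //; rewrite -fw.
have [|w1 w2 w3] := at_ w; first by have := normr_ge0 w0; lra.
exact: triple_lexp t0 tr w1 w2 w3.
Qed.

Theorem theorem4p1 (R : realType) (n : nat) (G : lieGroup R n)
  (G_connected : connected [set: G])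
  (G_noncompact : ~ compact [set: G])
  (G_semisimple : semisimple G)
  (G_center : finite_set (group_center G))
  (sigma : G -> G) (sigma_inv : lie_involution sigma)
  (H : set G) (H_subgroup : is_subgroup H) (H_closed : closed H)
  (H_component : connected_component H 1%g =
                 connected_component [set x | sigma x = x] 1%g)
  (theta : G -> G) (theta_cartan : cartan_involution theta)
  (sigma_theta : forall x, sigma (theta x) = theta (sigma x))
  (a : {vspace 'rV[R]_n})
  (a_maximal :
     maximal_abelian_in G (minus_space theta `&` minus_space sigma) a)
  (Sigma_pos : set 'Hom(subvs_of a, R^o))
  (Sigma_pos_system : positive_system (restricted_roots G a) Sigma_pos)
  (m : riemannian_metric G) :
  let K := [set x | theta x = x] in
  let A := exp_image G a in
  let O := id_ball m in
  let tSigma_pos := Sigma_pos `&` fixed_roots a sigma theta in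
  let tDelta := simple_roots tSigma_pos in
  forall c : R, 0 < c ->
  exists l eps0 : R, [/\ 1 < l, 0 < eps0 &
    forall k b h : G, K k -> closed_chamber G tSigma_pos b -> H h ->
    (forall alpha, tDelta alpha -> c < (alpha (lie_log G a b) : R)) ->
    forall eps : R, 0 < eps -> eps < eps0 ->
    setmulg (O eps) [set (k * b * h)%g] `<=`
      setmulg (setmulg (setmulg (K `&` O (l * eps)) [set k])
                       (setmulg (A `&` O (l * eps)) [set b]))
              (setmulg (H `&` O (l * eps)) [set h])].
Proof.
move=> K A O tSigma_pos tDelta c c0.
have hth : lie_hom theta := lie_involution_hom theta_cartan.1.
have hsi : lie_hom sigma := lie_involution_hom sigma_inv.
have [CA CA0 HA] := Ad_bounded theta_cartan.
have [C1 C10 HC] := group_decomposition theta_cartan sigma_inv sigma_theta a_maximal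
  Sigma_pos_system c0.
have [rb [Cb [rb0 Cb0 Hb]]] := id_ball_lexp m.
have [C2 [e2 [C20 e20 H2]]] := to_coord_id_ball m.
(* The decomposition costs [C1]; [Ad] of the inverse of [k] before it and [Ad k] after it cost [CA]
   each. The added 1 also covers the vectors taken without the outer [Ad k]. *)
pose D : R := (CA + 1) * (C1 * CA).
have CA1 : 0 < CA + 1 by rewrite addr_gt0.
have D0 : 0 < D by rewrite !mulr_gt0.
have [s s0 Hs] := triple_onto G D0.
(* A vector bounded by [D * |W|] has norm at most [2 * D * C2 * eps], and its exponential has
   distance to the identity controlled by [Cb] times that. Doubling and adding 2 makes the
   inequality strict and [l] greater than 1. *)
pose l : R := 4 * Cb * D * C2 + 2.
(* The three bounds serve the passage to coordinates, the inequality [|w0| <= s] and the size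
   allowed in [id_ball_lexp]. *)
pose eps0 : R := Num.min e2 (Num.min (s / C2) (rb / (2 * D * C2))).
exists l, eps0; split.
- have p0 : 0 < 4 * Cb * D * C2 by rewrite !mulr_gt0.
  by rewrite /l; lra.
- by rewrite !lt_min e20 !divr_gt0// !mulr_gt0.
move=> k b h Kk [bA _] Hh bc eps eps_gt0; rewrite !lt_min => /and3P[ee2 es er].
move=> _ [x Ox [_ -> <-]].
pose Y := lie_log G a b.
have bY : lexp G (vsval Y) = b.
  (* As [b] lies in the image of [a], the value of [lie_log] at [b] is a true logarithm and not the
     default 0. *)
  rewrite -lie_expE; have [Y0 _ Y0b] := bA.
  exact: (@xgetI _ 0 [set Y : subvs_of a | lie_exp G (vsval Y) = b] Y0 Y0b).
have [sk [sa [sh [lsk lsa lsh HW]]]] := HC Y bc.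
have [w0 xw0 w0e] := H2 eps x ee2 Ox.
have Kk' : theta k^-1%g = k^-1%g.
  have kk : theta (k * k^-1)%g = (k * theta k^-1)%g.
    by have [hM _ _ _] := hth; rewrite hM (Kk : theta k = k).
  by rewrite mulgV (lie_hom1 hth) in kk; rewrite -[LHS](mulKg k) -kk mulg1.
pose W' (W : 'rV[R]_n) := Ad k^-1%g W.
have W'le W : `|W' W| <= CA * `|W| by exact: HA.
have AdK W : Ad k (W' W) = W by rewrite /W' -AdM mulgV Ad1.
(* The linear problem is solved in the frame moved by [k]; [a3] contains [Ad b] of the third part,
   never that part alone. *)
pose a1 W := Ad k (sk (W' W)).
pose a2 W := Ad k (sa (W' W)).
pose a3 W := Ad k (Ad b (sh (W' W))).
have lin (u : 'rV[R]_n -> 'rV[R]_n) : linear u -> linear (fun W => Ad k (u (W' W))).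
  by move=> lu t v w; rewrite /W' (Ad_linear k^-1%g) lu (Ad_linear k).
have asum W : a1 W + a2 W + a3 W = W.
  have [[_ _ _ e] _] := HW (W' W).
  rewrite bY in e.
  have AdD u v : Ad k (u + v) = Ad k u + Ad k v.
    by have := Ad_linear k 1 u v; rewrite !scale1r.
  by rewrite /a1 /a2 /a3 -!AdD e AdK.
(* The bound with [Ad k] serves the contraction and the factor in [K], the one without it serves the
   factors in [A] and [H]. *)
have small W u : `|u| <= C1 * `|W' W| -> `|u| <= D * `|W| /\ `|Ad k u| <= D * `|W|.
  move=> uC.
  have uC' : `|u| <= C1 * CA * `|W|.
    by apply: le_trans uC _; rewrite -mulrA ler_wpM2l ?(ltW C10).
  have -> : D * `|W| = CA * (C1 * CA * `|W|) + C1 * CA * `|W| by rewrite /D; ring.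
  move: (C1 * CA * `|W|) uC' => q uq; have q0 : 0 <= q by apply: le_trans uq.
  have CAq : 0 <= CA * q by rewrite mulr_ge0// ltW.
  split; first by apply: le_trans uq _; rewrite lerDr.
  apply: le_trans (HA k u Kk) _; apply: (@le_trans _ _ (CA * q)); last by rewrite lerDl.
  by rewrite ler_wpM2l// ltW.
have w0s : `|w0| <= s.
  by apply: le_trans w0e _; rewrite mulrC -ler_pdivlMr// ltW.
have Wb W : [/\ `|a1 W| <= D * `|W|, `|a2 W| <= D * `|W| & `|a3 W| <= D * `|W|].
  have [_ [h1 h2 _ h4]] := HW (W' W); rewrite bY in h4.
  by split; rewrite /a1 /a2 /a3; [exact: (small W _ h1).2|exact: (small W _ h2).2|
    exact: (small W _ h4).2].
have la3 : linear (fun w => Ad b (sh w)).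
  by move=> t v w; rewrite lsh (Ad_linear b).
have [W Ww xE] := Hs a1 a2 a3 (lin _ lsk) (lin _ lsa) (lin _ la3) asum Wb w0 w0s.
have [[kfix aa hfix _] [h1 h2 h3 _]] := HW (W' W).
have inO u : `|u| <= D * `|W| -> O (l * eps) (lexp G u).
  move=> uW; have uW' : `|u| <= 2 * D * C2 * eps.
    apply: le_trans uW _; have -> : 2 * D * C2 * eps = D * (2 * (C2 * eps)) by ring.
    by rewrite ler_wpM2l ?(ltW D0)//; apply: le_trans Ww _; rewrite ler_pM2l.
  apply: Hb; first by apply: le_trans uW' _; rewrite mulrC -ler_pdivlMr ?ltW// !mulr_gt0.
  have : Cb * `|u| <= Cb * (2 * D * C2 * eps) by rewrite ler_wpM2l// ltW.
  have -> : l * eps = 2 * (Cb * (2 * D * C2 * eps)) + 2 * eps by rewrite /l; ring.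
  have : 0 <= Cb * (2 * D * C2 * eps) by rewrite !mulr_ge0// ltW.
  move: (Cb * (2 * D * C2 * eps)) (Cb * `|u|) => p q; lra.
pose X := lexp G (Ad k (sk (W' W))); pose Ya := lexp G (sa (W' W)).
pose Z := lexp G (sh (W' W)).
have eY : lexp G (a2 W) = (k * Ya * k^-1)%g by rewrite /Ya conj_lexp.
have eZ : lexp G (a3 W) = (k * (b * Z * b^-1) * k^-1)%g by rewrite /Z !conj_lexp.
exists ((X * k) * (Ya * b))%g.
  exists (X * k)%g.
    exists X; last by exists k.
    split; last exact: inO (small W _ h1).2.
    rewrite /K /= /X (lie_hom_lexp _ hth) (lie_diff_Ad k (sk (W' W)) hth).
    by rewrite (Kk : theta k = k) kfix.
  exists (Ya * b)%g => //.
  exists Ya; last by exists b.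
  split; last exact: inO (small W _ h2).1.
  by exists (vsproj a (sa (W' W))) => //=; rewrite vsprojK// lie_expE.
exists (Z * h)%g.
  exists Z; last by exists h.
  split; last exact: inO (small W _ h3).1.
  (* The exponential of a vector fixed by the differential of [sigma] lies in the identity component
     of the fixed points, which is that of [H]. *)
  apply: (@connected_component_sub _ H 1%g); rewrite H_component.
  exact: fixed_lexp_component hsi hfix.
rewrite xw0 xE eY eZ -/X; move: X Ya Z {inO eY eZ} => X' Y' Z'.
by rewrite !mulgA !mulgVK.
Qed.
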